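(* Let $N$ be a positive integer and $\{r_\delta\}_{\delta\mid N}$ integers such that $f(\tau)=\prod_{0<\delta\mid N}\eta(\delta\tau)^{r_{\delta}}$ is an eta quotient of level $N$. Then $f$ is a multiplicative Hecke eigenform of level $N$.
   Context: $\eta(\tau)=q^{1/24}\prod_{n\ge1}(1-q^n)$ is the Dedekind eta function, $q=e^{2\pi i\tau}$. An eta quotient of level $N$ is $\prod_{\delta\mid N}\eta(\delta\tau)^{r_\delta}$ with $r_\delta\in\mathbb Z$ satisfying $\sum_{\delta\mid N}\delta r_\delta\equiv0$ and $\sum_{\delta\mid N}(N/\delta)r_\delta\equiv 0\pmod{24}$, so that it is a weakly holomorphic modular form of weight $\frac12\sum r_\delta$ on $\Gamma_0(N)$ with a multiplier system. $\mathcal{M}(N)$ denotes the multiplicative group of meromorphic modular forms of integer weight $k$ for $\Gamma_0(N)$ with some unitary multiplier system (i.e. $f(\gamma\tau)=\chi(\gamma)(c\tau+d)^kf(\tau)$ for $\gamma\in\Gamma_0(N)$), integer Fourier coefficients at $i\infty$ and leading coefficient 1. With $(f|_k\gamma)(\tau)=\det(\gamma)^{k/2}(c\tau+d)^{-k}f(\gamma\tau)$, for a prime $p\nmid N$ and $f\in\mathcal{M}(N)$ of weight $k$, $f|\mathcal{T}(p):=\varepsilon p^{k(p-1)/2}\prod_{ad=p,\,0\le b<d}f|_k\begin{psmallmatrix}a&b\\0&d\end{psmallmatrix}$ ($a,d>0$), $\varepsilon$ the constant making the leading coefficient $1$. $f\in\mathcal{M}(N)$ is a multiplicative Hecke eigenform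 of level $N$ if for every prime $p\nmid N$ there is $\lambda(p)\in\mathbb C$ with $f|\mathcal{T}(p)=f^{\lambda(p)}$.
   Formalization: M(N) requires integer weight, which fails when the sum of the r_δ is odd (e.g. N=4, exponents -2,5,-2); the literal claim is proved for even sum, and for odd sum with M(N) and T(p) extended to half-integral weight by the principal branch. *)

(* Defs.v *)
From Stdlib Require Import Reals ZArith List Znumtheory.
From Coquelicot Require Import Coquelicot.

Open Scope R_scope.

(** * Complex preliminaries *)

Definition Cexp (z : C) : C :=
  (exp (Re z) * cos (Im z), exp (Re z) * sin (Im z)).

(* e(z) = exp (2 pi i z); the nome is q = e(tau). *)
Definition Ce (z : C) : C := Cexp (RtoC (2 * PI) * Ci * z)%C.

(* Integral powers; since [/ 0 = 0] in [C], [Cpowz 0 n] is 0 for every n <> 0. *)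
Definition Cpowz (z : C) (n : Z) : C :=
  match n with
  | Z0 => RtoC 1
  | Zpos m => Cpow z (Pos.to_nat m)
  | Zneg m => Cinv (Cpow z (Pos.to_nat m))
  end.

(* Principal square root, with argument in (-pi/2, pi/2]. *)
Definition Csqrt (z : C) : C :=
  let y := sqrt ((Cmod z - Re z) / 2) in
  (sqrt ((Cmod z + Re z) / 2), if Rle_dec 0 (Im z) then y else - y).

Definition Cprod (l : list C) : C := fold_right Cmult (RtoC 1) l.
Definition Zsum (l : list Z) : Z := fold_right Z.add 0%Z l.

Definition divisors (N : nat) : list nat :=
  filter (fun d => Nat.eqb (Nat.modulo N d) 0) (seq 1 N).

Definition in_H (tau : C) : Prop := 0 < Im tau.

Definition near_infty (P : C -> Prop) : Prop :=
  exists Y : R, forall tau : C, Y < Im tau -> P tau.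

(** * Eta quotients *)

Definition eta_partial (tau : C) (n : nat) : C :=
  Cprod (map (fun m => RtoC 1 - Cpow (Ce tau) m)%C (seq 1 n)).

(* The partial products converge for tau in the upper half-plane; outside it
   the value is irrelevant. *)
Definition eta (tau : C) : C :=
  (Ce (tau / RtoC 24) *
   (real (Lim_seq (fun n => Re (eta_partial tau n))),
    real (Lim_seq (fun n => Im (eta_partial tau n)))))%C.

(* Only the values of r at the divisors of N are used. *)
Definition eta_quotient (N : nat) (r : nat -> Z) (tau : C) : C :=
  Cprod (map (fun d => Cpowz (eta (RtoC (INR d) * tau)%C) (r d)) (divisors N)).

Definition eta_quotient_cond (N : nat) (r : nat -> Z) : Prop :=
  (24 | Zsum (map (fun d => Z.of_nat d * r d) (divisors N)))%Z /\
  (24 | Zsum (map (fun d => Z.of_nat (N / d) * r d) (divisors N)))%Z.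

Definition eta_twice_weight (N : nat) (r : nat -> Z) : Z :=
  Zsum (map r (divisors N)).

(** * Meromorphic modular forms *)

Record mat2 : Type := Mat2 { ma : Z; mb : Z; mc : Z; md : Z }.

Definition mdet (g : mat2) : Z := (ma g * md g - mb g * mc g)%Z.

Definition SL2Z (g : mat2) : Prop := mdet g = 1%Z.

Definition Gamma0 (N : nat) (g : mat2) : Prop :=
  SL2Z g /\ (Z.of_nat N | mc g)%Z.

Definition mob_denom (g : mat2) (tau : C) : C :=
  (RtoC (IZR (mc g)) * tau + RtoC (IZR (md g)))%C.

Definition mob (g : mat2) (tau : C) : C :=
  ((RtoC (IZR (ma g)) * tau + RtoC (IZR (mb g))) / mob_denom g tau)%C.

(* z ^ (w / 2), where w is twice the weight: a plain integral power when w is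
   even, the principal branch when w is odd. *)
Definition Cpow_half (z : C) (w : Z) : C :=
  if Z.even w then Cpowz z (w / 2) else (Csqrt z * Cpowz z (w / 2))%C.

(* f |_k g for k = w / 2. *)
Definition slash (w : Z) (f : C -> C) (g : mat2) (tau : C) : C :=
  (RtoC (Rpower (IZR (mdet g)) (IZR w / 4)) *
   Cinv (Cpow_half (mob_denom g tau) w) * f (mob g tau))%C.

(* A function meromorphic on the upper half-plane and not identically zero is
   represented by a total function taking the value 0 at its poles: locally
   f(z) = (z - z0)^n u(z), u holomorphic, u(z0) <> 0, and the equation at
   z = z0 itself forces f(z0) = 0 when n < 0. *)
Definition meromorphic_on_H (f : C -> C) : Prop :=
  forall z0 : C, in_H z0 ->
  exists (n : Z) (u : C -> C) (eps : R),
    0 < eps /\ u z0 <> RtoC 0 /\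
    forall z : C, Cmod (z - z0)%C < eps ->
      @ex_derive C_AbsRing C_NormedModule u z /\
      f z = (Cpowz (z - z0) n * u z)%C.

(* Equality of meromorphic functions: the pointwise values may differ on a
   discrete subset of the upper half-plane. *)
Definition mero_eq (f g : C -> C) : Prop :=
  forall z0 : C, in_H z0 ->
  exists eps : R, 0 < eps /\
    forall z : C, 0 < Cmod (z - z0)%C < eps -> f z = g z.

(* f(tau) = sum_(n >= 0) a_n e((n + rho) tau / width) for Im tau large. *)
Definition has_expansion (f : C -> C) (width : nat) (rho : R) (a : nat -> C)
  : Prop :=
  near_infty (fun tau =>
    @is_series C_AbsRing C_NormedModule
      (fun n => (a n * Ce (RtoC ((INR n + rho) / INR width) * tau))%C)
      (f tau)).

(* At a cusp the multiplier may make the exponents non-integral, whence the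
   real shift rho. *)
Definition meromorphic_at_cusps (w : Z) (f : C -> C) : Prop :=
  forall g : mat2, SL2Z g ->
  exists (width : nat) (rho : R) (a : nat -> C),
    (0 < width)%nat /\ has_expansion (slash w f g) width rho a.

Definition leading_coef_one (f : C -> C) : Prop :=
  exists (h : Z) (a : nat -> C),
    a 0%nat = RtoC 1 /\ has_expansion f 1 (IZR h) a.

Definition integral_normalized (f : C -> C) : Prop :=
  exists (h : Z) (a : nat -> Z),
    a 0%nat = 1%Z /\
    has_expansion f 1 (IZR h) (fun n => RtoC (IZR (a n))).

(* Membership in M(N) with weight w / 2. *)
Definition modular_form (N : nat) (w : Z) (f : C -> C) : Prop :=
  meromorphic_on_H f /\
  (exists chi : mat2 -> C,
     forall g : mat2, Gamma0 N g ->
       Cmod (chi g) = 1 /\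
       forall tau : C, in_H tau ->
         f (mob g tau) = (chi g * Cpow_half (mob_denom g tau) w * f tau)%C) /\
  meromorphic_at_cusps w f /\
  integral_normalized f.

(** * Multiplicative Hecke operators *)

(* The matrices (a b; 0 d) with a d = p, a, d > 0 and 0 <= b < d. *)
Definition hecke_matrices (p : nat) : list mat2 :=
  flat_map (fun d =>
    map (fun b => Mat2 (Z.of_nat (p / d)) (Z.of_nat b) 0 (Z.of_nat d))
        (seq 0 d))
    (divisors p).

(* g = f | T(p).  The normalizing constant eps is determined by the leading
   coefficient of g being 1. *)
Definition is_hecke (w : Z) (p : nat) (f g : C -> C) : Prop :=
  meromorphic_on_H g /\ leading_coef_one g /\
  exists eps : C, mero_eq g (fun tau =>
    (eps * RtoC (Rpower (INR p) (IZR w / 2 * (INR p - 1) / 2)) *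
     Cprod (map (fun m => slash w f m tau) (hecke_matrices p)))%C).

(* g = f ^ lambda for f = q^h (1 + O(q)): near i oo,
   f ^ lambda = exp (lambda L), where L is the branch of log f with
   L(tau) = 2 pi i h tau + o(1), and g is its meromorphic continuation. *)
Definition is_complex_power (f : C -> C) (lambda : C) (g : C -> C) : Prop :=
  meromorphic_on_H g /\
  exists (h : Z) (L : C -> C),
    near_infty (fun tau =>
      @continuous C_UniformSpace C_UniformSpace L tau /\
      f tau = Cexp (L tau) /\
      g tau = Cexp (lambda * L tau)%C) /\
    forall eps : R, 0 < eps ->
      near_infty (fun tau =>
        Cmod (L tau - RtoC (2 * PI * IZR h) * Ci * tau)%C < eps).

(* Multiplicative Hecke eigenform of level N and weight w / 2. *)
Definition mult_hecke_eigenform_wt (N : nat) (w : Z) (f : C -> C) : Prop :=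
  modular_form N w f /\
  forall p : nat, prime (Z.of_nat p) -> ~ Nat.divide p N ->
  exists (lambda : C) (g : C -> C),
    is_hecke w p f g /\ is_complex_power f lambda g.

(* The notion for integral weight. *)
Definition mult_hecke_eigenform (N : nat) (f : C -> C) : Prop :=
  exists k : Z, mult_hecke_eigenform_wt N (2 * k) f.

(* Main.v *)
Require Import Defs.
From Stdlib Require Import Reals ZArith List Znumtheory.
From Stdlib Require Import Ranalysis5 Lra Lia Psatz.
From Coquelicot Require Import Coquelicot.
Local Open Scope R_scope.

(* Near i oo, and in fact on the whole upper half-plane, eta = exp(log_eta) with
   log_eta(tau) = pi i tau / 12 - sum_j q^j / (j (1 - q^j)).  Its derivative is
   2 pi i (1/24 - sum_n q^n / (1 - q^n)^2), a multiple of the Eisenstein series of weight 2.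
   The partial fractions of pi^2 / sin^2 and pi cot turn this into a conditionally convergent
   double sum of 1 / (n tau + m)^2; exchanging the two summations costs exactly the term that
   makes eta(-1/tau)^2 / (tau eta(tau)^2) constant.  Hence eta^2 is modular of weight 1 for
   SL2(Z) up to unimodular constants, and so is f^2 for an eta quotient f, on Gamma_0(N) and at
   every cusp; the square root is taken by connectedness of the upper half-plane.  Integrality
   of the Fourier coefficients is read off from the product.  For the Hecke operator, the roots
   of unity identity prod_b (1 - zeta^b y) = 1 - y^p gives
   eta(p tau) prod_(b < p) eta((tau + b) / p) = c eta(tau)^(p+1), and the same holds for
   eta(d tau) when p does not divide d, so that f | T(p) = f^(p+1). *)

(** The exact multiplier of eta is a 24th root of unity governed by Dedekind sums. Only its modulus
    matters here, so it is never computed: for [eta * eta] the automorphy factor is the plain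
    denominator, and no branch of its square root enters the group-theoretic part. Nothing is lost
    by squaring, because eta = exp(log_eta) has no zero in the upper half-plane, so the quotient of
    the two sides of a desired identity is a continuous function whose square is a constant. The
    partial fractions come without residues. The functions cot and 1 / sin^2 satisfy duplication
    formulas; iterating them gives finite sums over 2^j translates, and dominated convergence for
    series gives the limit. The same convergence theorem serves for termwise derivatives,
    interchange of sums, Cauchy products and infinite products. Power series are carried with a
    geometric bound on their coefficients, which makes products and reciprocals explicit and keeps
    the coefficients in a given subring of the complex numbers. Since eta quotients have no zeros, f
    | T(p) is again an eta quotient, with exponents multiplied by p + 1. *)

(** * Elementary facts on the complex modulus *)

Lemma Cmod_sub_sym (x y : C) : Cmod (x - y)%C = Cmod (y - x)%C.
Proof. rewrite <- Cmod_opp. f_equal. ring. Qed.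

Lemma Cmod_sub_ge (x y : C) : Cmod x - Cmod y <= Cmod (x - y)%C.
Proof.
  generalize (Cmod_triangle (x - y)%C y). replace (x - y + y)%C with x by ring. lra.
Qed.

Lemma Cmod_sub_le (x y : C) : Cmod (x - y)%C <= Cmod x + Cmod y.
Proof. unfold Cminus. eapply Rle_trans; [apply Cmod_triangle|]. rewrite Cmod_opp. lra. Qed.

Lemma im_le_Cmod (z : C) : Rabs (Im z) <= Cmod z.
Proof. eapply Rle_trans; [|apply Rmax_Cmod]. apply Rmax_r. Qed.

Lemma Cmod_le_ReIm (z : C) : Cmod z <= Rabs (Re z) + Rabs (Im z).
Proof.
  replace z with (RtoC (Re z) + RtoC (Im z) * Ci)%C at 1.
  - eapply Rle_trans; [apply Cmod_triangle|].
    rewrite Cmod_mult, Cmod_Ci, !Cmod_R. lra.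
  - destruct z; unfold RtoC, Ci, Cmult, Cplus; simpl. f_equal; ring.
Qed.

Lemma Cmod_sqr (z : C) : Cmod z * Cmod z = Re z * Re z + Im z * Im z.
Proof. generalize (Cmod2_alt z). simpl. lra. Qed.

Lemma Ceq_ReIm (x y : C) : Re x = Re y -> Im x = Im y -> x = y.
Proof. destruct x, y; simpl; intros; subst; reflexivity. Qed.

Lemma Cinv_nz (z : C) : z <> 0 -> (/ z)%C <> 0.
Proof. intros H K. apply C1_nz. rewrite <- (Cinv_r z H), K. ring. Qed.

Lemma Cmod_pos (z : C) : z <> 0 -> 0 < Cmod z.
Proof. apply Cmod_gt_0. Qed.

Lemma Cmod_nz (z : C) : 0 < Cmod z -> z <> 0.
Proof. apply Cmod_gt_0. Qed.

Lemma RtoC_nz (x : R) : x <> 0 -> RtoC x <> 0.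
Proof. intros H K. apply H. apply RtoC_inj, K. Qed.

Lemma Cmult_integral (x y : C) : (x * y)%C = 0 -> x = 0 \/ y = 0.
Proof.
  intros H. destruct (Ceq_dec x 0) as [|Hx]; [now left|].
  destruct (Ceq_dec y 0) as [|Hy]; [now right|].
  exfalso; revert H; apply Cmult_neq_0; assumption.
Qed.

(** * Limits along filters *)

(** Stated with the modulus and an arbitrary filter, so that one set of rules serves sequences
    ([eventually]), points ([nbh]) and the cusp ([near_infty]). *)
Definition Clim {T : Type} (F : (T -> Prop) -> Prop) (f : T -> C) (l : C) : Prop :=
  forall eps : R, 0 < eps -> F (fun x => Cmod (f x - l)%C < eps).

Section Limits.
Context {T : Type} (F : (T -> Prop) -> Prop) {FF : ProperFilter F}.

Lemma Clim_ext_loc (f g : T -> C) l : F (fun x => f x = g x) -> Clim F f l -> Clim F g l.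
Proof.
  intros H Hf e He. generalize (filter_and _ _ H (Hf e He)).
  apply filter_imp. intros x [H1 H2]. now rewrite <- H1.
Qed.

Lemma Clim_ext (f g : T -> C) l : (forall x, f x = g x) -> Clim F f l -> Clim F g l.
Proof. intros H. apply Clim_ext_loc. apply filter_forall. exact H. Qed.

Lemma Clim_eq (f : T -> C) l m : l = m -> Clim F f l -> Clim F f m.
Proof. now intros ->. Qed.

Lemma Clim_const (c : C) : Clim F (fun _ => c) c.
Proof.
  intros e He. apply filter_forall. intros _.
  replace (c - c)%C with (RtoC 0) by ring. now rewrite Cmod_0.
Qed.

Lemma Clim_plus f g l m : Clim F f l -> Clim F g m -> Clim F (fun x => f x + g x)%C (l + m)%C.
Proof.
  intros Hf Hg e He.
  assert (He2 : 0 < e / 2) by lra. generalize (filter_and _ _ (Hf _ He2) (Hg _ He2)).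
  apply filter_imp. intros x [H1 H2].
  replace (f x + g x - (l + m))%C with ((f x - l) + (g x - m))%C by ring.
  generalize (Cmod_triangle (f x - l) (g x - m)). lra.
Qed.

Lemma Clim_opp f l : Clim F f l -> Clim F (fun x => - f x)%C (- l)%C.
Proof.
  intros Hf e He. generalize (Hf e He). apply filter_imp. intros x H1.
  replace (- f x - - l)%C with (- (f x - l))%C by ring. now rewrite Cmod_opp.
Qed.

Lemma Clim_minus f g l m : Clim F f l -> Clim F g m -> Clim F (fun x => f x - g x)%C (l - m)%C.
Proof. intros Hf Hg. apply Clim_plus; [|apply Clim_opp]; assumption. Qed.

Lemma Clim_le_bound f l M : Clim F f l -> F (fun x => Cmod (f x) <= M) -> Cmod l <= M.
Proof.
  intros Hf HM. apply Rnot_lt_le. intros Hlt.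
  assert (He : 0 < Cmod l - M) by lra.
  destruct (filter_ex _ (filter_and _ _ HM (Hf _ He))) as [x [H1 H2]].
  rewrite Cmod_sub_sym in H2. generalize (Cmod_sub_ge l (f x)). lra.
Qed.

Lemma Clim_unique f l m : Clim F f l -> Clim F f m -> l = m.
Proof.
  intros Hf Hg. apply Ceq_minus. apply Cmod_eq_0. apply Rle_antisym; [|apply Cmod_ge_0].
  apply (Clim_le_bound (fun x => f x - f x)%C).
  - now apply Clim_minus.
  - apply filter_forall. intros x. replace (f x - f x)%C with (RtoC 0) by ring.
    rewrite Cmod_0. lra.
Qed.

Lemma Clim_0_mult f g M : Clim F f 0 -> F (fun x => Cmod (g x) <= M) ->
  Clim F (fun x => f x * g x)%C 0.
Proof.
  intros Hf Hg e He.
  assert (HM : 0 < Rabs M + 1) by (generalize (Rabs_pos M); lra).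
  assert (He2 : 0 < e / (Rabs M + 1)) by (apply Rdiv_lt_0_compat; lra).
  generalize (filter_and _ _ (Hf _ He2) Hg).
  apply filter_imp. intros x [H1 H2].
  replace (f x - 0)%C with (f x) in H1 by ring.
  replace (f x * g x - 0)%C with (f x * g x)%C by ring. rewrite Cmod_mult.
  apply Rle_lt_trans with (Cmod (f x) * (Rabs M + 1)).
  - apply Rmult_le_compat_l; [apply Cmod_ge_0|]. generalize (Rle_abs M). lra.
  - apply (Rmult_lt_compat_r (Rabs M + 1)) in H1; [|lra].
    replace (e / (Rabs M + 1) * (Rabs M + 1)) with e in H1 by (field; lra). exact H1.
Qed.

Lemma Clim_bounded f l : Clim F f l -> F (fun x => Cmod (f x) <= Cmod l + 1).
Proof.
  intros Hf. generalize (Hf 1 Rlt_0_1). apply filter_imp. intros x Hx.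
  generalize (Cmod_sub_ge (f x) l). lra.
Qed.

Lemma Clim_sub0 f l : Clim F f l <-> Clim F (fun x => f x - l)%C 0.
Proof.
  split; intros H e He; generalize (H e He); apply filter_imp; intros x.
  - now replace (f x - l - 0)%C with (f x - l)%C by ring.
  - now replace (f x - l - 0)%C with (f x - l)%C by ring.
Qed.

Lemma Clim_mult f g l m : Clim F f l -> Clim F g m -> Clim F (fun x => f x * g x)%C (l * m)%C.
Proof.
  intros Hf Hg.
  apply Clim_ext with (fun x => ((f x - l) * g x + (g x - m) * l) + l * m)%C.
  { intros x; ring. }
  apply Clim_eq with ((0 + 0) + l * m)%C; [ring|].
  apply Clim_plus; [|apply Clim_const]. apply Clim_plus.
  - apply Clim_0_mult with (Cmod m + 1); [now apply Clim_sub0 in Hf|now apply Clim_bounded].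
  - apply Clim_0_mult with (Cmod l); [now apply Clim_sub0 in Hg|].
    apply filter_forall. intros; lra.
Qed.

Lemma Clim_lower f l : l <> RtoC 0 -> Clim F f l -> F (fun x => Cmod l / 2 < Cmod (f x)).
Proof.
  intros Hl Hf. apply Cmod_pos in Hl. assert (Hl2 : 0 < Cmod l / 2) by lra. generalize (Hf _ Hl2).
  apply filter_imp. intros x Hx. rewrite Cmod_sub_sym in Hx.
  generalize (Cmod_sub_ge l (f x)). lra.
Qed.

Lemma Clim_inv f l : l <> RtoC 0 -> Clim F f l -> Clim F (fun x => / f x)%C (/ l)%C.
Proof.
  intros Hl Hf. generalize (Clim_lower f l Hl Hf). intros Hlow.
  assert (Hl' := Cmod_pos _ Hl).
  apply Clim_sub0.
  apply Clim_ext_loc with (fun x => (f x - l) * (- / (f x * l)))%C.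
  - revert Hlow. apply filter_imp. intros x Hx.
    assert (f x <> 0) by (apply Cmod_nz; lra). field. split; assumption.
  - apply Clim_0_mult with (/ (Cmod l / 2 * Cmod l)); [now apply Clim_sub0 in Hf|].
    revert Hlow. apply filter_imp. intros x Hx.
    assert (f x <> 0) by (apply Cmod_nz; lra).
    rewrite Cmod_opp, Cmod_inv by now apply Cmult_neq_0.
    rewrite Cmod_mult. apply Rinv_le_contravar.
    + apply Rmult_lt_0_compat; lra.
    + apply Rmult_le_compat_r; lra.
Qed.

Lemma Clim_div f g l m : m <> RtoC 0 -> Clim F f l -> Clim F g m ->
  Clim F (fun x => f x / g x)%C (l / m)%C.
Proof. intros. apply Clim_mult; [|apply Clim_inv]; assumption. Qed.

Lemma Clim_pow f l n : Clim F f l -> Clim F (fun x => Cpow (f x) n) (Cpow l n).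
Proof.
  intros H. induction n as [|n IH]; simpl; [apply Clim_const|now apply Clim_mult].
Qed.

Lemma Clim_bound0 f (b : T -> R) :
  (forall e, 0 < e -> F (fun x => b x < e)) -> F (fun x => Cmod (f x) <= b x) -> Clim F f 0.
Proof.
  intros Hb Hf e He. generalize (filter_and _ _ (Hb e He) Hf). apply filter_imp.
  intros x [H1 H2]. replace (f x - 0)%C with (f x) by ring. lra.
Qed.

Lemma Clim_RtoC f (l : R) :
  (forall e, 0 < e -> F (fun x => Rabs (f x - l) < e)) -> Clim F (fun x => RtoC (f x)) (RtoC l).
Proof.
  intros H e He. generalize (H e He). apply filter_imp. intros x Hx.
  rewrite <- RtoC_minus, Cmod_R. exact Hx.
Qed.
End Limits.

(** Balls of the modulus, with the centre included: an identity that holds near [z] then also holds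
    at [z] ([nbh_self]). *)
Definition nbh (z : C) (P : C -> Prop) : Prop :=
  exists d : R, 0 < d /\ forall w, Cmod (w - z)%C < d -> P w.

Global Instance nbh_filter (z : C) : ProperFilter (nbh z).
Proof.
  constructor.
  - intros P [d [Hd H]]. exists z. apply H.
    replace (z - z)%C with (RtoC 0) by ring. now rewrite Cmod_0.
  - constructor.
    + exists 1. split; [lra|trivial].
    + intros P Q [d [Hd H]] [e [He K]]. exists (Rmin d e). split.
      * now apply Rmin_pos.
      * intros w Hw. split; [apply H|apply K]; eapply Rlt_le_trans; [exact Hw|apply Rmin_l|exact Hw|apply Rmin_r].
    + intros P Q HPQ [d [Hd H]]. exists d. split; [exact Hd|]. intros; apply HPQ, H; assumption.
Qed.

Lemma nbh_self (z : C) P : nbh z P -> P z.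
Proof.
  intros [d [Hd H]]. apply H. replace (z - z)%C with (RtoC 0) by ring. now rewrite Cmod_0.
Qed.

Definition Ccont (f : C -> C) (z : C) : Prop := Clim (nbh z) f (f z).

Lemma Ccont_id z : Ccont (fun w => w) z.
Proof. intros e He. exists e. split; [exact He|trivial]. Qed.

Lemma Clim_comp {T : Type} (F : (T -> Prop) -> Prop) {FF : ProperFilter F} (g : T -> C) f z :
  Clim F g z -> Ccont f z -> Clim F (fun x => f (g x)) (f z).
Proof.
  intros Hg Hf e He. destruct (Hf e He) as [d [Hd H]].
  generalize (Hg d Hd). apply filter_imp. intros x. apply H.
Qed.

Lemma Ccont_comp f g z : Ccont g z -> Ccont f (g z) -> Ccont (fun w => f (g w)) z.
Proof. intros Hg Hf. apply (Clim_comp (nbh z) g f (g z)); assumption. Qed.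

(** * Complex derivatives *)

(* Caratheodory's form of differentiability, so that the calculus rules reduce to limits. *)
Definition Cder (f : C -> C) (z l : C) : Prop :=
  exists phi : C -> C, Ccont phi z /\ phi z = l /\
    nbh z (fun w => (f w - f z = phi w * (w - z))%C).

Lemma Cder_ext_loc f g z l : nbh z (fun w => f w = g w) -> Cder f z l -> Cder g z l.
Proof.
  intros H [phi [H1 [H2 H3]]]. exists phi. split; [exact H1|split; [exact H2|]].
  assert (Hz := nbh_self _ _ H).
  generalize (filter_and _ _ H H3). apply filter_imp. intros w [K1 K2].
  now rewrite <- K1, <- Hz.
Qed.

Lemma Cder_ext f g z l : (forall w, f w = g w) -> Cder f z l -> Cder g z l.
Proof. intros H. apply Cder_ext_loc. apply filter_forall. exact H. Qed.

Lemma Cder_eq f z l m : l = m -> Cder f z l -> Cder f z m.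
Proof. now intros ->. Qed.

Lemma Cder_cont f z l : Cder f z l -> Ccont f z.
Proof.
  intros [phi [H1 [H2 H3]]].
  apply Clim_ext_loc with (fun w => phi w * (w - z) + f z)%C; [apply nbh_filter| |].
  - revert H3. apply filter_imp. intros w <-. ring.
  - apply Clim_eq with (phi z * (z - z) + f z)%C; [ring|].
    apply Clim_plus; [apply nbh_filter| |apply Clim_const, nbh_filter].
    apply Clim_mult; [apply nbh_filter|exact H1|].
    apply Clim_minus; [apply nbh_filter|apply Ccont_id|apply Clim_const, nbh_filter].
Qed.

Lemma Cder_const c z : Cder (fun _ => c) z 0.
Proof.
  exists (fun _ => 0). split; [apply Clim_const, nbh_filter|split; [reflexivity|]].
  apply filter_forall. intros; ring.
Qed.

Lemma Cder_id z : Cder (fun w => w) z 1.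
Proof.
  exists (fun _ => 1). split; [apply Clim_const, nbh_filter|split; [reflexivity|]].
  apply filter_forall. intros; ring.
Qed.

Lemma Cder_plus f g z l m : Cder f z l -> Cder g z m -> Cder (fun w => f w + g w)%C z (l + m)%C.
Proof.
  intros [p [H1 [H2 H3]]] [q [K1 [K2 K3]]]. exists (fun w => p w + q w)%C.
  split; [apply Clim_plus; [apply nbh_filter|assumption|assumption]|].
  split; [now rewrite H2, K2|].
  generalize (filter_and _ _ H3 K3). apply filter_imp. intros w [E1 E2].
  replace (f w + g w - (f z + g z))%C with ((f w - f z) + (g w - g z))%C by ring.
  rewrite E1, E2. ring.
Qed.

Lemma Cder_mult f g z l m : Cder f z l -> Cder g z m ->
  Cder (fun w => f w * g w)%C z (l * g z + f z * m)%C.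
Proof.
  intros Hf Hg. assert (Cg := Cder_cont _ _ _ Hg).
  destruct Hf as [p [H1 [H2 H3]]], Hg as [q [K1 [K2 K3]]].
  exists (fun w => p w * g w + f z * q w)%C.
  split.
  - apply Clim_plus; [apply nbh_filter| |]; apply Clim_mult; try apply nbh_filter; try assumption.
    apply Clim_const, nbh_filter.
  - split; [now rewrite H2, K2|].
    generalize (filter_and _ _ H3 K3). apply filter_imp. intros w [E1 E2].
    replace (f w * g w - f z * g z)%C with ((f w - f z) * g w + f z * (g w - g z))%C by ring.
    rewrite E1, E2. ring.
Qed.

Lemma Cder_scal c f z l : Cder f z l -> Cder (fun w => c * f w)%C z (c * l)%C.
Proof.
  intros H. eapply Cder_eq; [|apply (Cder_mult (fun _ => c) f z 0 l); [apply Cder_const|exact H]].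
  ring.
Qed.

Lemma Cder_opp f z l : Cder f z l -> Cder (fun w => - f w)%C z (- l)%C.
Proof.
  intros H. apply Cder_ext with (fun w => (RtoC (-1)) * f w)%C.
  - intros w. ring.
  - eapply Cder_eq; [|apply Cder_scal; exact H]. ring.
Qed.

Lemma Cder_minus f g z l m : Cder f z l -> Cder g z m -> Cder (fun w => f w - g w)%C z (l - m)%C.
Proof. intros. apply Cder_plus; [|apply Cder_opp]; assumption. Qed.

Lemma Cder_comp f g z l m : Cder g z m -> Cder f (g z) l -> Cder (fun w => f (g w)) z (l * m)%C.
Proof.
  intros Hg Hf. assert (Cg := Cder_cont _ _ _ Hg).
  destruct Hf as [p [H1 [H2 H3]]], Hg as [q [K1 [K2 K3]]].
  exists (fun w => p (g w) * q w)%C. split; [|split].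
  - apply Clim_mult; [apply nbh_filter| |exact K1]. now apply Ccont_comp.
  - now rewrite H2, K2.
  - destruct H3 as [d [Hd H3]]. generalize (filter_and _ _ K3 (Cg d Hd)).
    apply filter_imp. intros w [E1 E2]. rewrite H3 by exact E2. rewrite E1. ring.
Qed.

Lemma Cder_inv z : z <> RtoC 0 -> Cder (fun w => / w)%C z (- / (z * z))%C.
Proof.
  intros Hz. exists (fun w => - / (w * z))%C. split; [|split; [reflexivity|]].
  - apply Clim_opp; [apply nbh_filter|]. apply Clim_inv; [apply nbh_filter|now apply Cmult_neq_0|].
    apply Clim_mult; [apply nbh_filter|apply Ccont_id|apply Clim_const, nbh_filter].
  - generalize (Clim_lower (nbh z) _ _ Hz (Ccont_id z)). apply filter_imp. intros w Hw.
    assert (w <> 0) by (apply Cmod_nz; generalize (Cmod_pos _ Hz); lra).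
    field. split; assumption.
Qed.

Lemma Cder_inv_fun f z l : f z <> RtoC 0 -> Cder f z l ->
  Cder (fun w => / f w)%C z (- l / (f z * f z))%C.
Proof.
  intros Hz Hf. eapply Cder_eq; [|apply (Cder_comp (fun w => / w)%C f); [exact Hf|apply Cder_inv, Hz]].
  field; assumption.
Qed.

Lemma Cder_pow f z l n : Cder f z l ->
  Cder (fun w => Cpow (f w) n) z (INR n * l * Cpow (f z) (pred n))%C.
Proof.
  intros Hf. induction n as [|n IH].
  - eapply Cder_eq; [|apply (Cder_const (RtoC 1) z)]. simpl. ring.
  - eapply Cder_eq; [|apply (Cder_mult f (fun w => Cpow (f w) n)); eassumption].
    rewrite S_INR, RtoC_plus. simpl pred. destruct n; simpl; ring.
Qed.

(** Brings the real mean value theorem to bear on complex functions: restrict to a line and project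
    on a real direction, encoded by the factor [c]. *)
Lemma Cder_real_path (f : C -> C) (a b c l : C) (t : R) :
  Cder f (a + RtoC t * b)%C l ->
  derivable_pt_lim (fun s => Re (c * f (a + RtoC s * b)%C)%C) t (Re (c * (l * b))%C).
Proof.
  intros [phi [H1 [H2 [d0 [Hd0 H3]]]]] e He.
  set (K := Cmod c * Cmod b + 1).
  assert (HK : 0 < K) by (unfold K; generalize (Cmod_ge_0 c) (Cmod_ge_0 b); intros; nra).
  destruct (H1 (e / K) ltac:(apply Rdiv_lt_0_compat; lra)) as [d1 [Hd1 H4]].
  set (B := Cmod b + 1). assert (HB : 0 < B) by (unfold B; generalize (Cmod_ge_0 b); lra).
  assert (Hd : 0 < Rmin d0 d1 / B) by (apply Rdiv_lt_0_compat; [now apply Rmin_pos|exact HB]).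
  exists (mkposreal _ Hd). intros h Hh Hhd. simpl in Hhd.
  assert (Ew : (a + RtoC (t + h) * b - (a + RtoC t * b) = RtoC h * b)%C) by (rewrite RtoC_plus; ring).
  assert (Hw : Cmod (RtoC h * b)%C < Rmin d0 d1).
  { rewrite Cmod_mult, Cmod_R. apply Rle_lt_trans with (Rabs h * B).
    - apply Rmult_le_compat_l; [apply Rabs_pos|unfold B; lra].
    - apply (Rmult_lt_compat_r B) in Hhd; [|exact HB].
      replace (Rmin d0 d1 / B * B) with (Rmin d0 d1) in Hhd by (field; lra). exact Hhd. }
  assert (E : f (a + RtoC (t + h) * b)%C = (f (a + RtoC t * b) + phi (a + RtoC (t + h) * b) * (RtoC h * b))%C).
  { rewrite <- Ew, <- H3; [ring|]. rewrite Ew. eapply Rlt_le_trans; [exact Hw|apply Rmin_l]. }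
  assert (Hp : Cmod (phi (a + RtoC (t + h) * b) - l)%C < e / K).
  { rewrite <- H2. apply H4. rewrite Ew. eapply Rlt_le_trans; [exact Hw|apply Rmin_r]. }
  rewrite E. set (p := phi (a + RtoC (t + h) * b)%C) in *.
  replace ((Re (c * (f (a + RtoC t * b) + p * (RtoC h * b)))%C - Re (c * f (a + RtoC t * b))%C) / h - Re (c * (l * b))%C)
    with (Re (c * ((p - l) * b))%C).
  - eapply Rle_lt_trans; [apply re_le_Cmod|]. rewrite !Cmod_mult.
    apply Rle_lt_trans with (Cmod (p - l)%C * (Cmod c * Cmod b)); [right; ring|].
    apply Rle_lt_trans with (Cmod (p - l)%C * K).
    + apply Rmult_le_compat_l; [apply Cmod_ge_0|unfold K; lra].
    + apply (Rmult_lt_compat_r K) in Hp; [|exact HK].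
      replace (e / K * K) with e in Hp by (field; lra). exact Hp.
  - replace (c * (f (a + RtoC t * b) + p * (RtoC h * b)))%C
      with (c * f (a + RtoC t * b) + RtoC h * (c * (p * b)))%C by ring.
    rewrite re_plus, re_scal_l.
    replace (c * ((p - l) * b))%C with (c * (p * b) + - (c * (l * b)))%C by ring.
    rewrite re_plus, re_opp. field. exact Hh.
Qed.

(** A complex function has no mean value equality. It holds, however, for the real part of conj(D) f
    with D = f(b) - f(a), and the increment of that function is exactly |D|^2; dividing by |D| gives
    the inequality. *)
Lemma Cder_mean_value (f g : C -> C) (a b : C) (M : R) :
  (forall t : R, 0 <= t <= 1 -> let w := (a + RtoC t * (b - a))%C in
     Cder f w (g w) /\ Cmod (g w) <= M) ->
  Cmod (f b - f a)%C <= M * Cmod (b - a)%C.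
Proof.
  intros H. set (D := (f b - f a)%C).
  destruct (Ceq_dec D 0) as [E|E].
  - rewrite E, Cmod_0. apply Rmult_le_pos; [|apply Cmod_ge_0].
    destruct (H 0 ltac:(lra)) as [_ H0]. eapply Rle_trans; [apply Cmod_ge_0|exact H0].
  - apply Cmod_pos in E.
    destruct (MVT_cor2 (fun s => Re (Cconj D * f (a + RtoC s * (b - a))%C)%C)
      (fun s => Re (Cconj D * (g (a + RtoC s * (b - a)) * (b - a)))%C) 0 1 ltac:(lra)) as [s [Hs1 Hs2]].
    { intros s Hs. apply Cder_real_path. apply (H s Hs). }
    cbv beta in Hs1.
    replace (a + 1 * (b - a))%C with b in Hs1 by ring.
    replace (a + 0 * (b - a))%C with a in Hs1 by ring.
    set (G := g (a + RtoC s * (b - a))%C) in *.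
    assert (HG : Cmod G <= M) by (apply (H s ltac:(lra))).
    assert (E2 : Re (Cconj D * f b)%C - Re (Cconj D * f a)%C = Cmod D * Cmod D).
    { rewrite Cmod_sqr. unfold D. rewrite !re_mult. rewrite re_conj, im_conj.
      unfold Cminus. rewrite re_plus, im_plus, re_opp, im_opp. ring. }
    rewrite E2 in Hs1.
    assert (Hb : Re (Cconj D * (G * (b - a)))%C <= Cmod D * (M * Cmod (b - a))).
    { eapply Rle_trans; [apply Rle_abs|]. eapply Rle_trans; [apply re_le_Cmod|].
      rewrite !Cmod_mult, Cmod_conj. apply Rmult_le_compat_l; [apply Cmod_ge_0|].
      apply Rmult_le_compat_r; [apply Cmod_ge_0|exact HG]. }
    apply Rmult_le_reg_l with (Cmod D); [exact E|]. nra.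
Qed.

Lemma Cder_0_const (f : C -> C) (a b : C) :
  (forall t : R, 0 <= t <= 1 -> Cder f (a + RtoC t * (b - a))%C 0) -> f b = f a.
Proof.
  intros H. apply Ceq_minus, Cmod_eq_0, Rle_antisym; [|apply Cmod_ge_0].
  eapply Rle_trans; [apply (Cder_mean_value f (fun _ => 0) a b 0)|lra].
  intros t Ht. split; [now apply H|rewrite Cmod_0; lra].
Qed.

(** * The complex exponential *)

Lemma Cexp_add z w : Cexp (z + w)%C = (Cexp z * Cexp w)%C.
Proof.
  unfold Cexp. apply injective_projections; simpl;
  rewrite exp_plus, ?cos_plus, ?sin_plus; fold (Re z) (Re w) (Im z) (Im w); unfold Re, Im; ring.
Qed.

Lemma Cexp_0 : Cexp 0 = 1.
Proof. unfold Cexp, RtoC; simpl. rewrite exp_0, cos_0, sin_0. f_equal; ring. Qed.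

Lemma Cmod_Cexp z : Cmod (Cexp z) = exp (Re z).
Proof.
  unfold Cmod, Cexp; simpl fst; simpl snd.
  replace ((exp (Re z) * cos (Im z)) ^ 2 + (exp (Re z) * sin (Im z)) ^ 2) with (exp (Re z) * exp (Re z)).
  - apply sqrt_square. left; apply exp_pos.
  - generalize (sin2_cos2 (Im z)). unfold Rsqr. intros H.
    replace ((exp (Re z) * cos (Im z)) ^ 2 + (exp (Re z) * sin (Im z)) ^ 2)
     with (exp (Re z) * exp (Re z) * (sin (Im z) * sin (Im z) + cos (Im z) * cos (Im z))) by ring.
    rewrite H. ring.
Qed.

Lemma Cexp_nz z : Cexp z <> 0.
Proof. apply Cmod_nz. rewrite Cmod_Cexp. apply exp_pos. Qed.

Lemma Cexp_opp z : Cexp (- z)%C = (/ Cexp z)%C.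
Proof.
  assert (H : (Cexp (- z) * Cexp z = 1)%C).
  { rewrite <- Cexp_add. replace (- z + z)%C with (RtoC 0) by ring. apply Cexp_0. }
  replace (Cexp (- z)) with (Cexp (-z) * Cexp z * / Cexp z)%C by (field; apply Cexp_nz).
  rewrite H. ring.
Qed.

Lemma Cexp_minus z w : Cexp (z - w)%C = (Cexp z / Cexp w)%C.
Proof. unfold Cminus. now rewrite Cexp_add, Cexp_opp. Qed.

Lemma Cexp_INR n z : Cexp (INR n * z)%C = Cpow (Cexp z) n.
Proof.
  induction n as [|n IH].
  - simpl. replace (RtoC 0 * z)%C with (RtoC 0) by ring. apply Cexp_0.
  - rewrite S_INR, RtoC_plus.
    replace ((INR n + 1) * z)%C with (z + INR n * z)%C by ring.
    rewrite Cexp_add, IH. reflexivity.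
Qed.

Lemma sin_abs_le x : Rabs (sin x) <= Rabs x.
Proof.
  assert (P : forall y, 0 < y -> Rabs (sin y) <= y).
  { intros y Hy. apply Rabs_le. split.
    - destruct (Rle_dec y PI) as [h|h].
      + assert (0 <= sin y) by (apply sin_ge_0; lra). lra.
      + generalize (SIN_bound y) PI2_1. lra.
    - left; now apply sin_lt_x. }
  destruct (Rtotal_order x 0) as [h|[->|h]].
  - rewrite (Rabs_left x h). replace (sin x) with (- sin (- x)) by (rewrite sin_neg; ring).
    rewrite Rabs_Ropp. apply P. lra.
  - rewrite sin_0. lra.
  - rewrite (Rabs_pos_eq x) by lra. now apply P.
Qed.

Lemma one_minus_cos_le x : 0 <= 1 - cos x <= x * x / 2.
Proof.
  split; [generalize (COS_bound x); lra|].
  replace (cos x) with (cos (2 * (x / 2))) by (f_equal; field). rewrite cos_2a_sin.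
  assert (H := sin_abs_le (x / 2)).
  assert (sin (x / 2) * sin (x / 2) <= x / 2 * (x / 2)).
  { apply Rsqr_le_abs_1 in H. exact H. }
  lra.
Qed.

Lemma sin_minus_id_le x : Rabs x <= 1 -> Rabs (sin x - x) <= x * x.
Proof.
  assert (P : forall y, 0 < y <= 1 -> Rabs (sin y - y) <= y * y).
  { intros y Hy.
    destruct (MVT_cor2 (fun s => sin s - s) (fun s => cos s - 1) 0 y ltac:(lra)) as [s [H1 H2]].
    { intros s _. apply derivable_pt_lim_minus; [apply derivable_pt_lim_sin|apply derivable_pt_lim_id]. }
    rewrite sin_0 in H1. replace (sin y - y) with ((cos s - 1) * (y - 0)) by lra.
    rewrite Rabs_mult, (Rabs_pos_eq (y - 0)) by lra.
    generalize (one_minus_cos_le s). intros H3. rewrite Rabs_left1 by lra.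
    apply Rle_trans with (s * s / 2 * y); [nra|]. nra. }
  intros Hx. destruct (Rtotal_order x 0) as [h|[->|h]].
  - rewrite Rabs_left in Hx by assumption.
    replace (sin x - x) with (- (sin (- x) - (- x))) by (rewrite sin_neg; ring).
    rewrite Rabs_Ropp. apply Rle_trans with (- x * - x); [apply P|]; lra.
  - rewrite sin_0, Rminus_0_r, Rabs_R0. lra.
  - rewrite Rabs_pos_eq in Hx by lra. apply P. lra.
Qed.

(** The upper bound comes from exp(-a) >= 1 - a, that is (1 - a) exp(a) <= 1, and (1 - a)(1 + a + 2
    a^2) = 1 + a^2 (1 - 2 a) >= 1 for a <= 1/2. *)
Lemma exp_minus_1_le a : a <= 1 / 2 -> 0 <= exp a - 1 - a <= 2 * (a * a).
Proof.
  intros Ha. split; [generalize (exp_ineq1_le a); lra|].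
  generalize (exp_ineq1_le (- a)). intros H. rewrite exp_Ropp in H.
  assert (He := exp_pos a).
  assert (H1 : (1 - a) * exp a <= 1).
  { apply (Rmult_le_compat_r (exp a)) in H; [|lra]. rewrite Rinv_l in H by lra. lra. }
  assert (exp a <= 1 + a + 2 * (a * a)); [|lra].
  apply Rmult_le_reg_l with (1 - a); [lra|].
  assert ((1 - a) * (1 + a + 2 * (a * a)) = 1 + a * a * (1 - 2 * a)) by ring.
  nra.
Qed.

(** The quadratic remainder gives the derivative of [Cexp] at 0, hence everywhere by the addition
    formula. The constant 8 is generous: the real part contributes at most 3 |z|^2 and the imaginary
    part the same. *)
Lemma Cexp_quadratic z : Cmod z <= 1 / 2 -> Cmod (Cexp z - 1 - z)%C <= 8 * (Cmod z * Cmod z).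
Proof.
  intros Hz. set (a := Re z). set (b := Im z).
  assert (Ha : Rabs a <= Cmod z) by apply re_le_Cmod.
  assert (Hb : Rabs b <= Cmod z) by apply im_le_Cmod.
  assert (Ha' : - (1/2) <= a <= 1 / 2) by (apply Rabs_le_between; lra).
  assert (E1 := exp_minus_1_le a ltac:(lra)).
  assert (E2 := one_minus_cos_le b).
  assert (E3 := sin_minus_id_le b ltac:(lra)).
  assert (E4 := sin_abs_le b).
  assert (Sa : a * a <= Cmod z * Cmod z) by (apply Rsqr_le_abs_1; rewrite (Rabs_pos_eq (Cmod z)); [exact Ha|apply Cmod_ge_0]).
  assert (Sb : b * b <= Cmod z * Cmod z) by (apply Rsqr_le_abs_1; rewrite (Rabs_pos_eq (Cmod z)); [exact Hb|apply Cmod_ge_0]).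
  assert (Ea : exp a <= 2) by nra.
  eapply Rle_trans; [apply Cmod_le_ReIm|].
  replace (Re (Cexp z - 1 - z)%C) with ((exp a - 1 - a) - exp a * (1 - cos b))
    by (unfold a, b, Cexp, Re, Im; simpl; ring).
  replace (Im (Cexp z - 1 - z)%C) with ((exp a - 1) * sin b + (sin b - b))
    by (unfold a, b, Cexp, Re, Im; simpl; ring).
  assert (H1 : Rabs ((exp a - 1 - a) - exp a * (1 - cos b)) <= 2 * (a * a) + b * b).
  { generalize (exp_pos a); intros. apply Rabs_le. split; nra. }
  assert (H2 : Rabs ((exp a - 1) * sin b) <= 2 * (Cmod z * Cmod z)).
  { rewrite Rabs_mult.
    assert (Rabs (exp a - 1) <= 2 * Cmod z).
    { replace (exp a - 1) with ((exp a - 1 - a) + a) by ring. eapply Rle_trans; [apply Rabs_triang|].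
      rewrite (Rabs_pos_eq (exp a - 1 - a)) by lra.
      generalize (Cmod_ge_0 z). intros. nra. }
    replace (2 * (Cmod z * Cmod z)) with ((2 * Cmod z) * Cmod z) by ring.
    apply Rmult_le_compat; try apply Rabs_pos; lra. }
  generalize (Rabs_triang ((exp a - 1) * sin b) (sin b - b)). lra.
Qed.

Lemma Cder_Cexp z : Cder Cexp z (Cexp z).
Proof.
  exists (fun w => if Ceq_dec w z then Cexp z else ((Cexp w - Cexp z) / (w - z))%C).
  split; [|split].
  - unfold Ccont. destruct (Ceq_dec z z) as [_|n]; [|now elim n].
    apply Clim_sub0; [apply nbh_filter|].
    apply Clim_bound0 with (fun w => 8 * Cmod (Cexp z) * Cmod (w - z)%C); [apply nbh_filter| |].
    + intros e He. set (K := 8 * Cmod (Cexp z)).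
      assert (HK : 0 < K) by (unfold K; generalize (Cmod_pos _ (Cexp_nz z)); lra).
      exists (e / K). split; [apply Rdiv_lt_0_compat; lra|]. intros w Hw.
      apply (Rmult_lt_compat_l K) in Hw; [|exact HK].
      replace (K * (e / K)) with e in Hw by (field; lra). exact Hw.
    + exists (1/2). split; [lra|]. intros w Hw.
      destruct (Ceq_dec w z) as [->|n].
      * replace (Cexp z - Cexp z)%C with (RtoC 0) by ring. rewrite Cmod_0.
        generalize (Cmod_ge_0 (Cexp z)) (Cmod_ge_0 (z - z)%C). intros; nra.
      * assert (n' : (w - z)%C <> 0) by now apply Cminus_eq_contra.
        replace ((Cexp w - Cexp z) / (w - z) - Cexp z)%C with
          (Cexp z * (Cexp (w - z) - 1 - (w - z)) * / (w - z))%C.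
        2:{ rewrite Cexp_minus. field. split; [assumption|apply Cexp_nz]. }
        rewrite !Cmod_mult, Cmod_inv by assumption.
        assert (P := Cmod_pos _ n').
        apply Rmult_le_reg_r with (Cmod (w - z)%C); [exact P|].
        rewrite Rmult_assoc, Rinv_l by lra.
        assert (K := Cexp_quadratic (w - z)%C ltac:(lra)). generalize (Cmod_ge_0 (Cexp z)). intros. nra.
  - destruct (Ceq_dec z z) as [_|n]; [reflexivity|now elim n].
  - apply filter_forall. intros w. destruct (Ceq_dec w z) as [->|n]; [ring|].
    field. now apply Cminus_eq_contra.
Qed.

Lemma Cder_Cexp_comp f z l : Cder f z l -> Cder (fun w => Cexp (f w)) z (Cexp (f z) * l)%C.
Proof. intros H. apply (Cder_comp Cexp f); [exact H|apply Cder_Cexp]. Qed.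

Lemma Ccont_Cexp z : Ccont Cexp z.
Proof. eapply Cder_cont, Cder_Cexp. Qed.

(** * Absolutely convergent complex series *)

(** The upper bound is strict, so the empty sum exists and sums split at [n + m] without a shift. *)
Fixpoint csumn (u : nat -> C) (n : nat) : C :=
  match n with O => RtoC 0 | S m => (csumn u m + u m)%C end.

Definition Csum (u : nat -> C) : C :=
  (Series (fun n => Re (u n)), Series (fun n => Im (u n))).

Definition summable (u : nat -> C) : Prop := ex_series (fun n => Cmod (u n)).

Lemma csumn_ext u v n : (forall k, (k < n)%nat -> u k = v k) -> csumn u n = csumn v n.
Proof.
  induction n as [|n IH]; intros H; [reflexivity|]. simpl.
  rewrite IH by (intros; apply H; lia). now rewrite H by lia.
Qed.

Lemma csumn_plus u v n : csumn (fun k => u k + v k)%C n = (csumn u n + csumn v n)%C.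
Proof. induction n as [|n IH]; simpl; [|rewrite IH]; ring. Qed.

Lemma csumn_scal c u n : csumn (fun k => c * u k)%C n = (c * csumn u n)%C.
Proof. induction n as [|n IH]; simpl; [|rewrite IH]; ring. Qed.

Lemma csumn_app u n m : csumn u (n + m) = (csumn u n + csumn (fun k => u (n + k)%nat) m)%C.
Proof.
  induction m as [|m IH]; simpl.
  - rewrite Nat.add_0_r. ring.
  - rewrite Nat.add_succ_r. simpl. rewrite IH. ring.
Qed.

Lemma csumn_Sl u n : csumn u (S n) = (u 0%nat + csumn (fun k => u (S k)) n)%C.
Proof. change (S n) with (1 + n)%nat. rewrite csumn_app. simpl. ring. Qed.

Lemma csumn_0 u n : (forall k, (k < n)%nat -> u k = RtoC 0) -> csumn u n = RtoC 0.
Proof.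
  intros H. induction n as [|n IH]; [reflexivity|]. simpl.
  rewrite IH by (intros; apply H; lia). rewrite H by lia. ring.
Qed.

Lemma Re_csumn u n : Re (csumn u (S n)) = sum_n (fun k => Re (u k)) n.
Proof.
  induction n as [|n IH].
  - rewrite sum_O. simpl csumn. rewrite re_plus. simpl. ring.
  - rewrite sum_Sn, <- IH. simpl csumn. rewrite !re_plus. reflexivity.
Qed.

Lemma Im_csumn u n : Im (csumn u (S n)) = sum_n (fun k => Im (u k)) n.
Proof.
  induction n as [|n IH].
  - rewrite sum_O. simpl csumn. rewrite im_plus. simpl. ring.
  - rewrite sum_Sn, <- IH. simpl csumn. rewrite !im_plus. reflexivity.
Qed.

Lemma csumn_sum_n u n : csumn u (S n) = @sum_n C_AbelianMonoid u n.
Proof.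
  induction n as [|n IH].
  - rewrite sum_O. simpl. ring.
  - rewrite sum_Sn, <- IH. reflexivity.
Qed.

Lemma ex_series_Rle (a b : nat -> R) :
  (forall n, 0 <= a n <= b n) -> ex_series b -> ex_series a.
Proof.
  intros H Hb. apply (ex_series_le (V := R_CompleteNormedModule) a b); [|exact Hb].
  intros n. unfold norm; simpl. unfold abs; simpl. rewrite Rabs_pos_eq; apply H.
Qed.

Lemma summable_le u (M : nat -> R) :
  (forall n, Cmod (u n) <= M n) -> ex_series M -> summable u.
Proof.
  intros H HM. apply ex_series_Rle with M; [|exact HM].
  intros n; split; [apply Cmod_ge_0|apply H].
Qed.

Lemma summable_Re u : summable u -> ex_series (fun n => Re (u n)).
Proof.
  intros H. apply (ex_series_le (V := R_CompleteNormedModule) _ (fun n => Cmod (u n))); [|exact H].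
  intros n. apply re_le_Cmod.
Qed.

Lemma summable_Im u : summable u -> ex_series (fun n => Im (u n)).
Proof.
  intros H. apply (ex_series_le (V := R_CompleteNormedModule) _ (fun n => Cmod (u n))); [|exact H].
  intros n. apply im_le_Cmod.
Qed.

Lemma Clim_ReIm {T : Type} (F : (T -> Prop) -> Prop) {FF : ProperFilter F} (f : T -> C) l :
  (forall e, 0 < e -> F (fun x => Rabs (Re (f x) - Re l) < e)) ->
  (forall e, 0 < e -> F (fun x => Rabs (Im (f x) - Im l) < e)) -> Clim F f l.
Proof.
  intros H1 H2 e He. assert (He2 : 0 < e / 2) by lra.
  generalize (filter_and _ _ (H1 _ He2) (H2 _ He2)). apply filter_imp. intros x [K1 K2].
  eapply Rle_lt_trans; [apply Cmod_le_ReIm|].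
  unfold Cminus. rewrite re_plus, im_plus, re_opp, im_opp.
  unfold Rminus in *. lra.
Qed.

Lemma Clim_seq_S (f : nat -> C) l : Clim eventually (fun n => f (S n)) l -> Clim eventually f l.
Proof.
  intros H e He. destruct (H e He) as [N HN]. exists (S N). intros n Hn.
  destruct n as [|n]; [lia|]. apply HN. lia.
Qed.

Lemma is_series_Re_lim (a : nat -> R) l : is_series a l ->
  forall e, 0 < e -> eventually (fun n => Rabs (sum_n a n - l) < e).
Proof.
  intros H e He.
  assert (H' : is_lim_seq (sum_n a) l) by exact H.
  apply is_lim_seq_spec in H'. exact (H' (mkposreal e He)).
Qed.

Lemma Csum_lim u : summable u -> Clim eventually (csumn u) (Csum u).
Proof.
  intros H. apply Clim_seq_S. apply Clim_ReIm; [apply eventually_filter| |]; intros e He.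
  - generalize (is_series_Re_lim _ _ (Series_correct _ (summable_Re _ H)) e He).
    apply filter_imp. intros n Hn. rewrite Re_csumn. exact Hn.
  - generalize (is_series_Re_lim _ _ (Series_correct _ (summable_Im _ H)) e He).
    apply filter_imp. intros n Hn. rewrite Im_csumn. exact Hn.
Qed.

Lemma Csum_unique u l : summable u -> Clim eventually (csumn u) l -> Csum u = l.
Proof.
  intros H Hl. eapply (Clim_unique eventually); [apply Csum_lim, H|exact Hl].
Qed.

Lemma Clim_is_series u l : Clim eventually (csumn u) l -> @is_series C_AbsRing C_NormedModule u l.
Proof.
  intros H. apply filterlim_locally. intros eps.
  destruct (H eps (cond_pos eps)) as [N HN]. exists N. intros n Hn.
  apply C_NormedModule_mixin_compat1.
  generalize (HN (S n) ltac:(lia)). rewrite csumn_sum_n. intros K; exact K.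
Qed.

Lemma Csum_is_series u : summable u -> @is_series C_AbsRing C_NormedModule u (Csum u).
Proof. intros H. apply Clim_is_series, Csum_lim, H. Qed.

Lemma summable_plus u v : summable u -> summable v -> summable (fun n => u n + v n)%C.
Proof.
  intros H K. apply summable_le with (fun n => Cmod (u n) + Cmod (v n)).
  - intros; apply Cmod_triangle.
  - apply (ex_series_plus (V := R_NormedModule)); assumption.
Qed.

Lemma summable_scal c u : summable u -> summable (fun n => c * u n)%C.
Proof.
  intros H. apply summable_le with (fun n => scal (Cmod c) (Cmod (u n))).
  - intros; rewrite Cmod_mult; right; reflexivity.
  - apply (ex_series_scal (V := R_NormedModule)). exact H.
Qed.

Lemma summable_ext u v : (forall n, u n = v n) -> summable u -> summable v.
Proof. intros H. apply ex_series_ext. intros n; now rewrite H. Qed.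

Lemma summable_opp u : summable u -> summable (fun n => - u n)%C.
Proof. apply ex_series_ext. intros n; now rewrite Cmod_opp. Qed.

Lemma summable_minus u v : summable u -> summable v -> summable (fun n => u n - v n)%C.
Proof. intros; apply summable_plus; [|apply summable_opp]; assumption. Qed.

Lemma summable_shift u N : summable u -> summable (fun n => u (N + n)%nat).
Proof. intros H. unfold summable. apply (ex_series_incr_n (fun n => Cmod (u n)) N). exact H. Qed.

Lemma summable_unshift u N : summable (fun n => u (N + n)%nat) -> summable u.
Proof. intros H. unfold summable. apply (ex_series_incr_n (fun n => Cmod (u n)) N). exact H. Qed.

Lemma Csum_ext u v : (forall n, u n = v n) -> Csum u = Csum v.
Proof. intros H. unfold Csum. f_equal; apply Series_ext; intros n; now rewrite H. Qed.

Lemma Csum_plus u v : summable u -> summable v ->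
  Csum (fun n => u n + v n)%C = (Csum u + Csum v)%C.
Proof.
  intros H K. apply Csum_unique; [now apply summable_plus|].
  apply Clim_ext with (fun n => csumn u n + csumn v n)%C; [apply eventually_filter| |].
  - intros n; now rewrite csumn_plus.
  - apply Clim_plus; [apply eventually_filter| |]; now apply Csum_lim.
Qed.

Lemma Csum_scal c u : summable u -> Csum (fun n => c * u n)%C = (c * Csum u)%C.
Proof.
  intros H. apply Csum_unique; [now apply summable_scal|].
  apply Clim_ext with (fun n => c * csumn u n)%C; [apply eventually_filter| |].
  - intros n; now rewrite csumn_scal.
  - apply Clim_mult; [apply eventually_filter|apply Clim_const, eventually_filter|now apply Csum_lim].
Qed.

Lemma Csum_opp u : summable u -> Csum (fun n => - u n)%C = (- Csum u)%C.
Proof.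
  intros H. rewrite (Csum_ext _ (fun n => RtoC (-1) * u n)%C) by (intros; ring).
  rewrite Csum_scal by assumption. ring.
Qed.

Lemma Csum_minus u v : summable u -> summable v ->
  Csum (fun n => u n - v n)%C = (Csum u - Csum v)%C.
Proof.
  intros H K. unfold Cminus. rewrite (Csum_plus u (fun n => - v n)%C), Csum_opp;
  [reflexivity|assumption|assumption|now apply summable_opp].
Qed.

Lemma Clim_seq_shift (f : nat -> C) l N : Clim eventually f l -> Clim eventually (fun n => f (N + n)%nat) l.
Proof.
  intros H e He. destruct (H e He) as [K HK]. exists K. intros n Hn. apply HK. lia.
Qed.

Lemma Csum_shift u N : summable u -> Csum u = (csumn u N + Csum (fun n => u (N + n)%nat))%C.
Proof.
  intros H. apply (Clim_unique eventually (fun n => csumn u (N + n))).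
  - apply Clim_seq_shift. now apply Csum_lim.
  - apply Clim_ext with (fun n => csumn u N + csumn (fun k => u (N + k)%nat) n)%C; [apply eventually_filter| |].
    + intros n. now rewrite csumn_app.
    + apply Clim_plus; [apply eventually_filter|apply Clim_const, eventually_filter|].
      apply Csum_lim. now apply summable_shift.
Qed.

Lemma Csum_Sl u : summable u -> Csum u = (u 0%nat + Csum (fun n => u (S n)))%C.
Proof. intros H. rewrite (Csum_shift u 1 H). simpl. ring. Qed.

Lemma sum_n_le_Series (M : nat -> R) n : (forall k, 0 <= M k) -> ex_series M -> sum_n M n <= Series M.
Proof.
  intros HM H. apply (is_lim_seq_incr_compare (sum_n M)).
  - exact (Series_correct _ H).
  - intros k. rewrite sum_Sn. unfold plus; simpl. generalize (HM (S k)). lra.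
Qed.

Lemma Cmod_csumn_le u (M : nat -> R) n : (forall k, Cmod (u k) <= M k) ->
  Cmod (csumn u (S n)) <= sum_n M n.
Proof.
  intros H. induction n as [|n IH].
  - rewrite sum_O. simpl. replace (0 + u 0%nat)%C with (u 0%nat) by ring. apply H.
  - rewrite sum_Sn. simpl csumn in *. eapply Rle_trans; [apply Cmod_triangle|].
    apply Rplus_le_compat; [exact IH|apply H].
Qed.

Lemma Cmod_csumn_Series u (M : nat -> R) n : (forall k, Cmod (u k) <= M k) -> ex_series M ->
  Cmod (csumn u n) <= Series M.
Proof.
  intros H HM. assert (P : forall k, 0 <= M k) by (intros k; eapply Rle_trans; [apply Cmod_ge_0|apply H]).
  assert (Q : forall k, Cmod (csumn u (S k)) <= Series M).
  { intros k. eapply Rle_trans; [now apply Cmod_csumn_le|now apply sum_n_le_Series]. }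
  destruct n as [|n]; [|apply Q]. simpl. rewrite Cmod_0.
  eapply Rle_trans; [apply Cmod_ge_0|apply (Q 0%nat)].
Qed.

Lemma Cmod_Csum_le u (M : nat -> R) : (forall k, Cmod (u k) <= M k) -> ex_series M ->
  Cmod (Csum u) <= Series M.
Proof.
  intros H HM. apply (Clim_le_bound eventually (csumn u)).
  - apply Csum_lim. now apply summable_le with M.
  - apply filter_forall. intros n. now apply Cmod_csumn_Series.
Qed.

Lemma Series_tail (M : nat -> R) e : (forall k, 0 <= M k) -> ex_series M -> 0 < e ->
  exists N, Series (fun k => M (N + k)%nat) < e.
Proof.
  intros HM H He.
  destruct (is_series_Re_lim _ _ (Series_correct _ H) e He) as [N HN].
  exists (S N). specialize (HN N (le_n _)).
  rewrite (Series_incr_n M (S N)) in HN; [|lia|exact H].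
  simpl pred in HN. rewrite <- sum_n_Reals in HN.
  match goal with HN : Rabs (?a - (?a + ?b)) < e |- _ => replace (a - (a + b)) with (- b) in HN by ring end.
  rewrite Rabs_Ropp in HN. eapply Rle_lt_trans; [apply Rle_abs|exact HN].
Qed.

(** Tannery's theorem along an arbitrary filter: the tail of [M] bounds both remainders uniformly in
    the parameter, and the finitely many remaining terms converge one by one. *)
Lemma Csum_dominated {T : Type} (F : (T -> Prop) -> Prop) {FF : ProperFilter F}
  (u : nat -> T -> C) (v : nat -> C) (M : nat -> R) :
  ex_series M -> F (fun x => forall k, Cmod (u k x) <= M k) ->
  (forall k, Clim F (u k) (v k)) ->
  Clim F (fun x => Csum (fun k => u k x)) (Csum v).
Proof.
  intros HM Hu Hv.
  assert (Hv' : forall k, Cmod (v k) <= M k).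
  { intros k. apply (Clim_le_bound F (u k)); [apply Hv|]. revert Hu. apply filter_imp. auto. }
  assert (P : forall k, 0 <= M k) by (intros k; eapply Rle_trans; [apply Cmod_ge_0|apply Hv']).
  intros e He. destruct (Series_tail M (e / 3) P HM ltac:(lra)) as [N HN].
  assert (HM' : ex_series (fun k => M (N + k)%nat)) by now apply (ex_series_incr_n M N).
  assert (L : Clim F (fun x => csumn (fun k => u k x) N) (csumn v N)).
  { clear - Hv FF. induction N as [|N IH]; simpl; [apply Clim_const, FF|].
    apply Clim_plus; auto. }
  assert (He3 : 0 < e / 3) by lra.
  generalize (filter_and _ _ Hu (L _ He3)). apply filter_imp. intros x [H1 H2].
  rewrite (Csum_shift (fun k => u k x) N) by now apply summable_le with M.
  rewrite (Csum_shift v N) by now apply summable_le with M.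
  match goal with |- Cmod (?a + ?b - (?c + ?d))%C < e =>
    replace (a + b - (c + d))%C with ((a - c) + (b - d))%C by ring;
    eapply Rle_lt_trans; [apply Cmod_triangle|];
    assert (Cmod b <= Series (fun k => M (N + k)%nat)) by (apply Cmod_Csum_le; [intros; apply H1|exact HM']);
    assert (Cmod d <= Series (fun k => M (N + k)%nat)) by (apply Cmod_Csum_le; [intros; apply Hv'|exact HM']);
    generalize (Cmod_sub_le b d) end.
  lra.
Qed.

Lemma Csum_dominated_cont (u : nat -> C -> C) (M : nat -> R) (z : C) :
  ex_series M -> nbh z (fun w => forall k, Cmod (u k w) <= M k) ->
  (forall k, Ccont (u k) z) -> Ccont (fun w => Csum (fun k => u k w)) z.
Proof. intros. now apply (Csum_dominated (nbh z) u (fun k => u k z) M). Qed.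

Lemma ball_segment (z0 a : C) d t : Cmod (a - z0)%C < d -> 0 <= t <= 1 ->
  Cmod (z0 + RtoC t * (a - z0) - z0)%C < d.
Proof.
  intros Ha Ht. replace (z0 + RtoC t * (a - z0) - z0)%C with (RtoC t * (a - z0))%C by ring.
  rewrite Cmod_mult, Cmod_R, Rabs_pos_eq by lra. generalize (Cmod_ge_0 (a - z0)). nra.
Qed.

(** Termwise differentiation. The mean value inequality bounds the difference quotients of [f k] by
    the same [M k] as the derivatives, so their sum is a Caratheodory function for the series,
    continuous at [z] by domination. *)
Lemma Cder_Csum (f g : nat -> C -> C) (M : nat -> R) (z : C) :
  ex_series M ->
  nbh z (fun w => forall k, Cder (f k) w (g k w) /\ Cmod (g k w) <= M k) ->
  nbh z (fun w => summable (fun k => f k w)) ->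
  Cder (fun w => Csum (fun k => f k w)) z (Csum (fun k => g k z)).
Proof.
  intros HM [d [Hd H]] Hs.
  (* The difference quotient, completed at [z] by the derivative. *)
  set (phi := fun k w => if Ceq_dec w z then g k z else ((f k w - f k z) / (w - z))%C).
  assert (Bz : Cmod (z - z)%C < d) by (replace (z - z)%C with (RtoC 0) by ring; now rewrite Cmod_0).
  assert (B : forall w, Cmod (w - z)%C < d -> forall k, Cmod (phi k w) <= M k).
  { intros w Hw k. unfold phi. destruct (Ceq_dec w z) as [E|E]; [now apply H|].
    assert (E' : (w - z)%C <> RtoC 0) by now apply Cminus_eq_contra.
    unfold Cdiv. rewrite Cmod_mult, Cmod_inv by assumption.
    apply Cmod_pos in E'. apply Rmult_le_reg_r with (Cmod (w - z)%C); [exact E'|].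
    rewrite Rmult_assoc, Rinv_l, Rmult_1_r by lra.
    apply (Cder_mean_value (f k) (g k)). intros t Ht. cbv zeta.
    apply H. now apply ball_segment. }
  exists (fun w => Csum (fun k => phi k w)). split; [|split].
  - apply Csum_dominated_cont with M; [exact HM|exists d; split; [exact Hd|exact B]|].
    intros k. unfold Ccont. destruct (H z Bz k) as [[p [H1 [H2 H3]]] _].
    replace (phi k z) with (p z) by (unfold phi; destruct (Ceq_dec z z) as [_|n]; [exact H2|now elim n]).
    apply Clim_ext_loc with p; [apply nbh_filter| |exact H1].
    revert H3. apply filter_imp. intros w E. unfold phi.
    destruct (Ceq_dec w z) as [->|n]; [exact H2|]. rewrite E. field. now apply Cminus_eq_contra.
  - apply Csum_ext. intros k. unfold phi. destruct (Ceq_dec z z) as [_|n]; [reflexivity|now elim n].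
  - assert (Hs0 := nbh_self _ _ Hs). destruct Hs as [d' [Hd' Hs]].
    exists (Rmin d d'). split; [now apply Rmin_pos|]. intros w Hw.
    rewrite <- Csum_minus; [|apply Hs; eapply Rlt_le_trans; [exact Hw|apply Rmin_r]|exact Hs0].
    rewrite (Csum_ext _ (fun k => (w - z) * phi k w)%C).
    + rewrite Csum_scal; [ring|]. apply summable_le with M; [|exact HM].
      apply B. eapply Rlt_le_trans; [exact Hw|apply Rmin_l].
    + intros k. unfold phi. destruct (Ceq_dec w z) as [->|n]; [ring|].
      field. now apply Cminus_eq_contra.
Qed.

Lemma summable_0 : summable (fun _ : nat => RtoC 0).
Proof.
  exists 0. apply (is_series_ext (fun _ : nat => 0)); [intros; now rewrite Cmod_0|].
  apply filterlim_ext with (fun _ : nat => 0); [|apply filterlim_const].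
  intros n. rewrite sum_n_const. ring.
Qed.

Lemma Csum_0 : Csum (fun _ : nat => RtoC 0) = RtoC 0.
Proof.
  rewrite (Csum_ext _ (fun _ => 0 * 0)%C) by (intros; ring).
  rewrite (Csum_scal 0 (fun _ => RtoC 0)) by exact summable_0. ring.
Qed.

Lemma csumn_Csum_swap (u : nat -> nat -> C) N :
  (forall m, summable (fun n => u n m)) ->
  Csum (fun n => csumn (u n) N) = csumn (fun m => Csum (fun n => u n m)) N
  /\ summable (fun n => csumn (u n) N).
Proof.
  intros H. induction N as [|N [IH1 IH2]]; simpl.
  - split; [apply Csum_0|apply summable_0].
  - split; [|now apply summable_plus].
    rewrite Csum_plus by auto. now rewrite IH1.
Qed.

(** The column side is left as a limit of partial sums: in the application these are computed
    explicitly and their limit splits into a series and a boundary term. *)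
Lemma Csum_Csum_swap (u : nat -> nat -> C) (t : nat -> nat -> R) :
  (forall n m, Cmod (u n m) <= t n m) -> (forall n, ex_series (t n)) ->
  ex_series (fun n => Series (t n)) ->
  Clim eventually (csumn (fun m => Csum (fun n => u n m))) (Csum (fun n => Csum (u n))).
Proof.
  intros H1 H2 H3.
  assert (P : forall n k, 0 <= t n k) by (intros; eapply Rle_trans; [apply Cmod_ge_0|apply H1]).
  assert (Hc : forall m, summable (fun n => u n m)).
  { intros m. apply summable_le with (fun n => Series (t n)); [|exact H3].
    intros n. eapply Rle_trans; [apply H1|]. eapply Rle_trans; [|apply (sum_n_le_Series (t n) m); auto].
    destruct m as [|m]; [rewrite sum_O; lra|]. rewrite sum_Sn. unfold plus; simpl.
    assert (0 <= sum_n (t n) m); [|lra].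
    rewrite sum_n_Reals. apply cond_pos_sum. auto. }
  apply Clim_ext with (fun N => Csum (fun n => csumn (u n) N)); [apply eventually_filter| |].
  - intros N. now apply csumn_Csum_swap.
  - apply (Csum_dominated eventually (fun n N => csumn (u n) N) (fun n => Csum (u n)) (fun n => Series (t n))).
    + exact H3.
    + apply filter_forall. intros N n. apply Cmod_csumn_Series; auto.
    + intros n. apply Csum_lim. apply summable_le with (t n); auto.
Qed.

(** * The exponential e(z) = exp(2 pi i z) *)

Notation tpi := (RtoC (2 * PI) * Ci)%C.

Lemma tpi_nz : tpi <> 0.
Proof. apply Cmult_neq_0; [apply RtoC_nz; generalize PI_RGT_0; lra|apply Ci_nz]. Qed.

Lemma Ce_add z w : Ce (z + w)%C = (Ce z * Ce w)%C.
Proof. unfold Ce. rewrite <- Cexp_add. f_equal. ring. Qed.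

Lemma Ce_0 : Ce 0 = 1.
Proof. unfold Ce. rewrite <- Cexp_0. f_equal. ring. Qed.

Lemma Ce_nz z : Ce z <> 0.
Proof. apply Cexp_nz. Qed.

Lemma Ce_opp z : Ce (- z)%C = (/ Ce z)%C.
Proof. unfold Ce. rewrite <- Cexp_opp. f_equal. ring. Qed.

Lemma Ce_minus z w : Ce (z - w)%C = (Ce z / Ce w)%C.
Proof. unfold Cminus. now rewrite Ce_add, Ce_opp. Qed.

Lemma Re_tpi z : Re (tpi * z)%C = - (2 * PI * Im z).
Proof. destruct z; simpl. ring. Qed.

Lemma Im_tpi z : Im (tpi * z)%C = 2 * PI * Re z.
Proof. destruct z; simpl. ring. Qed.

Lemma Cmod_Ce z : Cmod (Ce z) = exp (- (2 * PI * Im z)).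
Proof. unfold Ce. now rewrite Cmod_Cexp, Re_tpi. Qed.

Lemma Ce_1 : Ce 1 = 1.
Proof.
  unfold Ce, Cexp. rewrite Re_tpi, Im_tpi. simpl. rewrite Rmult_0_r, Ropp_0, exp_0, Rmult_1_r, cos_2PI, sin_2PI.
  unfold RtoC. f_equal; ring.
Qed.

Lemma Ce_half : Ce (/ 2)%R = RtoC (-1).
Proof.
  unfold Ce, Cexp. rewrite Re_tpi, Im_tpi. simpl. rewrite Rmult_0_r, Ropp_0, exp_0.
  replace (2 * PI * / 2) with PI by field. rewrite cos_PI, sin_PI.
  unfold RtoC. f_equal; ring.
Qed.

Lemma Ce_pow z n : Ce (INR n * z)%C = Cpow (Ce z) n.
Proof. unfold Ce. rewrite <- Cexp_INR. f_equal. ring. Qed.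

Lemma Ce_nat n : Ce (INR n) = 1.
Proof.
  replace (RtoC (INR n)) with (INR n * 1)%C by ring.
  rewrite Ce_pow, Ce_1. apply Cpow_1_l.
Qed.

Lemma Ce_IZR n : Ce (IZR n) = 1.
Proof.
  destruct n as [|p|p].
  - apply Ce_0.
  - rewrite <- positive_nat_Z, <- INR_IZR_INZ. apply Ce_nat.
  - change (Z.neg p) with (- Z.pos p)%Z. rewrite opp_IZR, RtoC_opp, Ce_opp.
    rewrite <- positive_nat_Z, <- INR_IZR_INZ, Ce_nat. field.
Qed.

Lemma Cder_Ce z : Cder Ce z (tpi * Ce z)%C.
Proof.
  eapply Cder_eq; [|apply (Cder_Cexp_comp (fun w => tpi * w)%C z (tpi * 1)%C), Cder_scal, Cder_id].
  unfold Ce. ring.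
Qed.

Lemma Ccont_Ce z : Ccont Ce z.
Proof. eapply Cder_cont, Cder_Ce. Qed.

(** * Partial fractions by dyadic subdivision *)

Definition dy (j : nat) : R := (/ 2) ^ j.

Lemma dy_pos j : 0 < dy j.
Proof. apply pow_lt; lra. Qed.

Lemma dy_pow j : dy j * INR (2 ^ j) = 1.
Proof.
  unfold dy. rewrite pow_INR, <- Rpow_mult_distr.
  replace (/ 2 * INR 2) with 1 by (simpl; field). apply pow1.
Qed.

Lemma dy_small e : 0 < e -> eventually (fun j => dy j < e).
Proof.
  intros He. destruct (pow_lt_1_zero (/ 2) ltac:(rewrite Rabs_pos_eq; lra) e He) as [N HN].
  exists N. intros n Hn. generalize (HN n Hn). rewrite Rabs_pos_eq; [intros K; exact K|].
  left; apply dy_pos.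
Qed.

Lemma dy_lim : Clim eventually (fun j => RtoC (dy j)) 0.
Proof.
  apply Clim_RtoC; [apply eventually_filter|]. intros e He. generalize (dy_small e He). apply filter_imp.
  intros j Hj. rewrite Rminus_0_r, Rabs_pos_eq; [exact Hj|left; apply dy_pos].
Qed.

Lemma csumn_1 u : csumn u 1 = u 0%nat.
Proof. simpl. ring. Qed.

Lemma csumn_rev u n : csumn u n = csumn (fun k => u (n - 1 - k)%nat) n.
Proof.
  induction n as [|n IH]; [reflexivity|].
  rewrite (csumn_Sl (fun k => u (S n - 1 - k)%nat)). simpl csumn at 1.
  replace (S n - 1 - 0)%nat with n by lia. rewrite IH, Cplus_comm. f_equal.
  apply csumn_ext. intros k Hk. f_equal. lia.
Qed.

(** Duplication in the manner of Herglotz. The factor [sigma] is 1/2 for the cotangent and 1/4 for 1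
    / sin^2. After j steps the arguments are scaled by 2^(-j), so each translate contributes in the
    limit only through the pole of [phi] at 0, and this is the corresponding partial fraction. *)
Section Dyadic.
Variables (phi : C -> C) (sigma : C).
Hypothesis phi_period : forall z, phi (z + 1)%C = phi z.
Hypothesis phi_double : forall z, Ce z <> 1 ->
  phi z = (sigma * (phi (RtoC (/ 2) * z) + phi (RtoC (/ 2) * (z + 1))))%C.

Lemma Ce_dy_neq1 z j k : Ce z <> 1 -> Ce (RtoC (dy j) * (z + INR k))%C <> 1.
Proof.
  intros Hz H. apply Hz.
  assert (E : (z + INR k = INR (2 ^ j) * (RtoC (dy j) * (z + INR k)))%C).
  { rewrite Cmult_assoc, <- RtoC_mult, Rmult_comm, dy_pow. ring. }
  replace (Ce z) with (Ce (z + INR k)%C) by (rewrite Ce_add, Ce_nat; ring).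
  rewrite E, Ce_pow, H. apply Cpow_1_l.
Qed.

Lemma phi_dyadic z j : Ce z <> 1 ->
  phi z = (Cpow sigma j * csumn (fun k => phi (RtoC (dy j) * (z + INR k))) (2 ^ j))%C.
Proof.
  intros Hz. induction j as [|j IH].
  - simpl. rewrite Cplus_0_l, Cmult_1_l. f_equal. unfold dy; simpl. ring.
  - rewrite IH. replace (2 ^ S j)%nat with (2 ^ j + 2 ^ j)%nat by (simpl; lia).
    rewrite csumn_app, <- csumn_plus.
    replace (Cpow sigma (S j)) with (Cpow sigma j * sigma)%C by (simpl; ring).
    rewrite <- Cmult_assoc. f_equal. rewrite <- csumn_scal. apply csumn_ext. intros k _.
    rewrite phi_double by now apply Ce_dy_neq1. f_equal.
    assert (E : RtoC (dy (S j)) = (RtoC (/ 2) * RtoC (dy j))%C) by (rewrite <- RtoC_mult; reflexivity).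
    f_equal; f_equal; rewrite E; [ring|].
    rewrite plus_INR, RtoC_plus.
    transitivity (RtoC (/ 2) * (RtoC (dy j) * (z + INR k) + RtoC (dy j * INR (2 ^ j))))%C.
    + rewrite dy_pow. ring.
    + rewrite RtoC_mult. ring.
Qed.

(** Of the 2^(j+1) translates, those with k > 2^j are moved by periodicity to negative shifts and
    paired with the positive ones, which is needed for convergence in the case of the cotangent. The
    translates k = 0 and k = 2^j stay alone; the latter is displaced by exactly 1/2, far from the
    pole, and vanishes in the limit. *)
Lemma phi_dyadic_sym z j : Ce z <> 1 ->
  phi z = (Cpow sigma (S j) * phi (RtoC (dy (S j)) * z)
    + Cpow sigma (S j) * phi (RtoC (dy (S j)) * z + RtoC (/ 2))
    + csumn (fun k => Cpow sigma (S j) * (phi (RtoC (dy (S j)) * (z + INR (S k)))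
              + phi (RtoC (dy (S j)) * (z - INR (S k))))) (2 ^ j - 1))%C.
Proof.
  intros Hz. rewrite (phi_dyadic z (S j) Hz).
  set (s := Cpow sigma (S j)). set (h := dy (S j)).
  assert (Hh : h * INR (2 ^ j) = / 2).
  { generalize (dy_pow (S j)). fold h. replace (2 ^ S j)%nat with (2 * 2 ^ j)%nat by (simpl; lia).
    rewrite mult_INR. simpl (INR 2). lra. }
  rewrite csumn_scal, <- !Cmult_plus_distr_l. f_equal.
  assert (P : (0 < 2 ^ j)%nat) by (apply Nat.neq_0_lt_0, Nat.pow_nonzero; lia).
  remember (2 ^ j - 1)%nat as M eqn:EM.
  assert (E2 : (2 ^ S j = (1 + M) + (1 + M))%nat) by (simpl; lia).
  assert (E1 : (2 ^ j = 1 + M)%nat) by lia.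
  rewrite E2, csumn_app, !csumn_app, !csumn_1.
  rewrite csumn_plus. rewrite (csumn_rev (fun k => phi (RtoC h * (z + INR (1 + M + (1 + k)))))%C).
  match goal with |- (?a + ?b + (?c + ?d) = ?e + ?f + (?g + ?i))%C =>
    assert (Ha : a = e); [|assert (Hb : b = g); [|assert (Hc : c = f); [|assert (Hd : d = i)]]] end.
  - f_equal. simpl. ring.
  - reflexivity.
  - f_equal. rewrite Nat.add_0_r. rewrite <- E1. rewrite <- Hh, RtoC_mult. ring.
  - apply csumn_ext. intros k Hk.
    rewrite <- (phi_period (RtoC h * (z - INR (S k)))%C). f_equal.
    replace (1 + M + (1 + (M - 1 - k)))%nat with (2 * 2 ^ j - S k)%nat by lia.
    rewrite minus_INR by lia. rewrite RtoC_minus.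
    transitivity (RtoC h * (z - INR (S k)) + RtoC (h * INR (2 * 2 ^ j)))%C.
    + rewrite RtoC_mult. ring.
    + f_equal. f_equal. rewrite mult_INR. simpl (INR 2). lra.
  - rewrite Ha, Hb, Hc, Hd. ring.
Qed.

Lemma partial_fractions z t0 (t : nat -> C) (M : nat -> R) :
  Ce z <> 1 ->
  Clim eventually (fun j => Cpow sigma (S j) * phi (RtoC (dy (S j)) * z))%C t0 ->
  Clim eventually (fun j => Cpow sigma (S j) * phi (RtoC (dy (S j)) * z + RtoC (/ 2)))%C 0 ->
  (forall k, Clim eventually (fun j => Cpow sigma (S j) * (phi (RtoC (dy (S j)) * (z + INR (S k)))
              + phi (RtoC (dy (S j)) * (z - INR (S k)))))%C (t k)) ->
  ex_series M ->
  eventually (fun j => forall k, (k < 2 ^ j - 1)%nat ->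
     Cmod (Cpow sigma (S j) * (phi (RtoC (dy (S j)) * (z + INR (S k)))
              + phi (RtoC (dy (S j)) * (z - INR (S k)))))%C <= M k) ->
  phi z = (t0 + Csum t)%C.
Proof.
  intros Hz H0 Hh Ht HM Hb.
  assert (PM : forall k, 0 <= M k).
  { intros k. destruct Hb as [J HJ].
    eapply Rle_trans; [apply Cmod_ge_0|apply (HJ (J + S (S k))%nat)]; [lia|].
    assert (S (S k) < 2 ^ S (S k))%nat by (apply Nat.pow_gt_lin_r; lia).
    assert (2 ^ S (S k) <= 2 ^ (J + S (S k)))%nat by (apply Nat.pow_le_mono_r; lia). lia. }
  set (u := fun k j => (Cpow sigma (S j) * (phi (RtoC (dy (S j)) * (z + INR (S k)))
              + phi (RtoC (dy (S j)) * (z - INR (S k)))))%C).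
  (* The finite sum, padded with zeros to a series, so that [Csum_dominated] applies although the
     range grows with [j]. *)
  set (v := fun k j => if (k <? 2 ^ j - 1)%nat then u k j else 0).
  apply (Clim_unique eventually (fun _ => phi z)); [apply Clim_const, eventually_filter|].
  apply Clim_ext with (fun j => Cpow sigma (S j) * phi (RtoC (dy (S j)) * z)
    + Cpow sigma (S j) * phi (RtoC (dy (S j)) * z + RtoC (/ 2)) + Csum (fun k => v k j))%C;
    [apply eventually_filter| |].
  - intros j. rewrite (phi_dyadic_sym z j Hz). f_equal.
    assert (Z : forall n, v (2 ^ j - 1 + n)%nat j = 0).
    { intros n. unfold v. destruct (Nat.ltb_spec (2 ^ j - 1 + n) (2 ^ j - 1)); [lia|reflexivity]. }
    rewrite (Csum_shift _ (2 ^ j - 1)).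
    + rewrite (Csum_ext (fun n => v (2 ^ j - 1 + n)%nat j) (fun _ => 0)) by exact Z.
      rewrite Csum_0, Cplus_0_r. apply csumn_ext. intros k Hk. unfold v.
      destruct (Nat.ltb_spec k (2 ^ j - 1)); [reflexivity|lia].
    + apply summable_unshift with (2 ^ j - 1)%nat. eapply summable_ext; [intros n; symmetry; apply Z|apply summable_0].
  - apply Clim_eq with (t0 + 0 + Csum t)%C; [ring|].
    apply Clim_plus; [apply eventually_filter| |].
    { apply Clim_plus; [apply eventually_filter|exact H0|exact Hh]. }
    apply (Csum_dominated eventually v t M HM).
    + revert Hb. apply filter_imp. intros j Hj k. unfold v.
      destruct (Nat.ltb_spec k (2 ^ j - 1)) as [h|h]; [now apply Hj|]. rewrite Cmod_0. apply PM.
    + intros k. apply Clim_ext_loc with (u k); [apply eventually_filter| |apply Ht].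
      exists (S (S k)). intros j Hj. unfold v.
      destruct (Nat.ltb_spec k (2 ^ j - 1)) as [h|h]; [reflexivity|].
      assert (S (S k) < 2 ^ S (S k))%nat by (apply Nat.pow_gt_lin_r; lia).
      assert (2 ^ S (S k) <= 2 ^ j)%nat by (apply Nat.pow_le_mono_r; lia). lia.
Qed.
End Dyadic.

(** * Lower bounds for |1 - e(v)| *)

(** The range reaches beyond 1/2 because the rescaled points have real part up to 1/2 from the shift
    plus 1/4 from [Re z]. *)
Lemma sin_PI_lower x : 0 <= x <= 3 / 4 -> x / 4 <= sin (PI * x).
Proof.
  intros Hx. assert (P4 := PI_4). assert (P2 := PI2_1).
  assert (S2 : 1 / 4 <= sin (1 / 2)).
  { generalize (sin_minus_id_le (1 / 2) ltac:(rewrite Rabs_pos_eq; lra)). intros H.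
    apply Rabs_le_between in H. lra. }
  destruct (Rle_dec (PI * x) (1 / 2)) as [h|h].
  - assert (0 <= PI * x) by nra.
    generalize (sin_minus_id_le (PI * x) ltac:(rewrite Rabs_pos_eq; lra)). intros H1.
    apply Rabs_le_between in H1. nra.
  - apply Rnot_le_lt in h. apply Rle_trans with (1 / 4); [lra|]. apply Rle_trans with (sin (1 / 2)); [exact S2|].
    destruct (Rle_dec (PI * x) (PI / 2)) as [h2|h2].
    + apply sin_incr_1; lra.
    + rewrite <- (sin_PI_x (PI * x)). apply sin_incr_1; nra.
Qed.

Lemma Rabs_sqr x : x * x = Rabs x * Rabs x.
Proof. unfold Rabs. destruct (Rcase_abs x); ring. Qed.

(** With r = |e(v)| and x = Re v one has |1 - e(v)|^2 = (1 - r)^2 + 4 r sin(pi x)^2. The first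
    summand controls Im v, the second Re v; in the strip |Re v| <= 3/4 the only zero is v = 0,
    whence a bound linear in |v|. *)
Lemma one_minus_Ce_lower v Y : Rabs (Re v) <= 3 / 4 -> Rabs (Im v) <= Y ->
  exp (- (2 * PI * Y)) / 2 * Cmod v <= Cmod (1 - Ce v)%C.
Proof.
  intros Hx Hy. set (x := Re v) in *. set (y := Im v) in *. assert (P2 := PI2_1).
  assert (HY : 0 <= Y) by (generalize (Rabs_pos y); lra).
  set (r0 := exp (- (2 * PI * Y))). set (r := exp (- (2 * PI * y))).
  assert (Hr0 : 0 < r0) by apply exp_pos. assert (Hr : 0 < r) by apply exp_pos.
  assert (Hr01 : r0 <= 1).
  { rewrite <- exp_0. unfold r0. destruct (Req_dec Y 0) as [->|]; [right; f_equal; ring|].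
    left; apply exp_increasing; nra. }
  assert (Hy' := proj1 (Rabs_le_between _ _) Hy).
  assert (Hrr0 : r0 <= r).
  { unfold r, r0. destruct (Req_dec Y y) as [->|]; [lra|]. left; apply exp_increasing. nra. }
  assert (E : Cmod (1 - Ce v) * Cmod (1 - Ce v) = (1 - r) * (1 - r) + 4 * r * (sin (PI * x) * sin (PI * x))).
  { rewrite Cmod_sqr. unfold Cminus. rewrite re_plus, im_plus, re_opp, im_opp.
    unfold Ce, Cexp. rewrite Re_tpi, Im_tpi. fold x y r. simpl.
    replace (2 * PI * x) with (2 * (PI * x)) by ring. rewrite sin_2a, cos_2a.
    generalize (sin2_cos2 (PI * x)). unfold Rsqr.
    set (sn := sin (PI * x)). set (cs := cos (PI * x)). intros H.
    assert (H' : cs * cs = 1 - sn * sn) by lra.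
    transitivity (1 - 2 * r * (cs * cs - sn * sn) + r * r * ((cs * cs - sn * sn) * (cs * cs - sn * sn) + 4 * (sn * sn) * (cs * cs))); [ring|].
    rewrite H'. ring. }
  assert (S1 : x * x / 16 <= sin (PI * x) * sin (PI * x)).
  { assert (H : Rabs x / 4 <= Rabs (sin (PI * x))).
    { destruct (Rle_dec 0 x) as [h|h].
      - rewrite (Rabs_pos_eq x) in * by lra. eapply Rle_trans; [apply sin_PI_lower; lra|apply Rle_abs].
      - apply Rnot_le_lt in h. rewrite (Rabs_left x) in * by lra.
        replace (PI * x) with (- (PI * - x)) by ring. rewrite sin_neg, Rabs_Ropp.
        eapply Rle_trans; [apply sin_PI_lower; lra|apply Rle_abs]. }
    replace (x * x / 16) with ((Rabs x / 4) * (Rabs x / 4)).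
    - rewrite (Rabs_sqr (sin (PI * x))).
      generalize (Rabs_pos x). intros. apply Rmult_le_compat; lra.
    - rewrite (Rabs_sqr x). field. }
  assert (S2 : r0 * r0 * (y * y) <= (1 - r) * (1 - r)).
  { assert (H : r0 * Rabs y <= Rabs (1 - r)).
    { destruct (Rle_dec 0 y) as [h|h].
      - rewrite (Rabs_pos_eq y) by lra. eapply Rle_trans; [|apply Rle_abs].
        generalize (exp_ineq1_le (2 * PI * y)). intros K.
        assert (K2 : r * exp (2 * PI * y) = 1).
        { unfold r. rewrite <- exp_plus, <- exp_0. f_equal. ring. }
        assert (r * (1 + 2 * PI * y) <= 1) by nra.
        assert (r * (y) <= r * (2 * PI * y)) by (apply Rmult_le_compat_l; nra). nra.
      - apply Rnot_le_lt in h. rewrite (Rabs_left y) by lra.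
        generalize (exp_ineq1_le (- (2 * PI * y))). fold r. intros K.
        rewrite Rabs_minus_sym. eapply Rle_trans; [|apply Rle_abs]. nra. }
    replace (r0 * r0 * (y * y)) with ((r0 * Rabs y) * (r0 * Rabs y)).
    - rewrite (Rabs_sqr (1 - r)).
      assert (0 <= r0 * Rabs y) by (generalize (Rabs_pos y); nra).
      apply Rmult_le_compat; lra.
    - rewrite (Rabs_sqr y). ring. }
  apply Rsqr_incr_0_var; [|apply Cmod_ge_0]. unfold Rsqr. rewrite E.
  replace (r0 / 2 * Cmod v * (r0 / 2 * Cmod v)) with (r0 * r0 / 4 * (Cmod v * Cmod v)) by field.
  rewrite (Cmod_sqr v). fold x y.
  assert (r0 * r0 <= r) by nra.
  assert (r0 * r0 * (x * x / 16) <= r * (sin (PI * x) * sin (PI * x))) by (apply Rmult_le_compat; nra).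
  assert (0 <= r0 * r0 * (y * y)) by nra. nra.
Qed.

(* Satisfied by the points of the upper half-plane and by z = 1/2, which gives zeta(2). *)
Definition sep (z : C) (c : R) : Prop := 0 < c /\
  forall k : nat, c * (1 + INR k) <= Cmod (z + INR k)%C /\ c * (1 + INR k) <= Cmod (z - INR k)%C.

Lemma sep_plus_nz z c k : sep z c -> (z + INR k)%C <> 0.
Proof.
  intros [Hc H]. apply Cmod_nz. generalize (proj1 (H k)) (pos_INR k). nra.
Qed.

Lemma sep_minus_nz z c k : sep z c -> (z - INR k)%C <> 0.
Proof.
  intros [Hc H]. apply Cmod_nz. generalize (proj2 (H k)) (pos_INR k). nra.
Qed.

Lemma sep_nz z c : sep z c -> z <> 0.
Proof. intros H. replace z with (z + INR 0)%C by (simpl; ring). now apply sep_plus_nz with c. Qed.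

Lemma Clim_dy (f : C -> C) z : Clim (nbh 0) f z -> forall w, Clim eventually (fun j => f (RtoC (dy (S j)) * w)%C) z.
Proof.
  intros Hf w e He. destruct (Hf e He) as [d [Hd H]].
  assert (L : Clim eventually (fun j => RtoC (dy (S j)) * w)%C 0).
  { apply Clim_eq with (0 * w)%C; [ring|].
    apply Clim_mult; [apply eventually_filter|apply (Clim_seq_shift (fun j => RtoC (dy j)) _ 1), dy_lim|apply Clim_const, eventually_filter]. }
  generalize (L d Hd). apply filter_imp. intros j. apply H.
Qed.

Lemma Clim_one_minus_Ce w :
  Clim eventually (fun j => (1 - Ce (RtoC (dy (S j)) * w)) / RtoC (dy (S j)))%C (- (tpi * w))%C.
Proof.
  destruct (Cder_Ce 0) as [p [H1 [H2 [d [Hd H3]]]]].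
  apply Clim_ext_loc with (fun j => - (p (RtoC (dy (S j)) * w) * w))%C; [apply eventually_filter| |].
  - assert (L : Clim eventually (fun j => RtoC (dy (S j)) * w)%C 0).
    { apply (Clim_dy (fun w => w) 0). apply (Ccont_id 0). }
    generalize (L d Hd). apply filter_imp. intros j Hj. specialize (H3 _ Hj).
    rewrite Ce_0 in H3.
    assert (D : RtoC (dy (S j)) <> 0) by (apply RtoC_nz; generalize (dy_pos (S j)); lra).
    replace (1 - Ce (RtoC (dy (S j)) * w))%C with (- (Ce (RtoC (dy (S j)) * w) - 1))%C by ring.
    rewrite H3. field. exact D.
  - apply Clim_opp; [apply eventually_filter|]. apply Clim_mult; [apply eventually_filter| |apply Clim_const, eventually_filter].
    rewrite Ce_0 in H2. replace tpi with (p 0)%C by (rewrite H2; ring).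
    apply (Clim_dy p). exact H1.
Qed.

Lemma Clim_Ce_dy w : Clim eventually (fun j => Ce (RtoC (dy (S j)) * w)%C) 1.
Proof. apply Clim_dy. rewrite <- Ce_0. apply Ccont_Ce. Qed.

Lemma Clim_Ce_dy_half w : Clim eventually (fun j => Ce (RtoC (dy (S j)) * w + RtoC (/ 2))%C) (RtoC (-1)).
Proof.
  apply Clim_ext with (fun j => Ce (RtoC (dy (S j)) * w) * RtoC (-1))%C; [apply eventually_filter| |].
  - intros j. now rewrite Ce_add, Ce_half.
  - apply Clim_eq with (1 * RtoC (-1))%C; [ring|].
    apply Clim_mult; [apply eventually_filter|apply Clim_Ce_dy|apply Clim_const, eventually_filter].
Qed.

(* kap z = i cot (pi z) and psi z = - 1 / (4 sin (pi z)^2). *)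
Definition kap (z : C) : C := ((1 + Ce z) / (1 - Ce z))%C.
Definition psi (z : C) : C := (Ce z / ((1 - Ce z) * (1 - Ce z)))%C.

Lemma kap_period z : kap (z + 1)%C = kap z.
Proof. unfold kap. now rewrite Ce_add, Ce_1, Cmult_1_r. Qed.

Lemma psi_period z : psi (z + 1)%C = psi z.
Proof. unfold psi. now rewrite Ce_add, Ce_1, Cmult_1_r. Qed.

Lemma Ce_half_sqr z : Ce z = (Ce (RtoC (/ 2) * z) * Ce (RtoC (/ 2) * z))%C.
Proof.
  rewrite <- Ce_add, <- Cmult_plus_distr_r, <- RtoC_plus.
  replace (/ 2 + / 2) with 1 by field. now rewrite Cmult_1_l.
Qed.

Lemma Ce_half_shift z : Ce (RtoC (/ 2) * (z + 1))%C = (- Ce (RtoC (/ 2) * z))%C.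
Proof.
  replace (RtoC (/ 2) * (z + 1))%C with (RtoC (/ 2) * z + RtoC (/ 2))%C by ring.
  rewrite Ce_add, Ce_half. ring.
Qed.

Lemma sqr_neq1 s : (s * s)%C <> 1 -> (1 - s)%C <> 0 /\ (1 + s)%C <> 0.
Proof.
  intros H; split; intros K; apply H.
  - replace s with (1 - (1 - s))%C by ring. rewrite K. ring.
  - replace s with ((1 + s) - 1)%C by ring. rewrite K. ring.
Qed.

Lemma kap_double z : Ce z <> 1 ->
  kap z = (RtoC (/ 2) * (kap (RtoC (/ 2) * z) + kap (RtoC (/ 2) * (z + 1))))%C.
Proof.
  intros H. unfold kap. rewrite Ce_half_shift, (Ce_half_sqr z). rewrite (Ce_half_sqr z) in H.
  set (s := Ce (RtoC (/ 2) * z)) in *. destruct (sqr_neq1 s H) as [H1 H2].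
  rewrite RtoC_inv by lra. field. repeat split; try assumption.
  - replace (1 - - s)%C with (1 + s)%C by ring. exact H2.
  - replace (1 - s * s)%C with ((1 - s) * (1 + s))%C by ring. now apply Cmult_neq_0.
Qed.

Lemma psi_double z : Ce z <> 1 ->
  psi z = (RtoC (/ 4) * (psi (RtoC (/ 2) * z) + psi (RtoC (/ 2) * (z + 1))))%C.
Proof.
  intros H. unfold psi. rewrite Ce_half_shift, (Ce_half_sqr z). rewrite (Ce_half_sqr z) in H.
  set (s := Ce (RtoC (/ 2) * z)) in *. destruct (sqr_neq1 s H) as [H1 H2].
  rewrite RtoC_inv by lra. field. repeat split; try assumption.
  - replace (1 - - s)%C with (1 + s)%C by ring. exact H2.
  - replace (1 - s * s)%C with ((1 - s) * (1 + s))%C by ring. now apply Cmult_neq_0.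
Qed.

Lemma ex_series_telescoping : ex_series (fun k => / ((INR k + 1) * (INR k + 2))).
Proof.
  exists 1. assert (H : is_lim_seq (sum_n (fun k => / ((INR k + 1) * (INR k + 2)))) 1); [|exact H].
  apply (is_lim_seq_ext (fun n => 1 - / (INR n + 2))).
  - intros n. induction n as [|n IH].
    + rewrite sum_O. simpl. field.
    + rewrite sum_Sn, <- IH, S_INR. unfold plus; simpl. generalize (pos_INR n); intros. field. lra.
  - replace (Finite 1) with (Finite (1 - 0)) by (f_equal; ring).
    apply is_lim_seq_minus'; [apply is_lim_seq_const|].
    apply is_lim_seq_spec. intros [e He]. simpl.
    destruct (archimed_cor1 e He) as [N [HN1 HN2]]. exists N. intros n Hn.
    apply le_INR in Hn. apply lt_0_INR in HN2. rewrite Rminus_0_r, Rabs_pos_eq.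
    + eapply Rle_lt_trans; [|exact HN1]. apply Rinv_le_contravar; lra.
    + left. apply Rinv_0_lt_compat. lra.
Qed.

Lemma ex_series_Rscal (c : R) a : ex_series a -> ex_series (fun k => c * a k).
Proof. apply (ex_series_scal (V := R_NormedModule) c a). Qed.

Lemma ex_series_inv_sqr : ex_series (fun k => / ((INR k + 1) * (INR k + 1))).
Proof.
  apply ex_series_Rle with (fun k => 2 * / ((INR k + 1) * (INR k + 2))).
  - intros k. generalize (pos_INR k). intros P. split.
    + left. apply Rinv_0_lt_compat. nra.
    + replace (2 * / ((INR k + 1) * (INR k + 2))) with (/ ((INR k + 1) * (INR k + 2) / 2)) by (field; lra).
      apply Rinv_le_contravar; nra.
  - apply ex_series_Rscal, ex_series_telescoping.
Qed.

Lemma ex_series_inv_sqr2 : ex_series (fun k => / ((INR k + 2) * (INR k + 2))).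
Proof.
  apply ex_series_Rle with (2 := ex_series_inv_sqr).
  intros k. generalize (pos_INR k). intros P. split.
  - left. apply Rinv_0_lt_compat. nra.
  - apply Rinv_le_contravar; nra.
Qed.

(** The bound is uniform in [k]: as long as k < 2^j - 1, the rescaled points stay in the strip where
    [one_minus_Ce_lower] applies. The factor [INR k + 2] is [1 + INR (S k)] from [sep]. *)
Lemma one_minus_Ce_dy_lower z c : sep z c ->
  eventually (fun j => forall k, (k < 2 ^ j - 1)%nat ->
    let r := dy (S j) * (exp (- (2 * PI * Rabs (Im z))) / 2 * (c * (INR k + 2))) in
    r <= Cmod (1 - Ce (RtoC (dy (S j)) * (z + INR (S k))))%C /\
    r <= Cmod (1 - Ce (RtoC (dy (S j)) * (z - INR (S k))))%C).
Proof.
  intros [Hc Hs].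
  assert (He : 0 < / (4 * (Rabs (Re z) + 1))) by (apply Rinv_0_lt_compat; generalize (Rabs_pos (Re z)); lra).
  generalize (dy_small _ He). apply filter_imp. intros j Hj k Hk. cbv zeta.
  assert (Dj := dy_pos j).
  assert (ES : dy (S j) = / 2 * dy j) by reflexivity.
  assert (D : 0 < dy (S j)) by apply dy_pos.
  assert (D1 : dy (S j) <= 1).
  { unfold dy. rewrite <- (pow1 (S j)). apply pow_incr. lra. }
  assert (Hx : dy (S j) * Rabs (Re z) <= 1 / 4).
  { generalize (Rabs_pos (Re z)). intros P.
    apply (Rmult_lt_compat_r (4 * (Rabs (Re z) + 1))) in Hj; [|lra].
    rewrite Rinv_l in Hj by lra. nra. }
  assert (HkS : dy (S j) * INR (S k) <= 1 / 2).
  { apply Rle_trans with (dy (S j) * INR (2 ^ j)).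
    - apply Rmult_le_compat_l; [lra|]. apply le_INR. lia.
    - rewrite ES. generalize (dy_pow j). lra. }
  assert (PS := pos_INR (S k)).
  assert (HI : Rabs (dy (S j) * Im z) <= Rabs (Im z)).
  { rewrite Rabs_mult, (Rabs_pos_eq (dy (S j))) by lra. generalize (Rabs_pos (Im z)). nra. }
  set (E := exp (- (2 * PI * Rabs (Im z)))) in *.
  assert (PE : 0 < E) by apply exp_pos.
  destruct (Hs (S k)) as [H1 H2].
  assert (R1 : forall s : R, Rabs s = INR (S k) -> c * (1 + INR (S k)) <= Cmod (z + RtoC s)%C ->
    dy (S j) * (E / 2 * (c * (INR k + 2))) <= Cmod (1 - Ce (RtoC (dy (S j)) * (z + RtoC s)))%C).
  { intros s Hsk Hsm. eapply Rle_trans; [|apply (one_minus_Ce_lower _ (Rabs (Im z)))].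
    - rewrite Cmod_mult, Cmod_R, (Rabs_pos_eq (dy (S j))) by lra. fold E.
      rewrite S_INR in *. replace (INR k + 2) with (1 + (INR k + 1)) by ring.
      replace (E / 2 * (dy (S j) * Cmod (z + RtoC s))) with (dy (S j) * (E / 2 * Cmod (z + RtoC s))) by ring.
      apply Rmult_le_compat_l; [lra|]. apply Rmult_le_compat_l; lra.
    - rewrite re_scal_l, re_plus, re_RtoC. rewrite Rmult_plus_distr_l.
      eapply Rle_trans; [apply Rabs_triang|]. rewrite !Rabs_mult, (Rabs_pos_eq (dy (S j))), Hsk by lra. lra.
    - rewrite im_scal_l, im_plus, im_RtoC, Rplus_0_r. exact HI. }
  split.
  - apply R1; [apply Rabs_pos_eq; exact PS|exact H1].
  - replace (z - INR (S k))%C with (z + RtoC (- INR (S k)))%C by (rewrite RtoC_opp; reflexivity).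
    apply R1; [rewrite Rabs_Ropp; apply Rabs_pos_eq; exact PS|].
    rewrite RtoC_opp. exact H2.
Qed.

Lemma Cpow_half_dy j : Cpow (RtoC (/ 2)) j = RtoC (dy j).
Proof. unfold dy. now rewrite RtoC_pow. Qed.

Lemma Cpow_quarter_dy j : Cpow (RtoC (/ 4)) j = (RtoC (dy j) * RtoC (dy j))%C.
Proof.
  rewrite <- Cpow_half_dy, <- Cpow_mult_l, <- RtoC_mult.
  replace (/ 2 * / 2) with (/ 4) by field. reflexivity.
Qed.

Lemma RtoC_dy_nz j : RtoC (dy j) <> 0.
Proof. apply RtoC_nz. generalize (dy_pos j). lra. Qed.

Lemma Copp_nz (z : C) : z <> 0 -> (- z)%C <> 0.
Proof. intros H K. apply H. replace z with (- - z)%C by ring. rewrite K. ring. Qed.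

Lemma Clim_kap_dy w : w <> RtoC 0 ->
  Clim eventually (fun j => RtoC (dy (S j)) * kap (RtoC (dy (S j)) * w))%C (- (2 / (tpi * w)))%C.
Proof.
  intros Hw. assert (N : (- (tpi * w))%C <> 0).
  { apply Copp_nz, Cmult_neq_0; [apply tpi_nz|exact Hw]. }
  assert (Hw2 : (tpi * w)%C <> 0) by (apply Cmult_neq_0; [apply tpi_nz|exact Hw]).
  apply Clim_ext_loc with (fun j => (1 + Ce (RtoC (dy (S j)) * w)) / ((1 - Ce (RtoC (dy (S j)) * w)) / RtoC (dy (S j))))%C;
    [apply eventually_filter| |].
  - generalize (Clim_lower eventually _ _ N (Clim_one_minus_Ce w)). apply filter_imp.
    intros j Hj. unfold kap. set (q := Ce (RtoC (dy (S j)) * w)) in *.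
    assert (D := RtoC_dy_nz (S j)). assert (PN := Cmod_pos _ N).
    assert (A : (1 - q)%C <> 0).
    { intros K. rewrite K in Hj. replace (0 / RtoC (dy (S j)))%C with (RtoC 0) in Hj by (field; exact D).
      rewrite Cmod_0 in Hj. lra. }
    field. split; assumption.
  - apply Clim_eq with ((1 + 1) / (- (tpi * w)))%C.
    { field. split; [exact Hw|split; [apply Ci_nz|]]. apply RtoC_nz. generalize PI_RGT_0. lra. }
    apply Clim_div; [apply eventually_filter|exact N| |apply Clim_one_minus_Ce].
    apply Clim_plus; [apply eventually_filter|apply Clim_const, eventually_filter|apply Clim_Ce_dy].
Qed.

Lemma Clim_psi_dy w : w <> RtoC 0 ->
  Clim eventually (fun j => RtoC (dy (S j)) * RtoC (dy (S j)) * psi (RtoC (dy (S j)) * w))%C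
    (/ ((tpi * w) * (tpi * w)))%C.
Proof.
  intros Hw. assert (N : (- (tpi * w))%C <> 0).
  { apply Copp_nz, Cmult_neq_0; [apply tpi_nz|exact Hw]. }
  assert (Hw2 : (tpi * w)%C <> 0) by (apply Cmult_neq_0; [apply tpi_nz|exact Hw]).
  apply Clim_ext_loc with (fun j => Ce (RtoC (dy (S j)) * w) /
    (((1 - Ce (RtoC (dy (S j)) * w)) / RtoC (dy (S j))) * ((1 - Ce (RtoC (dy (S j)) * w)) / RtoC (dy (S j)))))%C;
    [apply eventually_filter| |].
  - generalize (Clim_lower eventually _ _ N (Clim_one_minus_Ce w)). apply filter_imp.
    intros j Hj. unfold psi. set (q := Ce (RtoC (dy (S j)) * w)) in *.
    assert (D := RtoC_dy_nz (S j)). assert (PN := Cmod_pos _ N).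
    assert (A : (1 - q)%C <> 0).
    { intros K. rewrite K in Hj. replace (0 / RtoC (dy (S j)))%C with (RtoC 0) in Hj by (field; exact D).
      rewrite Cmod_0 in Hj. lra. }
    field. split; assumption.
  - apply Clim_eq with (1 / ((- (tpi * w)) * (- (tpi * w))))%C.
    { field. split; [exact Hw|split; [apply Ci_nz|]]. apply RtoC_nz. generalize PI_RGT_0. lra. }
    apply Clim_div; [apply eventually_filter|now apply Cmult_neq_0|apply Clim_Ce_dy|].
    apply Clim_mult; [apply eventually_filter| |]; apply Clim_one_minus_Ce.
Qed.

Lemma Cpair_mult_add (s a b : C) : (s * (a + b))%C = (s * a + s * b)%C.
Proof. ring. Qed.

Lemma m1_nz : (1 - RtoC (-1))%C <> 0.
Proof. rewrite <- RtoC_minus. apply RtoC_nz. lra. Qed.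

Lemma Clim_dy_S : Clim eventually (fun j => RtoC (dy (S j))) 0.
Proof. apply (Clim_seq_shift (fun j => RtoC (dy j)) _ 1), dy_lim. Qed.

(** A single term decays only like 1/k. With a = e(h(z + k)) and b = e(h(z - k)), the pair is (1 +
    a)/(1 - a) + (1 + b)/(1 - b) = 2 (1 - a b) / ((1 - a)(1 - b)), and a b = e(2 h z) does not
    depend on k; hence 1 - a b = O(h), and the pair, weighted by h, is O(1/k^2). *)
Theorem kap_partial_fractions z c : Ce z <> 1 -> sep z c ->
  kap z = (- (2 / (tpi * z)) + Csum (fun k =>
     - (2 / (tpi * (z + INR (S k)))) - 2 / (tpi * (z - INR (S k)))))%C.
Proof.
  intros Hz Hs. set (E := exp (- (2 * PI * Rabs (Im z))) / 2).
  assert (PE : 0 < E) by (unfold E; generalize (exp_pos (- (2 * PI * Rabs (Im z)))); lra).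
  (* Eventually bounds |1 - e(2 h z)| / h, whose limit is |2 pi i * 2 z|. *)
  set (B := Cmod (- (tpi * (2 * z)))%C + 1).
  assert (PB : 0 < B) by (unfold B; generalize (Cmod_ge_0 (- (tpi * (2 * z)))%C); lra).
  assert (Hc : 0 < c) by apply Hs.
  apply (partial_fractions kap (RtoC (/ 2)) kap_period kap_double z _ _
    (fun k => 2 * B / (E * c * (E * c)) * / ((INR k + 2) * (INR k + 2)))).
  - exact Hz.
  - eapply Clim_ext; [apply eventually_filter| |apply (Clim_kap_dy z (sep_nz _ _ Hs))].
    intros j. now rewrite Cpow_half_dy.
  - apply Clim_ext with (fun j => RtoC (dy (S j)) * kap (RtoC (dy (S j)) * z + RtoC (/ 2)))%C;
      [apply eventually_filter|intros j; now rewrite Cpow_half_dy|].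
    apply Clim_eq with (0 * ((1 + RtoC (-1)) / (1 - RtoC (-1))))%C; [ring|].
    apply Clim_mult; [apply eventually_filter|apply Clim_dy_S|]. unfold kap.
    apply Clim_div; [apply eventually_filter|apply m1_nz| |].
    + apply Clim_plus; [apply eventually_filter|apply Clim_const, eventually_filter|apply Clim_Ce_dy_half].
    + apply Clim_minus; [apply eventually_filter|apply Clim_const, eventually_filter|apply Clim_Ce_dy_half].
  - intros k. apply Clim_ext with (fun j => RtoC (dy (S j)) * kap (RtoC (dy (S j)) * (z + INR (S k)))
      + RtoC (dy (S j)) * kap (RtoC (dy (S j)) * (z - INR (S k))))%C;
      [apply eventually_filter|intros j; rewrite Cpow_half_dy; ring|].
    apply Clim_plus; [apply eventually_filter| |].
    + apply Clim_kap_dy. now apply sep_plus_nz with c.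
    + apply Clim_kap_dy. now apply sep_minus_nz with c.
  - apply ex_series_Rscal, ex_series_inv_sqr2.
  - generalize (filter_and _ _ (one_minus_Ce_dy_lower z c Hs)
      (Clim_bounded eventually _ _ (Clim_one_minus_Ce (2 * z)))).
    apply filter_imp. intros j [H1 H2] k Hk. rewrite Cpow_half_dy. fold B in H2.
    destruct (H1 k Hk) as [L1 L2]. fold E in L1, L2. clear H1.
    set (h := dy (S j)) in *. assert (Ph : 0 < h) by apply dy_pos.
    assert (Pk := pos_INR k). clearbody h E.
    set (qa := Ce (RtoC h * (z + INR (S k)))) in *.
    set (qb := Ce (RtoC h * (z - INR (S k)))) in *.
    assert (Eq : (Ce (RtoC h * (2 * z)) = qa * qb)%C).
    { unfold qa, qb. rewrite <- Ce_add. f_equal. ring. }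
    rewrite Eq in H2.
    set (r := h * (E * (c * (INR k + 2)))) in *.
    assert (Pr : 0 < r) by (unfold r; repeat (apply Rmult_lt_0_compat; [lra|]); lra).
    assert (Na : (1 - qa)%C <> 0) by (apply Cmod_nz; lra).
    assert (Nb : (1 - qb)%C <> 0) by (apply Cmod_nz; lra).
    assert (Nh : RtoC h <> 0) by (apply RtoC_nz; lra).
    unfold kap. fold qa qb.
    replace (RtoC h * ((1 + qa) / (1 - qa) + (1 + qb) / (1 - qb)))%C
      with (2 * (RtoC h * RtoC h) * ((1 - qa * qb) / RtoC h) * (/ (1 - qa) * / (1 - qb)))%C
      by (field; repeat split; assumption).
    rewrite !Cmod_mult, (Cmod_inv (1 - qa)), (Cmod_inv (1 - qb)), !Cmod_R by assumption.
    rewrite (Rabs_pos_eq h), (Rabs_pos_eq 2) by lra.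
    replace (2 * B / (E * c * (E * c)) * / ((INR k + 2) * (INR k + 2)))
      with (2 * (h * h) * B * (/ r * / r)) by (unfold r; field; repeat split; lra).
    assert (I1 : / Cmod (1 - qa) <= / r) by (apply Rinv_le_contravar; assumption).
    assert (I2 : / Cmod (1 - qb) <= / r) by (apply Rinv_le_contravar; assumption).
    assert (J1 : 0 < / Cmod (1 - qa)) by (apply Rinv_0_lt_compat; lra).
    assert (J2 : 0 < / Cmod (1 - qb)) by (apply Rinv_0_lt_compat; lra).
    apply Rmult_le_compat.
    + repeat apply Rmult_le_pos; try lra; apply Cmod_ge_0.
    + apply Rmult_le_pos; lra.
    + apply Rmult_le_compat_l; [nra|]. exact H2.
    + apply Rmult_le_compat; lra.
Qed.

(** Here each term is O(1/k^2) by itself, so the two members of a pair are bounded separately; [B]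
    bounds the numerator |e(h(z + s))| for real s and 0 < h <= 1. *)
Theorem psi_partial_fractions z c : Ce z <> 1 -> sep z c ->
  psi z = (/ (tpi * z * (tpi * z)) + Csum (fun k =>
     / (tpi * (z + INR (S k)) * (tpi * (z + INR (S k)))) +
     / (tpi * (z - INR (S k)) * (tpi * (z - INR (S k))))))%C.
Proof.
  intros Hz Hs. set (E := exp (- (2 * PI * Rabs (Im z))) / 2).
  assert (PE : 0 < E) by (unfold E; generalize (exp_pos (- (2 * PI * Rabs (Im z)))); lra).
  set (B := exp (2 * PI * Rabs (Im z))). assert (PB : 0 < B) by apply exp_pos.
  assert (Hc : 0 < c) by apply Hs.
  apply (partial_fractions psi (RtoC (/ 4)) psi_period psi_double z _ _
    (fun k => 2 * B / (E * c * (E * c)) * / ((INR k + 2) * (INR k + 2)))).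
  - exact Hz.
  - eapply Clim_ext; [apply eventually_filter| |apply (Clim_psi_dy z (sep_nz _ _ Hs))].
    intros j. now rewrite Cpow_quarter_dy.
  - apply Clim_ext with (fun j => RtoC (dy (S j)) * RtoC (dy (S j)) * psi (RtoC (dy (S j)) * z + RtoC (/ 2)))%C;
      [apply eventually_filter|intros j; now rewrite Cpow_quarter_dy|].
    apply Clim_eq with (0 * 0 * (RtoC (-1) / ((1 - RtoC (-1)) * (1 - RtoC (-1)))))%C; [ring|].
    apply Clim_mult; [apply eventually_filter|apply Clim_mult; [apply eventually_filter|apply Clim_dy_S|apply Clim_dy_S]|].
    unfold psi.
    apply Clim_div; [apply eventually_filter|apply Cmult_neq_0; apply m1_nz|apply Clim_Ce_dy_half|].
    apply Clim_mult; [apply eventually_filter| |];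
    (apply Clim_minus; [apply eventually_filter|apply Clim_const, eventually_filter|apply Clim_Ce_dy_half]).
  - intros k. apply Clim_ext with (fun j => RtoC (dy (S j)) * RtoC (dy (S j)) * psi (RtoC (dy (S j)) * (z + INR (S k)))
      + RtoC (dy (S j)) * RtoC (dy (S j)) * psi (RtoC (dy (S j)) * (z - INR (S k))))%C;
      [apply eventually_filter|intros j; rewrite Cpow_quarter_dy; ring|].
    apply Clim_plus; [apply eventually_filter| |].
    + apply Clim_psi_dy. now apply sep_plus_nz with c.
    + apply Clim_psi_dy. now apply sep_minus_nz with c.
  - apply ex_series_Rscal, ex_series_inv_sqr2.
  - generalize (one_minus_Ce_dy_lower z c Hs).
    apply filter_imp. intros j H1 k Hk. rewrite Cpow_quarter_dy.
    destruct (H1 k Hk) as [L1 L2]. fold E in L1, L2. clear H1.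
    set (h := dy (S j)) in *. assert (Ph : 0 < h) by apply dy_pos.
    assert (Ph1 : h <= 1).
    { unfold h, dy. rewrite <- (pow1 (S j)). apply pow_incr. lra. }
    assert (Pk := pos_INR k). clearbody h E.
    set (r := h * (E * (c * (INR k + 2)))) in *.
    assert (Pr : 0 < r) by (unfold r; repeat (apply Rmult_lt_0_compat; [lra|]); lra).
    assert (G : forall s : R, r <= Cmod (1 - Ce (RtoC h * (z + RtoC s)))%C ->
      Cmod (RtoC h * RtoC h * psi (RtoC h * (z + RtoC s)))%C <= h * h * B * (/ r * / r)).
    { intros s Hr. assert (Na : (1 - Ce (RtoC h * (z + RtoC s)))%C <> 0) by (apply Cmod_nz; lra).
      assert (I1 : / Cmod (1 - Ce (RtoC h * (z + RtoC s)))%C <= / r) by (apply Rinv_le_contravar; assumption).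
      assert (J1 : 0 < / Cmod (1 - Ce (RtoC h * (z + RtoC s)))%C) by (apply Rinv_0_lt_compat; lra).
      unfold psi, Cdiv. rewrite !Cmod_mult, Cmod_inv, Cmod_mult, Rinv_mult, !Cmod_R by now apply Cmult_neq_0.
      rewrite (Rabs_pos_eq h) by lra. rewrite <- Rmult_assoc.
      apply Rmult_le_compat.
      - repeat apply Rmult_le_pos; try lra. apply Cmod_ge_0.
      - apply Rmult_le_pos; lra.
      - apply Rmult_le_compat_l; [nra|]. rewrite Cmod_Ce, im_scal_l, im_plus, im_RtoC, Rplus_0_r.
        unfold B. assert (Q : - (2 * PI * (h * Im z)) <= 2 * PI * Rabs (Im z)).
        { assert (- (h * Im z) <= Rabs (Im z)).
          { eapply Rle_trans; [apply Rle_abs|]. rewrite Rabs_Ropp, Rabs_mult, (Rabs_pos_eq h) by lra.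
            generalize (Rabs_pos (Im z)). nra. }
          generalize PI_RGT_0. nra. }
        destruct Q as [Q|Q]; [left; now apply exp_increasing|rewrite Q; lra].
      - apply Rmult_le_compat; lra. }
    replace (2 * B / (E * c * (E * c)) * / ((INR k + 2) * (INR k + 2)))
      with (h * h * B * (/ r * / r) + h * h * B * (/ r * / r)) by (unfold r; field; repeat split; lra).
    rewrite Cpair_mult_add. eapply Rle_trans; [apply Cmod_triangle|]. apply Rplus_le_compat.
    + now apply G.
    + replace (z - INR (S k))%C with (z + RtoC (- INR (S k)))%C in * by (rewrite RtoC_opp; reflexivity).
      now apply G.
Qed.

(** * The value of zeta(2) *)

Lemma Clim_seq_double (f : nat -> C) l : Clim eventually f l -> Clim eventually (fun n => f (2 * n)%nat) l.
Proof. intros H e He. destruct (H e He) as [N HN]. exists N. intros n Hn. apply HN. lia. Qed.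

Lemma csumn_S u n : csumn u (S n) = (csumn u n + u n)%C.
Proof. reflexivity. Qed.

Lemma csumn_pairs u n : csumn u (2 * n) = csumn (fun m => u (2 * m)%nat + u (2 * m + 1)%nat)%C n.
Proof.
  induction n as [|n IH]; [reflexivity|].
  replace (2 * S n)%nat with (S (S (2 * n))) by lia. rewrite !csumn_S, IH.
  replace (2 * n + 1)%nat with (S (2 * n)) by lia. ring.
Qed.

Lemma Csum_pairs u : summable u -> summable (fun m => u (2 * m)%nat) -> summable (fun m => u (2 * m + 1)%nat) ->
  Csum u = (Csum (fun m => u (2 * m)%nat) + Csum (fun m => u (2 * m + 1)%nat))%C.
Proof.
  intros H H0 H1. rewrite <- Csum_plus by assumption. symmetry. apply Csum_unique; [now apply summable_plus|].
  apply Clim_ext with (fun n => csumn u (2 * n)); [apply eventually_filter|intros; apply csumn_pairs|].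
  apply Clim_seq_double. now apply Csum_lim.
Qed.

Definition invsq (k : nat) : C := RtoC (/ ((INR k + 1) * (INR k + 1))).

Lemma invsq_summable : summable invsq.
Proof.
  apply summable_le with (2 := ex_series_inv_sqr). intros k. unfold invsq. rewrite Cmod_R, Rabs_pos_eq; [lra|].
  generalize (pos_INR k); intros. left; apply Rinv_0_lt_compat. nra.
Qed.

Lemma sep_half : sep (RtoC (/ 2)) (1 / 4).
Proof.
  split; [lra|]. intros k. rewrite <- RtoC_plus, <- RtoC_minus, !Cmod_R. assert (P := pos_INR k).
  split; [rewrite Rabs_pos_eq; lra|].
  destruct k as [|k]; [simpl; rewrite Rabs_pos_eq; lra|].
  rewrite S_INR in *. assert (P' := pos_INR k). rewrite Rabs_left1; lra.
Qed.

Lemma tpi_sqr : (tpi * tpi)%C = RtoC (- (4 * (PI * PI))).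
Proof. apply Ceq_ReIm; simpl; ring. Qed.

(** The partial fractions of 1 / sin^2 at z = 1/2, where psi = -1/4, give the sum [o] of 1 / (k +
    1/2)^2. Splitting zeta(2) by parity gives zeta(2) = [o] / 4 + zeta(2) / 4. *)
Theorem Csum_invsq : Csum invsq = RtoC (PI * PI / 6).
Proof.
  assert (PP := PI_RGT_0).
  set (o := fun k => RtoC (/ ((INR k + / 2) * (INR k + / 2)))).
  assert (So : summable o).
  { apply summable_le with (fun k => 4 * / ((INR k + 1) * (INR k + 1))).
    - intros k. generalize (pos_INR k); intros. unfold o. rewrite Cmod_R, Rabs_pos_eq.
      + replace (4 * / ((INR k + 1) * (INR k + 1))) with (/ ((INR k + 1) * (INR k + 1) / 4)) by (field; lra).
        apply Rinv_le_contravar; nra.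
      + left; apply Rinv_0_lt_compat. nra.
    - apply ex_series_Rscal, ex_series_inv_sqr. }
  assert (E1 : Csum invsq = (RtoC (/ 4) * Csum o + RtoC (/ 4) * Csum invsq)%C).
  { assert (Ee : forall m, invsq (2 * m) = (RtoC (/ 4) * o m)%C).
    { intros m. unfold invsq, o. rewrite <- RtoC_mult. f_equal. rewrite mult_INR. simpl (INR 2).
      generalize (pos_INR m); intros. field. lra. }
    assert (Eo : forall m, invsq (2 * m + 1) = (RtoC (/ 4) * invsq m)%C).
    { intros m. unfold invsq. rewrite <- RtoC_mult. f_equal. rewrite plus_INR, mult_INR. simpl (INR 2). simpl (INR 1).
      generalize (pos_INR m); intros. field. lra. }
    rewrite <- (Csum_scal _ o), <- (Csum_scal _ invsq) by (assumption || apply invsq_summable).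
    rewrite <- (Csum_ext _ _ Ee), <- (Csum_ext _ _ Eo).
    apply Csum_pairs; [apply invsq_summable| |].
    - eapply summable_ext; [intros; symmetry; apply Ee|now apply summable_scal].
    - eapply summable_ext; [intros; symmetry; apply Eo|apply summable_scal, invsq_summable]. }
  assert (Hne : Ce (/ 2)%R <> 1) by (rewrite Ce_half; intros H; apply RtoC_inj in H; lra).
  assert (E2 := psi_partial_fractions _ _ Hne sep_half).
  set (c := RtoC (- / (4 * (PI * PI)))).
  assert (Ec : forall x : R, x <> 0 -> (/ (tpi * RtoC x * (tpi * RtoC x)))%C = (c * RtoC (/ (x * x)))%C).
  { intros x Hx. replace (tpi * RtoC x * (tpi * RtoC x))%C with (tpi * tpi * RtoC (x * x))%C by (rewrite (RtoC_mult x x); ring).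
    rewrite tpi_sqr. unfold c. rewrite <- !RtoC_mult, <- RtoC_inv.
    - f_equal. field. repeat split; lra.
    - apply Rmult_integral_contrapositive. split; [|now apply Rmult_integral_contrapositive]. nra. }
  rewrite (Csum_ext _ (fun k => c * (o (S k) + o k))%C) in E2.
  2:{ intros k. rewrite <- RtoC_plus, <- RtoC_minus, !Ec, Cmult_plus_distr_l by (rewrite S_INR; generalize (pos_INR k); lra).
      unfold o. rewrite !S_INR.
      replace ((/ 2 - (INR k + 1)) * (/ 2 - (INR k + 1))) with ((INR k + / 2) * (INR k + / 2)) by field.
      replace (/ 2 + (INR k + 1)) with (INR k + 1 + / 2) by ring. reflexivity. }
  rewrite Csum_scal in E2 by (apply summable_plus; [apply (summable_shift o 1 So)|exact So]).
  rewrite Csum_plus in E2 by (exact So || apply (summable_shift o 1 So)).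
  (* The central term 1/z^2 = 4 is [o 0]; together with the pairs [o (S k) + o k] it makes the full
     sum exactly twice [Csum o]. *)
  assert (E3 : Csum o = (RtoC 4 + Csum (fun k => o (S k)))%C).
  { rewrite (Csum_Sl o So). f_equal. unfold o. f_equal. simpl. field. }
  rewrite Ec in E2 by lra. unfold psi in E2. rewrite Ce_half in E2.
  replace (RtoC (-1) / ((1 - RtoC (-1)) * (1 - RtoC (-1))))%C with (RtoC (- / 4)) in E2.
  2:{ rewrite <- RtoC_minus, <- RtoC_mult, <- RtoC_div by lra. f_equal. field. }
  replace (/ (/ 2 * / 2)) with 4 in E2 by field.
  assert (E4 : (RtoC (- / 4) = c * (Csum o + Csum o))%C).
  { rewrite E2, E3 at 1. rewrite E3. ring. }
  assert (E5 : (Csum o + Csum o)%C = RtoC (PI * PI)).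
  { replace (Csum o + Csum o)%C with (RtoC (- (4 * (PI * PI))) * (c * (Csum o + Csum o)))%C.
    - rewrite <- E4, <- RtoC_mult. f_equal. field.
    - unfold c. rewrite Cmult_assoc, <- RtoC_mult. replace (- (4 * (PI * PI)) * - / (4 * (PI * PI))) with 1 by (field; lra). ring. }
  assert (E6 : (RtoC 6 * Csum invsq)%C = RtoC (PI * PI)).
  { rewrite <- E5. rewrite E1. assert (X : (RtoC 3 * Csum invsq = Csum o)%C).
    { replace (RtoC 3 * Csum invsq)%C with (RtoC 4 * Csum invsq - Csum invsq)%C by ring.
      rewrite E1 at 1. replace (RtoC (/ 4)) with (/ RtoC 4)%C by (rewrite RtoC_inv by lra; reflexivity). field. }
    rewrite <- X. replace (RtoC (/ 4)) with (/ RtoC 4)%C by (rewrite RtoC_inv by lra; reflexivity). field. }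
  replace (PI * PI / 6) with (/ 6 * (PI * PI)) by field. rewrite RtoC_mult, <- E6, Cmult_assoc, <- RtoC_mult.
  replace (/ 6 * 6) with 1 by field. ring.
Qed.

(** * The order of summation in the Eisenstein series of weight two *)

(** Imaginary parts bound |n| by the modulus X of n tau + m; then |m| <= X + |n| |tau|. The constant
    results from adding the two estimates. *)
Lemma lattice_lower (tau : C) (n m : R) : 0 < Im tau ->
  Im tau / (1 + Im tau + Cmod tau) * (Rabs n + Rabs m) <= Cmod (RtoC n * tau + RtoC m)%C.
Proof.
  intros Hy. set (y := Im tau) in *. assert (P := Cmod_ge_0 tau).
  assert (H1 : Rabs n * y <= Cmod (RtoC n * tau + RtoC m)%C).
  { eapply Rle_trans; [|apply im_le_Cmod]. rewrite im_plus, im_scal_l, im_RtoC, Rplus_0_r, Rabs_mult.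
    fold y. rewrite (Rabs_pos_eq y) by lra. lra. }
  assert (H2 : Rabs m <= Cmod (RtoC n * tau + RtoC m)%C + Rabs n * Cmod tau).
  { rewrite <- (Cmod_R m), <- (Cmod_R n), <- Cmod_mult.
    replace (RtoC m) with ((RtoC n * tau + RtoC m) - RtoC n * tau)%C at 1 by ring. apply Cmod_sub_le. }
  apply Rmult_le_reg_l with (1 + y + Cmod tau); [lra|].
  replace ((1 + y + Cmod tau) * (y / (1 + y + Cmod tau) * (Rabs n + Rabs m))) with (y * (Rabs n + Rabs m)) by (field; lra).
  set (X := Cmod (RtoC n * tau + RtoC m)%C) in *.
  assert (y * Rabs m <= y * (X + Rabs n * Cmod tau)) by (apply Rmult_le_compat_l; lra).
  assert (Rabs n * y * Cmod tau <= X * Cmod tau) by (apply Rmult_le_compat_r; lra). lra.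
Qed.

Lemma lattice_const_pos tau : 0 < Im tau -> 0 < Im tau / (1 + Im tau + Cmod tau).
Proof. intros H. apply Rdiv_lt_0_compat; generalize (Cmod_ge_0 tau); lra. Qed.

Lemma sep_H z : in_H z -> sep z (Im z / (1 + Im z + Cmod z)).
Proof.
  intros H. split; [now apply lattice_const_pos|]. intros k.
  assert (P := pos_INR k). split.
  - generalize (lattice_lower z 1 (INR k) H). rewrite Rabs_R1, Rabs_pos_eq, Cmult_1_l by lra. trivial.
  - generalize (lattice_lower z 1 (- INR k) H). rewrite Rabs_R1, Rabs_Ropp, Rabs_pos_eq, Cmult_1_l, RtoC_opp by lra. trivial.
Qed.

Lemma Cmod_Ce_lt_1 z : in_H z -> Cmod (Ce z) < 1.
Proof.
  intros H. rewrite Cmod_Ce, <- exp_0. apply exp_increasing. unfold in_H in H.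
  generalize PI_RGT_0. nra.
Qed.

Lemma Ce_neq1_H z : in_H z -> Ce z <> 1.
Proof. intros H E. apply Cmod_Ce_lt_1 in H. rewrite E, Cmod_1 in H. lra. Qed.

Lemma in_H_scal n tau : in_H tau -> in_H (INR (S n) * tau)%C.
Proof.
  unfold in_H. intros H. rewrite im_scal_l. apply Rmult_lt_0_compat; [apply lt_0_INR; lia|exact H].
Qed.

Lemma in_H_nz tau : in_H tau -> tau <> 0.
Proof. intros H ->. unfold in_H in H. simpl in H. lra. Qed.

Lemma in_H_inv tau : in_H tau -> in_H (- / tau)%C.
Proof.
  intros H. assert (N := in_H_nz _ H). unfold in_H in *. destruct tau as [x y]. simpl in *.
  replace (- (- y / (x * (x * 1) + y * (y * 1)))) with (y / (x * x + y * y)) by (field; nra).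
  apply Rdiv_lt_0_compat; nra.
Qed.

Lemma Ce_scal_pow n tau : Ce (INR (S n) * tau)%C = Cpow (Ce tau) (S n).
Proof. apply Ce_pow. Qed.

Lemma ex_series_geom_S r : 0 <= r < 1 -> ex_series (fun n => r ^ S n).
Proof.
  intros H. apply (ex_series_incr_1 (fun n => r ^ n)). exists (/ (1 - r)). apply is_series_geom.
  rewrite Rabs_pos_eq; lra.
Qed.

Lemma one_minus_pow_lower q r n : Cmod q <= r -> r < 1 -> 1 - r <= Cmod (1 - Cpow q (S n))%C.
Proof.
  intros H Hr. generalize (Cmod_sub_ge 1 (Cpow q (S n))). rewrite Cmod_1, Cmod_pow.
  assert (Cmod q ^ S n <= r); [|lra].
  eapply Rle_trans; [apply pow_incr; split; [apply Cmod_ge_0|exact H]|].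
  simpl. assert (0 <= r) by (generalize (Cmod_ge_0 q); lra).
  assert (r ^ n <= 1) by (rewrite <- (pow1 n); apply pow_incr; lra). nra.
Qed.

Lemma psi_bound n tau r : Cmod (Ce tau) <= r -> r < 1 ->
  Cmod (psi (INR (S n) * tau)) <= / ((1 - r) * (1 - r)) * r ^ S n.
Proof.
  intros H Hr. unfold psi. rewrite Ce_scal_pow.
  assert (L := one_minus_pow_lower _ _ n H Hr). set (A := (1 - Cpow (Ce tau) (S n))%C) in *.
  assert (NA : A <> 0) by (apply Cmod_nz; lra).
  unfold Cdiv. rewrite Cmod_mult, Cmod_inv, Cmod_mult, Cmod_pow by now apply Cmult_neq_0.
  rewrite Rmult_comm. apply Rmult_le_compat.
  - left. apply Rinv_0_lt_compat. apply Rmult_lt_0_compat; lra.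
  - apply pow_le, Cmod_ge_0.
  - apply Rinv_le_contravar; [apply Rmult_lt_0_compat; lra|]. apply Rmult_le_compat; lra.
  - apply pow_incr. split; [apply Cmod_ge_0|exact H].
Qed.

(** This is sum_n sigma_1(n) q^n, so the Eisenstein series E_2 equals [1 - 24 * psi_sum]. *)
Definition psi_sum (tau : C) : C := Csum (fun n => psi (INR (S n) * tau)).

Lemma psi_summable tau : in_H tau -> summable (fun n => psi (INR (S n) * tau)).
Proof.
  intros H. apply Cmod_Ce_lt_1 in H.
  apply summable_le with (fun n => / ((1 - Cmod (Ce tau)) * (1 - Cmod (Ce tau))) * Cmod (Ce tau) ^ S n).
  - intros n. apply psi_bound; lra.
  - apply ex_series_Rscal, ex_series_geom_S. split; [apply Cmod_ge_0|exact H].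
Qed.

(* v is telescoping in both variables, and u - v = O((n + m)^(-3)) is absolutely summable: only
   the boundary terms w of v see the order of summation. *)
Section OrderSwap.
Variable tau : C.
Hypothesis Htau : in_H tau.

Let pos (n : nat) : C := INR n.
Let u (n m : nat) : C :=
  (/ ((pos (S n) * tau + pos (S m)) * (pos (S n) * tau + pos (S m))) +
   / ((pos (S n) * tau - pos (S m)) * (pos (S n) * tau - pos (S m))))%C.
Let w (n m : nat) : C := (/ (pos (S n) * tau - pos m) - / (pos (S n) * tau + pos m))%C.
Let v (n m : nat) : C := (w n (S m) - w n m)%C.
Let c := Im tau / (1 + Im tau + Cmod tau).

Local Lemma c_pos : 0 < c.
Proof. now apply lattice_const_pos. Qed.

Local Lemma lower_plus n m : c * (INR n + INR m) <= Cmod (pos n * tau + pos m)%C.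
Proof.
  generalize (lattice_lower tau (INR n) (INR m) Htau). rewrite !Rabs_pos_eq by apply pos_INR. trivial.
Qed.

Local Lemma lower_minus n m : c * (INR n + INR m) <= Cmod (pos n * tau - pos m)%C.
Proof.
  generalize (lattice_lower tau (INR n) (- INR m) Htau).
  rewrite Rabs_Ropp, !Rabs_pos_eq, RtoC_opp by apply pos_INR. trivial.
Qed.

Local Lemma nz_plus n m : (pos (S n) * tau + pos m)%C <> 0.
Proof.
  apply Cmod_nz. generalize (lower_plus (S n) m) c_pos (pos_INR n) (pos_INR m). rewrite S_INR. nra.
Qed.

Local Lemma nz_minus n m : (pos (S n) * tau - pos m)%C <> 0.
Proof.
  apply Cmod_nz. generalize (lower_minus (S n) m) c_pos (pos_INR n) (pos_INR m). rewrite S_INR. nra.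
Qed.

Local Lemma inv_sqr_bound (A : C) s : 0 < s -> s <= Cmod A -> Cmod (/ (A * A))%C <= / (s * s).
Proof.
  intros Hs HA. assert (A <> 0) by (apply Cmod_nz; lra).
  rewrite Cmod_inv, Cmod_mult by now apply Cmult_neq_0.
  apply Rinv_le_contravar; [nra|]. apply Rmult_le_compat; lra.
Qed.

Local Lemma u_bound n m : Cmod (u n m) <= 2 / (c * c) * / ((INR (S n) + INR (S m)) * (INR (S n) + INR (S m))).
Proof.
  assert (Hc := c_pos). assert (P := pos_INR n). assert (Q := pos_INR m).
  assert (S0 : 0 < c * (INR (S n) + INR (S m))) by (rewrite !S_INR; nra).
  unfold u. eapply Rle_trans; [apply Cmod_triangle|].
  replace (2 / (c * c) * / ((INR (S n) + INR (S m)) * (INR (S n) + INR (S m)))) with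
   (/ (c * (INR (S n) + INR (S m)) * (c * (INR (S n) + INR (S m)))) + / (c * (INR (S n) + INR (S m)) * (c * (INR (S n) + INR (S m)))))
   by (field; split; rewrite ?S_INR; lra).
  apply Rplus_le_compat; apply inv_sqr_bound; try exact S0; [apply lower_plus|apply lower_minus].
Qed.

Local Lemma u_summable_m n : summable (u n).
Proof.
  apply summable_le with (fun m => 2 / (c * c) * / ((INR m + 1) * (INR m + 1))).
  - intros m. eapply Rle_trans; [apply u_bound|]. assert (Hc := c_pos).
    assert (P := pos_INR n). assert (Q := pos_INR m). rewrite !S_INR.
    apply Rmult_le_compat_l; [left; apply Rdiv_lt_0_compat; nra|]. apply Rinv_le_contravar; nra.
  - apply ex_series_Rscal, ex_series_inv_sqr.
Qed.

Local Lemma u_summable_n m : summable (fun n => u n m).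
Proof.
  apply summable_le with (fun n => 2 / (c * c) * / ((INR n + 1) * (INR n + 1))).
  - intros n. eapply Rle_trans; [apply u_bound|]. assert (Hc := c_pos).
    assert (P := pos_INR n). assert (Q := pos_INR m). rewrite !S_INR.
    apply Rmult_le_compat_l; [left; apply Rdiv_lt_0_compat; nra|]. apply Rinv_le_contravar; nra.
  - apply ex_series_Rscal, ex_series_inv_sqr.
Qed.

(** With s = n + m + 2 this is a multiple of 1 / ((s - 1) s (s + 1)), a majorant of 1 / s^3 which
    telescopes in [m]; its row sums telescope again in [n]. *)
Let t (n m : nat) : R := 4 / (c * c * c) *
  / ((INR n + INR m + 1) * (INR n + INR m + 2) * (INR n + INR m + 3)).

(** By 1/x^2 - 1/(x (x + 1)) = 1 / (x^2 (x + 1)) for the difference and its mirror image for the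
    sum, one power of decay is gained. With s = n + m + 2 >= 2 the shifted factor still has modulus
    at least c (s - 1) >= c s / 2, and two bounds of 2 / (c s)^3 add up to the 4 in [t]. *)
Local Lemma uv_bound n m : Cmod (u n m - v n m)%C <= t n m.
Proof.
  assert (Hc := c_pos). assert (P := pos_INR n). assert (Q := pos_INR m).
  set (s := INR n + INR m + 2).
  assert (E : (u n m - v n m)%C =
    (/ ((pos (S n) * tau - pos (S m)) * (pos (S n) * tau - pos (S m))) * / (pos (S n) * tau - pos m)
    - / ((pos (S n) * tau + pos (S m)) * (pos (S n) * tau + pos (S m))) * / (pos (S n) * tau + pos m))%C).
  { unfold u, v, w.
    assert (N1 := nz_plus n m). assert (N2 := nz_minus n m).
    assert (N3 := nz_plus n (S m)). assert (N4 := nz_minus n (S m)).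
    replace (pos (S m)) with (pos m + 1)%C in * by (unfold pos; rewrite S_INR, RtoC_plus; reflexivity).
    set (T := (pos (S n) * tau)%C) in *. field. repeat split; assumption. }
  rewrite E.
  assert (Hs : 2 <= s) by (unfold s; lra).
  assert (Es : INR (S n) + INR (S m) = s) by (unfold s; rewrite !S_INR; ring).
  assert (B : forall A A' : C, c * s <= Cmod A -> c * (s - 1) <= Cmod A' ->
    Cmod (/ (A * A) * / A')%C <= / (c * s * (c * s)) * / (c * s / 2)).
  { intros A A' HA HA'. assert (A' <> 0) by (apply Cmod_nz; nra).
    rewrite Cmod_mult, (Cmod_inv A') by assumption. apply Rmult_le_compat.
    - apply Cmod_ge_0.
    - left. apply Rinv_0_lt_compat. nra.
    - apply inv_sqr_bound; nra.
    - apply Rinv_le_contravar; nra. }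
  eapply Rle_trans; [apply Cmod_sub_le|].
  eapply Rle_trans; [apply Rplus_le_compat; apply B|].
  - rewrite <- Es. apply lower_minus.
  - replace (s - 1) with (INR (S n) + INR m) by (unfold s; rewrite S_INR; ring). apply lower_minus.
  - rewrite <- Es. apply lower_plus.
  - replace (s - 1) with (INR (S n) + INR m) by (unfold s; rewrite S_INR; ring). apply lower_plus.
  - unfold t. replace (INR n + INR m + 1) with (s - 1) by (unfold s; ring).
    replace (INR n + INR m + 3) with (s + 1) by (unfold s; ring). fold s.
    replace (/ (c * s * (c * s)) * / (c * s / 2) + / (c * s * (c * s)) * / (c * s / 2))
      with (4 / (c * c * c) * / (s * s * s)) by (field; lra).
    apply Rmult_le_compat_l.
    + left. apply Rdiv_lt_0_compat; [lra|]. repeat (apply Rmult_lt_0_compat; [|lra]). lra.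
    + apply Rinv_le_contravar.
      * repeat (apply Rmult_lt_0_compat; [|lra]). lra.
      * assert (0 < s) by lra. nra.
Qed.

Local Lemma t_series n : is_series (t n) (2 / (c * c * c) * / ((INR n + 1) * (INR n + 2))).
Proof.
  assert (Hc := c_pos). assert (P := pos_INR n).
  assert (H : is_lim_seq (sum_n (t n)) (2 / (c * c * c) * / ((INR n + 1) * (INR n + 2)))); [|exact H].
  apply (is_lim_seq_ext (fun m => 2 / (c * c * c) * / ((INR n + 1) * (INR n + 2)) -
     2 / (c * c * c) * / ((INR n + INR m + 2) * (INR n + INR m + 3)))).
  - intros m. induction m as [|m IH].
    + rewrite sum_O. unfold t. simpl. field. repeat split; lra.
    + rewrite sum_Sn, <- IH. match goal with |- _ = plus ?a ?b => change (plus a b) with (a + b) end.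
      unfold t. rewrite S_INR. generalize (pos_INR m); intros.
      field. repeat split; lra.
  - replace (Finite (2 / (c * c * c) * / ((INR n + 1) * (INR n + 2)))) with
      (Finite (2 / (c * c * c) * / ((INR n + 1) * (INR n + 2)) - 0)) by (f_equal; ring).
    apply is_lim_seq_minus'; [apply is_lim_seq_const|].
    apply is_lim_seq_spec. intros [e He]. simpl.
    set (K := 2 / (c * c * c)). assert (HK : 0 < K) by (apply Rdiv_lt_0_compat; [lra|apply Rmult_lt_0_compat; [nra|lra]]).
    assert (HeK : 0 < e / K) by now apply Rdiv_lt_0_compat.
    destruct (archimed_cor1 _ HeK) as [N [HN1 HN2]]. exists N. intros m Hm.
    apply le_INR in Hm. apply lt_0_INR in HN2. rewrite Rminus_0_r, Rabs_pos_eq.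
    + apply Rlt_le_trans with (K * (e / K)); [|right; field; lra].
      apply Rmult_lt_compat_l; [exact HK|].
      eapply Rle_lt_trans; [|exact HN1]. apply Rinv_le_contravar; nra.
    + left. apply Rmult_lt_0_compat; [exact HK|]. apply Rinv_0_lt_compat. nra.
Qed.

Local Lemma uv_summable_m n : summable (fun m => u n m - v n m)%C.
Proof. apply summable_le with (t n); [apply uv_bound|]. eexists; apply t_series. Qed.

Local Lemma t_le n m : t n m <= 2 / (c * c * c) * / ((INR n + 1) * (INR n + 2)).
Proof.
  rewrite <- (is_series_unique _ _ (t_series n)).
  assert (P : forall k, 0 <= t n k) by (intros k; eapply Rle_trans; [apply Cmod_ge_0|apply uv_bound]).
  eapply Rle_trans; [|apply (sum_n_le_Series (t n) m)]; [|exact P|eexists; apply t_series].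
  destruct m as [|m]; [rewrite sum_O; lra|]. rewrite sum_Sn. unfold plus; simpl.
  assert (0 <= sum_n (t n) m); [|lra]. rewrite sum_n_Reals. apply cond_pos_sum. exact P.
Qed.

Local Lemma uv_summable_n m : summable (fun n => u n m - v n m)%C.
Proof.
  apply summable_le with (fun n => 2 / (c * c * c) * / ((INR n + 1) * (INR n + 2))).
  - intros n. eapply Rle_trans; [apply uv_bound|apply t_le].
  - apply ex_series_Rscal, ex_series_telescoping.
Qed.

Local Lemma v_summable_m n : summable (v n).
Proof.
  apply summable_ext with (fun m => u n m - (u n m - v n m))%C; [intros; ring|].
  apply summable_minus; [apply u_summable_m|apply uv_summable_m].
Qed.

Local Lemma v_summable_n m : summable (fun n => v n m).
Proof.
  apply summable_ext with (fun n => u n m - (u n m - v n m))%C; [intros; ring|].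
  apply summable_minus; [apply u_summable_n|apply uv_summable_n].
Qed.

Local Lemma csumn_v n M : csumn (v n) M = w n M.
Proof.
  induction M as [|M IH].
  - unfold w. replace (pos (S n) * tau - pos 0)%C with (pos (S n) * tau + pos 0)%C
      by (unfold pos; change (INR 0) with 0; ring).
    simpl csumn. ring.
  - rewrite csumn_S, IH. unfold v. ring.
Qed.

Local Lemma Clim_inv_seq (f : nat -> C) (K : R) : 0 < K -> (forall n, K * INR n <= Cmod (f n)) ->
  Clim eventually (fun n => / f n)%C 0.
Proof.
  intros HK H e He. assert (0 < K * e) by nra.
  destruct (archimed_cor1 _ H0) as [N [HN1 HN2]]. exists N. intros n Hn.
  apply le_INR in Hn. apply lt_0_INR in HN2. specialize (H n).
  assert (Pf : 0 < Cmod (f n)) by nra.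
  replace (/ f n - 0)%C with (/ f n)%C by ring. rewrite Cmod_inv by now apply Cmod_nz.
  apply Rmult_lt_reg_l with (Cmod (f n)); [exact Pf|]. rewrite Rinv_r by lra.
  apply Rmult_lt_compat_l with (r := INR N) in HN1; [|exact HN2]. rewrite Rinv_r in HN1 by lra.
  eapply Rlt_le_trans; [exact HN1|].
  apply Rle_trans with (K * INR n * e); [|apply Rmult_le_compat_r; lra].
  replace (INR N * (K * e)) with (K * e * INR N) by ring. replace (K * INR n * e) with (K * e * INR n) by ring.
  apply Rmult_le_compat_l; lra.
Qed.

(** Each row telescopes from [w n 0], which is 0, to the limit of [w n M], also 0. The columns do
    not share this property. *)
Local Lemma Csum_v n : Csum (v n) = 0.
Proof.
  apply Csum_unique; [apply v_summable_m|].
  apply Clim_ext with (w n); [apply eventually_filter|intros; now rewrite csumn_v|].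
  apply Clim_eq with (0 - 0)%C; [ring|]. assert (Hc := c_pos).
  apply Clim_minus; [apply eventually_filter| |]; apply Clim_inv_seq with c; try exact Hc; intros m.
  - eapply Rle_trans; [|apply lower_minus]. generalize (pos_INR (S n)). nra.
  - eapply Rle_trans; [|apply lower_plus]. generalize (pos_INR (S n)). nra.
Qed.

(** Up to the factor -2 tau / (2 pi i), the terms [w n M] are the pairs in the cotangent series at z
    = - M / tau. As M grows, Im z tends to infinity, e(z) tends to 0 and [kap z] to 1: the sum over
    n survives although every single [w n M] tends to 0. *)
Local Lemma Csum_w_lim : Clim eventually (fun M => Csum (fun n => w n M)) (- (tpi / (2 * tau)))%C.
Proof.
  assert (Ht := in_H_nz _ Htau). assert (Hi := in_H_inv _ Htau). assert (T := tpi_nz).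
  set (z := fun M : nat => (INR M * - / tau)%C).
  apply Clim_seq_S.
  apply Clim_ext with (fun M => - (tpi / (2 * tau)) * (kap (z (S M)) + 2 / tpi * / z (S M)))%C; [apply eventually_filter| |].
  - intros M. assert (Hz : in_H (z (S M))) by now apply in_H_scal.
    rewrite (kap_partial_fractions _ _ (Ce_neq1_H _ Hz) (sep_H _ Hz)).
    assert (Sw : summable (fun n => w n (S M))).
    { eapply summable_ext; [intros n; apply csumn_v|]. apply csumn_Csum_swap. intros m; apply v_summable_n. }
    rewrite (Csum_ext (fun k => _) (fun n => - (2 * tau / tpi) * w n (S M))%C).
    + rewrite Csum_scal by exact Sw.
      assert (Nz := in_H_nz _ Hz). set (X := Csum (fun n => w n (S M))). set (zz := z (S M)) in *.
      field. repeat split; try assumption; try (apply RtoC_nz; generalize PI_RGT_0; lra). apply Ci_nz.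
    + intros n. unfold w, z.
      assert (N1 := nz_plus n (S M)). assert (N2 := nz_minus n (S M)). unfold pos in *.
      replace (INR (S M) * - / tau + INR (S n))%C with ((INR (S n) * tau - INR (S M)) / tau)%C by (field; exact Ht).
      replace (INR (S M) * - / tau - INR (S n))%C with (- ((INR (S n) * tau + INR (S M)) / tau))%C by (field; exact Ht).
      set (x := (INR (S n) * tau - INR (S M))%C) in *.
      set (y := (INR (S n) * tau + INR (S M))%C) in *.
      field. repeat split; try assumption; try (apply RtoC_nz; generalize PI_RGT_0; lra). apply Ci_nz.
  - apply Clim_eq with (- (tpi / (2 * tau)) * (1 + 2 / tpi * 0))%C; [ring|].
    apply Clim_mult; [apply eventually_filter|apply Clim_const, eventually_filter|].
    apply Clim_plus; [apply eventually_filter| |apply Clim_mult; [apply eventually_filter|apply Clim_const, eventually_filter|]].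
    + assert (L : Clim eventually (fun M => Ce (z (S M))) 0).
      { apply (Clim_seq_shift (fun M => Ce (z M)) _ 1).
        apply Clim_ext with (fun M => Cpow (Ce (- / tau)%C) M); [apply eventually_filter|intros; symmetry; apply Ce_pow|].
        intros e He. destruct (pow_lt_1_zero (Cmod (Ce (- / tau)%C))) with (y := e) as [N HN].
        - rewrite Rabs_pos_eq by apply Cmod_ge_0. now apply Cmod_Ce_lt_1.
        - exact He.
        - exists N. intros n Hn. replace (Cpow (Ce (- / tau)%C) n - 0)%C with (Cpow (Ce (- / tau)%C) n) by ring.
          rewrite Cmod_pow. eapply Rle_lt_trans; [apply Rle_abs|now apply HN]. }
      unfold kap. apply Clim_eq with ((1 + 0) / (1 - 0))%C; [field|].
      apply Clim_div; [apply eventually_filter| | |].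
      * replace (1 - 0)%C with (RtoC 1) by ring. apply C1_nz.
      * apply Clim_plus; [apply eventually_filter|apply Clim_const, eventually_filter|exact L].
      * apply Clim_minus; [apply eventually_filter|apply Clim_const, eventually_filter|exact L].
    + apply (Clim_seq_shift (fun M => / z M)%C _ 1).
      apply Clim_inv_seq with (Cmod (- / tau)%C).
      * apply Cmod_pos, (in_H_nz _ Hi).
      * intros M. unfold z. rewrite Cmod_mult, Cmod_R, Rabs_pos_eq by apply pos_INR. lra.
Qed.

(** [u] runs over m >= 1 with both signs; the subtracted multiple of [invsq n] is the term m = 0 of
    the partial fractions at (n + 1) tau. *)
Local Lemma rows n : Csum (u n) = (tpi * tpi * psi (pos (S n) * tau) - / (tau * tau) * invsq n)%C.
Proof.
  assert (Hz := in_H_scal n _ Htau). assert (Ht := in_H_nz _ Htau).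
  fold (pos (S n)) in Hz.
  rewrite (psi_partial_fractions _ _ (Ce_neq1_H _ Hz) (sep_H _ Hz)).
  assert (T := tpi_nz). assert (Nz := in_H_nz _ Hz).
  match goal with |- context [(_ + Csum ?F)%C] => rewrite (Csum_ext F (fun m => / (tpi * tpi) * u n m)%C) end.
  - rewrite Csum_scal by apply u_summable_m.
    assert (Ei : invsq n = (/ (pos (S n) * pos (S n)))%C).
    { unfold invsq, pos. rewrite <- RtoC_mult, <- RtoC_inv.
      - now rewrite S_INR.
      - rewrite S_INR. generalize (pos_INR n). nra. }
    rewrite Ei.
    assert (Np : pos (S n) <> 0) by (apply RtoC_nz; rewrite S_INR; generalize (pos_INR n); lra).
    set (X := Csum (u n)). set (p := pos (S n)) in *. field.
    repeat split; try assumption; try (apply RtoC_nz; generalize PI_RGT_0; lra). apply Ci_nz.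
  - intros m. unfold u. assert (N1 := nz_plus n (S m)). assert (N2 := nz_minus n (S m)).
    fold (pos (S m)).
    set (x := (pos (S n) * tau + pos (S m))%C) in *. set (y := (pos (S n) * tau - pos (S m))%C) in *.
    field. repeat split; try assumption; try (apply RtoC_nz; generalize PI_RGT_0; lra). apply Ci_nz.
Qed.
End OrderSwap.

(** The quasi-modularity of E_2. The absolutely convergent double sum of u - v is evaluated by rows,
    where v contributes nothing, and by columns, where the sums of v add up to the limit of
    [Csum_w_lim]; this is the extra term tpi / (2 tau). *)
Theorem psi_sum_inv tau : in_H tau ->
  (tpi * tpi * psi_sum tau - / (tau * tau) * Csum invsq =
   / (tau * tau) * (tpi * tpi * psi_sum (- / tau)) - Csum invsq + tpi / (2 * tau))%C.
Proof.
  intros Htau. assert (Hi := in_H_inv _ Htau). assert (Ht := in_H_nz _ Htau). assert (T := tpi_nz).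
  set (u := fun (t : C) (n m : nat) =>
     (/ ((INR (S n) * t + INR (S m)) * (INR (S n) * t + INR (S m))) +
      / ((INR (S n) * t - INR (S m)) * (INR (S n) * t - INR (S m))))%C).
  set (w := fun (n m : nat) => (/ (INR (S n) * tau - INR m) - / (INR (S n) * tau + INR m))%C).
  set (v := fun n m => (w n (S m) - w n m)%C).
  assert (Rw : forall t, in_H t -> forall n, Csum (u t n) = (tpi * tpi * psi (INR (S n) * t) - / (t * t) * invsq n)%C).
  { intros t H n. exact (rows t H n). }
  (* The substitution tau -> -1/tau exchanges the two indices, so columns at tau are rows at
     -1/tau. *)
  assert (Eu : forall n m, u tau n m = (/ (tau * tau) * u (- / tau)%C m n)%C).
  { intros n m. unfold u.
    assert (N1 := nz_plus tau Htau n (S m)). assert (N2 := nz_minus tau Htau n (S m)).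
    replace (INR (S m) * - / tau + INR (S n))%C with ((INR (S n) * tau - INR (S m)) / tau)%C by (field; exact Ht).
    replace (INR (S m) * - / tau - INR (S n))%C with (- ((INR (S n) * tau + INR (S m)) / tau))%C by (field; exact Ht).
    set (x := (INR (S n) * tau - INR (S m))%C) in *.
    set (y := (INR (S n) * tau + INR (S m))%C) in *.
    field. repeat split; assumption. }
  assert (Su : forall m, summable (fun n => u tau n m)) by exact (u_summable_n tau Htau).
  assert (Sv : forall m, summable (fun n => v n m)) by exact (v_summable_n tau Htau).
  assert (Col : forall m, Csum (fun n => u tau n m) = (/ (tau * tau) * (tpi * tpi * psi (INR (S m) * - / tau)) - invsq m)%C).
  { intros m. rewrite (Csum_ext _ _ (fun n => Eu n m)).
    rewrite Csum_scal by exact (u_summable_m _ Hi m). rewrite (Rw _ Hi).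
    field. repeat split; assumption. }
  assert (L : Clim eventually (csumn (fun m => Csum (fun n => u tau n m - v n m)%C)) (Csum (fun n => Csum (fun m => u tau n m - v n m)%C))).
  { apply Csum_Csum_swap with (fun n m => 4 / (Im tau / (1 + Im tau + Cmod tau) * (Im tau / (1 + Im tau + Cmod tau)) * (Im tau / (1 + Im tau + Cmod tau))) *
      / ((INR n + INR m + 1) * (INR n + INR m + 2) * (INR n + INR m + 3))).
    - exact (uv_bound tau Htau).
    - intros n. eexists. exact (t_series tau Htau n).
    - eapply ex_series_ext; [intros n; symmetry; exact (is_series_unique _ _ (t_series tau Htau n))|].
      apply ex_series_Rscal, ex_series_telescoping. }
  assert (E1 : Csum (fun n => Csum (fun m => u tau n m - v n m)%C) = (tpi * tpi * psi_sum tau - / (tau * tau) * Csum invsq)%C).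
  { rewrite (Csum_ext _ (fun n => tpi * tpi * psi (INR (S n) * tau) - / (tau * tau) * invsq n)%C).
    - rewrite Csum_minus, !Csum_scal; [reflexivity|apply invsq_summable|now apply psi_summable| |];
      apply summable_scal; [now apply psi_summable|apply invsq_summable].
    - intros n. rewrite <- (Rw tau Htau n). rewrite Csum_minus by (exact (u_summable_m tau Htau n) || exact (v_summable_m tau Htau n)).
      assert (Z : Csum (fun m => v n m) = 0) by exact (Csum_v tau Htau n).
      transitivity (Csum (u tau n) - 0)%C; [exact (f_equal (fun x => Csum (u tau n) - x)%C Z)|ring]. }
  rewrite <- E1.
  refine (Clim_unique eventually _ _ _ L _).
  (* The first M columns of v add up to the boundary value [w n M] in each row. *)
  apply Clim_ext with (fun M => csumn (fun m => / (tau * tau) * (tpi * tpi * psi (INR (S m) * - / tau)) - invsq m)%C M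
     - Csum (fun n => w n M))%C; [apply eventually_filter| |].
  - intros M.
    rewrite (csumn_ext (fun m => Csum (fun n => u tau n m - v n m)%C) (fun m => (/ (tau * tau) * (tpi * tpi * psi (INR (S m) * - / tau)) - invsq m) + RtoC (-1) * Csum (fun n => v n m))%C).
    + rewrite csumn_plus, csumn_scal. rewrite <- (proj1 (csumn_Csum_swap (fun n m => v n m) M Sv)).
      rewrite (Csum_ext (fun n => csumn (fun m => v n m) M) (fun n => w n M)) by (intros n; exact (csumn_v tau n M)). ring.
    + intros m _. rewrite Csum_minus, Col by auto. ring.
  - apply Clim_eq with ((/ (tau * tau) * (tpi * tpi * psi_sum (- / tau)) - Csum invsq) - (- (tpi / (2 * tau))))%C; [ring|].
    apply Clim_minus; [apply eventually_filter| |exact (Csum_w_lim tau Htau)].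
    assert (SP := psi_summable _ Hi).
    unfold psi_sum. rewrite <- !Csum_scal by (try apply summable_scal; exact SP).
    rewrite <- Csum_minus by (try (apply summable_scal, summable_scal; exact SP); apply invsq_summable).
    apply Csum_lim. apply summable_minus; [apply summable_scal, summable_scal; exact SP|apply invsq_summable].
Qed.

(** * The logarithm of the eta function *)

Lemma csumn_geom z n : (csumn (fun k => Cpow z k) n * (1 - z) = 1 - Cpow z n)%C.
Proof.
  induction n as [|n IH]; [simpl; ring|]. rewrite csumn_S, Cmult_plus_distr_r, IH. simpl. ring.
Qed.

Lemma Clim_pow_0 z : Cmod z < 1 -> Clim eventually (fun n => Cpow z n) 0.
Proof.
  intros H e He. destruct (pow_lt_1_zero (Cmod z)) with (y := e) as [N HN].
  - rewrite Rabs_pos_eq by apply Cmod_ge_0. exact H.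
  - exact He.
  - exists N. intros n Hn. replace (Cpow z n - 0)%C with (Cpow z n) by ring.
    rewrite Cmod_pow. eapply Rle_lt_trans; [apply Rle_abs|now apply HN].
Qed.

Lemma one_minus_nz z : Cmod z < 1 -> (1 - z)%C <> 0.
Proof. intros H. apply Cmod_nz. generalize (Cmod_sub_ge 1 z). rewrite Cmod_1. lra. Qed.

Lemma Clim_geom z : Cmod z < 1 -> Clim eventually (csumn (fun k => Cpow z k)) (/ (1 - z))%C.
Proof.
  intros H. assert (N := one_minus_nz _ H).
  apply Clim_ext with (fun n => (1 - Cpow z n) * / (1 - z))%C; [apply eventually_filter| |].
  - intros n. rewrite <- csumn_geom. field. exact N.
  - apply Clim_eq with ((1 - 0) * / (1 - z))%C; [ring|].
    apply Clim_mult; [apply eventually_filter| |apply Clim_const, eventually_filter].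
    apply Clim_minus; [apply eventually_filter|apply Clim_const, eventually_filter|now apply Clim_pow_0].
Qed.

Lemma ex_series_geom_R r : 0 <= r < 1 -> ex_series (fun n => r ^ n).
Proof. intros H. exists (/ (1 - r)). apply is_series_geom. rewrite Rabs_pos_eq; lra. Qed.

Lemma summable_geom z : Cmod z < 1 -> summable (fun k => Cpow z k).
Proof.
  intros H. apply summable_le with (fun k => Cmod z ^ k).
  - intros k. rewrite Cmod_pow. lra.
  - apply ex_series_geom_R. split; [apply Cmod_ge_0|exact H].
Qed.

Lemma Csum_geom z : Cmod z < 1 -> Csum (fun k => Cpow z k) = (/ (1 - z))%C.
Proof. intros H. apply Csum_unique; [now apply summable_geom|now apply Clim_geom]. Qed.

Definition log_series (z : C) : C := Csum (fun k => / INR (S k) * Cpow z (S k))%C.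

Lemma RtoC_INR_S_nz k : RtoC (INR (S k)) <> 0.
Proof. apply RtoC_nz. apply not_0_INR. lia. Qed.

Lemma Cmod_inv_INR_S k : Cmod (/ INR (S k))%C <= 1.
Proof.
  rewrite Cmod_inv by apply RtoC_INR_S_nz. rewrite Cmod_R, Rabs_pos_eq by apply pos_INR.
  rewrite <- Rinv_1. apply Rinv_le_contravar; [lra|]. rewrite S_INR. generalize (pos_INR k). lra.
Qed.

Lemma log_series_term_bound z k : Cmod (/ INR (S k) * Cpow z (S k))%C <= Cmod z ^ S k.
Proof.
  rewrite Cmod_mult, Cmod_pow. generalize (Cmod_inv_INR_S k) (pow_le (Cmod z) (S k) (Cmod_ge_0 z)).
  generalize (Cmod_ge_0 (/ INR (S k))%C). intros. nra.
Qed.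

Lemma log_series_summable z : Cmod z < 1 -> summable (fun k => / INR (S k) * Cpow z (S k))%C.
Proof.
  intros H. apply summable_le with (fun k => Cmod z ^ S k); [apply log_series_term_bound|].
  apply ex_series_geom_S. split; [apply Cmod_ge_0|exact H].
Qed.

Lemma Cder_log_series z : Cmod z < 1 -> Cder log_series z (/ (1 - z))%C.
Proof.
  intros H. rewrite <- Csum_geom by exact H.
  set (r := (1 + Cmod z) / 2).
  assert (Hr : 0 <= r < 1) by (unfold r; generalize (Cmod_ge_0 z); lra).
  assert (N : nbh z (fun w => Cmod w < r)).
  { exists (r - Cmod z). split; [unfold r; lra|]. intros w Hw. generalize (Cmod_sub_ge w z). lra. }
  apply (Cder_Csum (fun k w => / INR (S k) * Cpow w (S k))%C (fun k w => Cpow w k) (fun k => r ^ k)).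
  - now apply ex_series_geom_R.
  - revert N. apply filter_imp. intros w Hw k. split.
    + eapply Cder_eq; [|apply Cder_scal, (Cder_pow (fun w => w) w 1 (S k)), Cder_id].
      simpl pred. field. apply RtoC_INR_S_nz.
    + rewrite Cmod_pow. apply pow_incr. split; [apply Cmod_ge_0|lra].
  - revert N. apply filter_imp. intros w Hw. apply log_series_summable. lra.
Qed.

(** [log_series] is -log(1 - z): the function exp(log_series w) (1 - w) has derivative 0 on the
    segment from 0 to z and equals 1 at 0. *)
Lemma Cexp_log_series z : Cmod z < 1 -> Cexp (- log_series z)%C = (1 - z)%C.
Proof.
  intros H. assert (E : (Cexp (log_series z) * (1 - z) = 1)%C).
  { transitivity (Cexp (log_series 0) * (1 - 0))%C.
    - apply (Cder_0_const (fun w => Cexp (log_series w) * (1 - w))%C 0 z). intros t Ht.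
      set (w := (0 + RtoC t * (z - 0))%C).
      assert (Hw : Cmod w < 1).
      { unfold w. replace (0 + RtoC t * (z - 0))%C with (RtoC t * z)%C by ring.
        rewrite Cmod_mult, Cmod_R, Rabs_pos_eq by lra. generalize (Cmod_ge_0 z). nra. }
      eapply Cder_eq; [|apply (Cder_mult (fun w => Cexp (log_series w)) (fun w => 1 - w)%C);
        [apply Cder_Cexp_comp, Cder_log_series, Hw|apply (Cder_minus (fun _ => 1) (fun w => w)); [apply Cder_const|apply Cder_id]]].
      field. now apply one_minus_nz.
    - unfold log_series. rewrite (Csum_ext _ (fun _ => 0)), Csum_0, Cexp_0; [ring|].
      intros k. simpl Cpow. ring. }
  rewrite Cexp_opp. replace (/ Cexp (log_series z))%C with (/ Cexp (log_series z) * (Cexp (log_series z) * (1 - z)))%C.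
  - field. apply Cexp_nz.
  - rewrite E. ring.
Qed.

(* - log prod_n (1 - q^n) = sum_n sum_k q^(n k) / k, summed over n first. *)
Definition lambert (q : C) : C :=
  Csum (fun k => / INR (S k) * (Cpow q (S k) / (1 - Cpow q (S k))))%C.

Lemma lambert_term_bound q r k : Cmod q <= r -> r < 1 ->
  Cmod (/ INR (S k) * (Cpow q (S k) / (1 - Cpow q (S k))))%C <= / (1 - r) * r ^ S k.
Proof.
  intros H Hr. assert (L := one_minus_pow_lower _ _ k H Hr).
  assert (N : (1 - Cpow q (S k))%C <> 0) by (apply Cmod_nz; lra).
  unfold Cdiv. rewrite !Cmod_mult, (Cmod_inv (1 - Cpow q (S k))%C) by exact N. rewrite Cmod_pow.
  assert (A := Cmod_inv_INR_S k). assert (A0 := Cmod_ge_0 (/ INR (S k))%C).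
  assert (B : Cmod q ^ S k <= r ^ S k) by (apply pow_incr; split; [apply Cmod_ge_0|exact H]).
  assert (B0 : 0 <= Cmod q ^ S k) by (apply pow_le, Cmod_ge_0).
  assert (D : / Cmod (1 - Cpow q (S k))%C <= / (1 - r)) by (apply Rinv_le_contravar; lra).
  assert (D0 : 0 < / Cmod (1 - Cpow q (S k))%C) by (apply Rinv_0_lt_compat; lra).
  assert (X : Cmod q ^ S k * / Cmod (1 - Cpow q (S k))%C <= r ^ S k * / (1 - r)) by (apply Rmult_le_compat; lra).
  assert (0 <= Cmod q ^ S k * / Cmod (1 - Cpow q (S k))%C) by (apply Rmult_le_pos; lra).
  nra.
Qed.

Lemma lambert_summable q : Cmod q < 1 ->
  summable (fun k => / INR (S k) * (Cpow q (S k) / (1 - Cpow q (S k))))%C.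
Proof.
  intros H. apply summable_le with (fun k => / (1 - Cmod q) * Cmod q ^ S k).
  - intros k. apply lambert_term_bound; lra.
  - apply ex_series_Rscal, ex_series_geom_S. split; [apply Cmod_ge_0|exact H].
Qed.

Lemma Cprod_app l m : Cprod (l ++ m) = (Cprod l * Cprod m)%C.
Proof. induction l as [|x l IH]; simpl; [ring|]. rewrite IH. ring. Qed.

Definition euler_partial (q : C) (n : nat) : C :=
  Cprod (map (fun m => 1 - Cpow q m)%C (seq 1 n)).

Lemma euler_partial_S q n : euler_partial q (S n) = (euler_partial q n * (1 - Cpow q (S n)))%C.
Proof.
  unfold euler_partial. rewrite seq_S, map_app, Cprod_app. simpl. ring.
Qed.

Lemma Cmod_pow_lt_1 q n : Cmod q < 1 -> Cmod (Cpow q (S n)) < 1.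
Proof.
  intros H. generalize (one_minus_pow_lower q (Cmod q) n ltac:(lra) H). rewrite Cmod_pow.
  intros _. simpl. assert (P := Cmod_ge_0 q).
  assert (Cmod q ^ n <= 1) by (rewrite <- (pow1 n); apply pow_incr; lra).
  assert (0 <= Cmod q ^ n) by now apply pow_le. nra.
Qed.

Lemma euler_partial_exp q n : Cmod q < 1 ->
  euler_partial q n = Cexp (- csumn (fun m => log_series (Cpow q (S m))) n)%C.
Proof.
  intros H. induction n as [|n IH].
  - simpl. replace (- 0)%C with (RtoC 0) by ring. now rewrite Cexp_0.
  - rewrite euler_partial_S, IH, csumn_S, Copp_plus_distr, Cexp_add, (Cexp_log_series (Cpow q (S n))); [reflexivity|].
    now apply Cmod_pow_lt_1.
Qed.

(** The logarithm of the partial product is a finite sum of series; with the finite sum inside, it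
    becomes a series in k of geometric partial sums in q^k. These are (1 - q^(k n)) / (1 - q^k),
    with numerator at most 2 in modulus, so domination in k yields the limit. *)
Theorem euler_partial_lim q : Cmod q < 1 -> Clim eventually (euler_partial q) (Cexp (- lambert q)%C).
Proof.
  intros H. apply Clim_ext with (fun n => Cexp (- csumn (fun m => log_series (Cpow q (S m))) n)%C);
    [apply eventually_filter|intros; now rewrite euler_partial_exp|].
  apply (Clim_comp eventually (fun n => - csumn (fun m => log_series (Cpow q (S m))) n)%C Cexp); [|apply Ccont_Cexp].
  apply Clim_opp; [apply eventually_filter|].
  assert (Sm : forall m, summable (fun k => / INR (S k) * Cpow (Cpow q (S m)) (S k))%C).
  { intros m. now apply log_series_summable, Cmod_pow_lt_1. }
  apply Clim_ext with (fun n => Csum (fun k => csumn (fun m => / INR (S k) * Cpow (Cpow q (S m)) (S k))%C n));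
    [apply eventually_filter|intros n; apply (csumn_Csum_swap (fun k m => / INR (S k) * Cpow (Cpow q (S m)) (S k))%C n Sm)|].
  assert (Pq := Cmod_ge_0 q).
  assert (E : forall k n, csumn (fun m => / INR (S k) * Cpow (Cpow q (S m)) (S k))%C n =
    (/ INR (S k) * (Cpow q (S k) * csumn (fun m => Cpow (Cpow q (S k)) m) n))%C).
  { intros k n. rewrite <- !csumn_scal. apply csumn_ext. intros m _. f_equal.
    rewrite <- !Cpow_mult_r, <- Cpow_add_r. f_equal. lia. }
  apply (Csum_dominated eventually (fun k n => csumn (fun m => / INR (S k) * Cpow (Cpow q (S m)) (S k))%C n) _
    (fun k => 2 * / (1 - Cmod q) * Cmod q ^ S k)).
  - apply ex_series_Rscal, ex_series_geom_S. lra.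
  - apply filter_forall. intros n k. rewrite E.
    assert (H1 := Cmod_pow_lt_1 q k H). assert (N := one_minus_nz _ H1).
    replace (csumn (fun m => Cpow (Cpow q (S k)) m) n) with ((1 - Cpow (Cpow q (S k)) n) * / (1 - Cpow q (S k)))%C
      by (rewrite <- csumn_geom; field; exact N).
    replace (/ INR (S k) * (Cpow q (S k) * ((1 - Cpow (Cpow q (S k)) n) * / (1 - Cpow q (S k)))))%C
      with ((/ INR (S k) * (Cpow q (S k) / (1 - Cpow q (S k)))) * (1 - Cpow (Cpow q (S k)) n))%C
      by (field; split; [exact N|apply RtoC_INR_S_nz]).
    rewrite Cmod_mult. replace (2 * / (1 - Cmod q) * Cmod q ^ S k) with (/ (1 - Cmod q) * Cmod q ^ S k * 2) by ring.
    apply Rmult_le_compat; try apply Cmod_ge_0.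
    + apply lambert_term_bound; lra.
    + eapply Rle_trans; [apply Cmod_sub_le|]. rewrite Cmod_1, Cmod_pow.
      assert (Cmod (Cpow q (S k)) ^ n <= 1); [|lra].
      rewrite <- (pow1 n). apply pow_incr. split; [apply Cmod_ge_0|lra].
  - intros k. apply Clim_ext with (fun n => / INR (S k) * (Cpow q (S k) * csumn (fun m => Cpow (Cpow q (S k)) m) n))%C;
      [apply eventually_filter|intros; now rewrite E|].
    apply Clim_mult; [apply eventually_filter|apply Clim_const, eventually_filter|].
    apply Clim_mult; [apply eventually_filter|apply Clim_const, eventually_filter|].
    apply Clim_geom. now apply Cmod_pow_lt_1.
Qed.

Lemma Clim_seq_Re (f : nat -> C) l : Clim eventually f l -> real (Lim_seq (fun n => Re (f n))) = Re l.
Proof.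
  intros H. rewrite (is_lim_seq_unique _ (Re l)); [reflexivity|]. apply is_lim_seq_spec. intros e.
  generalize (H e (cond_pos e)). apply filter_imp. intros n Hn.
  eapply Rle_lt_trans; [|exact Hn]. replace (Re (f n) - Re l) with (Re (f n - l)%C); [apply re_le_Cmod|].
  unfold Cminus. rewrite re_plus, re_opp. ring.
Qed.

Lemma Clim_seq_Im (f : nat -> C) l : Clim eventually f l -> real (Lim_seq (fun n => Im (f n))) = Im l.
Proof.
  intros H. rewrite (is_lim_seq_unique _ (Im l)); [reflexivity|]. apply is_lim_seq_spec. intros e.
  generalize (H e (cond_pos e)). apply filter_imp. intros n Hn.
  eapply Rle_lt_trans; [|exact Hn]. replace (Im (f n) - Im l) with (Im (f n - l)%C); [apply im_le_Cmod|].
  unfold Cminus. rewrite im_plus, im_opp. ring.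
Qed.

Definition log_eta (tau : C) : C := (tpi * (tau / RtoC 24) - lambert (Ce tau))%C.

Theorem eta_exp tau : in_H tau -> eta tau = Cexp (log_eta tau).
Proof.
  intros H. assert (L := euler_partial_lim _ (Cmod_Ce_lt_1 _ H)).
  unfold eta, log_eta, Cminus. rewrite Cexp_add. f_equal.
  change (eta_partial tau) with (euler_partial (Ce tau)).
  rewrite (Clim_seq_Re _ _ L), (Clim_seq_Im _ _ L). now destruct (Cexp _).
Qed.

Lemma eta_nz tau : in_H tau -> eta tau <> 0.
Proof. intros H. rewrite eta_exp by exact H. apply Cexp_nz. Qed.

Lemma in_H_nbh tau : in_H tau -> nbh tau (fun w => Im tau / 2 < Im w).
Proof.
  intros H. unfold in_H in H. exists (Im tau / 2). split; [lra|]. intros w Hw.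
  generalize (im_le_Cmod (w - tau)). intros K. unfold Cminus in K at 1. rewrite im_plus, im_opp in K.
  apply Rabs_le_between in K. lra.
Qed.

(** The factor k produced by differentiating q^k cancels the 1/k of the series, and each term
    becomes q^k / (1 - q^k)^2 times 2 pi i. The majorant uses the supremum [r] of |q| over the
    points above half the height of tau. *)
Lemma Cder_lambert_Ce tau : in_H tau -> Cder (fun w => lambert (Ce w)) tau (tpi * psi_sum tau)%C.
Proof.
  intros H. unfold psi_sum. rewrite <- Csum_scal by now apply psi_summable.
  set (r := exp (- (2 * PI * (Im tau / 2)))).
  assert (PP := PI_RGT_0).
  assert (Hr : 0 < r < 1).
  { split; [apply exp_pos|]. unfold r. rewrite <- exp_0. apply exp_increasing. unfold in_H in H. nra. }
  assert (N : nbh tau (fun w => in_H w /\ Cmod (Ce w) <= r)).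
  { generalize (in_H_nbh _ H). apply filter_imp. unfold in_H in *. intros w Hw. split; [lra|].
    rewrite Cmod_Ce. left. apply exp_increasing. nra. }
  apply (Cder_Csum (fun k w => / INR (S k) * (Cpow (Ce w) (S k) / (1 - Cpow (Ce w) (S k))))%C
    (fun k w => tpi * psi (INR (S k) * w))%C
    (fun k => Cmod tpi * (/ ((1 - r) * (1 - r)) * r ^ S k))).
  - apply ex_series_Rscal, ex_series_Rscal, ex_series_geom_S. lra.
  - revert N. apply filter_imp. intros w [Hw1 Hw2] k. split.
    + assert (Nq := one_minus_nz _ (Cmod_pow_lt_1 _ k (Cmod_Ce_lt_1 _ Hw1))).
      assert (Dq : Cder (fun w => Cpow (Ce w) (S k)) w (tpi * INR (S k) * Cpow (Ce w) (S k))%C).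
      { eapply Cder_eq; [|apply Cder_pow, Cder_Ce]. simpl pred. simpl Cpow. ring. }
      eapply Cder_eq; [|apply Cder_scal, (Cder_mult (fun w => Cpow (Ce w) (S k)) (fun w => / (1 - Cpow (Ce w) (S k)))%C);
        [exact Dq|apply Cder_inv_fun; [exact Nq|apply Cder_minus; [apply Cder_const|exact Dq]]]].
      unfold psi. rewrite Ce_scal_pow. assert (NN := RtoC_INR_S_nz k).
      set (x := Cpow (Ce w) (S k)) in *. field. split; assumption.
    + rewrite Cmod_mult. apply Rmult_le_compat_l; [apply Cmod_ge_0|]. apply psi_bound; [exact Hw2|lra].
  - revert N. apply filter_imp. intros w [Hw1 _]. apply lambert_summable. now apply Cmod_Ce_lt_1.
Qed.

Lemma Cder_log_eta tau : in_H tau -> Cder log_eta tau (tpi * (/ RtoC 24 - psi_sum tau))%C.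
Proof.
  intros H. unfold log_eta.
  apply Cder_ext with (fun w => tpi * / RtoC 24 * w - lambert (Ce w))%C.
  - intros w. field.
  - eapply Cder_eq; [|apply Cder_minus; [apply Cder_scal, Cder_id|now apply Cder_lambert_Ce]]. ring.
Qed.

Lemma log_eta_shift tau n : log_eta (tau + IZR n)%C = (log_eta tau + tpi * (IZR n / RtoC 24))%C.
Proof.
  unfold log_eta. rewrite Ce_add, Ce_IZR, Cmult_1_r. field.
Qed.

(** * The inversion formula for the square of eta *)

(** Since zeta(2) = - (2 pi i)^2 / 24, the two zeta terms are absorbed exactly by the constant 1/24,
    the exponent in eta = q^(1/24) prod_n (1 - q^n). *)
Lemma psi_sum_inv_24 tau : in_H tau ->
  (tpi * (/ RtoC 24 - psi_sum (- / tau)) * / (tau * tau) = tpi * (/ RtoC 24 - psi_sum tau) + / (2 * tau))%C.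
Proof.
  intros H. assert (Ht := in_H_nz _ H). assert (T := tpi_nz). assert (K := psi_sum_inv tau H).
  rewrite Csum_invsq in K.
  replace (RtoC (PI * PI / 6)) with (- (tpi * tpi) / RtoC 24)%C in K.
  2:{ rewrite tpi_sqr. rewrite <- RtoC_opp, <- RtoC_div by lra. f_equal. field. }
  apply Ceq_minus. apply Ceq_minus in K.
  match type of K with ?A = _ => match goal with |- ?B = _ =>
    assert (E : (A * / tpi = - - B)%C) end end.
  { clear K. set (X := psi_sum tau). set (Y := psi_sum (- / tau)%C). field.
    repeat split; try assumption; try (apply RtoC_nz; generalize PI_RGT_0; lra); try apply Ci_nz. }
  rewrite K in E. match goal with |- ?B = _ => replace B with (- - B)%C by ring end. rewrite <- E. ring.
Qed.

Lemma in_H_convex a b t : in_H a -> in_H b -> 0 <= t <= 1 -> in_H (a + RtoC t * (b - a))%C.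
Proof.
  unfold in_H, Cminus. intros Ha Hb Ht. rewrite im_plus, im_scal_l, im_plus, im_opp.
  replace (Im a + t * (Im b + - Im a)) with ((1 - t) * Im a + t * Im b) by ring.
  destruct (Rle_dec t (1/2)); nra.
Qed.

Lemma in_H_Ci : in_H Ci.
Proof. unfold in_H; simpl; lra. Qed.

(** [h] is eta(-1/w)^2 / (w eta(w)^2), written through [log_eta]. Its derivative vanishes by the
    preceding lemma, and its constant value is read off at the fixed point w = i of the
    inversion. *)
Theorem eta_sqr_inv tau : in_H tau ->
  (eta (- / tau) * eta (- / tau) = - Ci * tau * (eta tau * eta tau))%C.
Proof.
  intros H.
  set (h := fun w => (Cexp (2 * (log_eta (- / w) - log_eta w)) * / w)%C).
  assert (Eh : h tau = h Ci).
  { apply Cder_0_const. intros t Ht. assert (Hw := in_H_convex _ _ t in_H_Ci H Ht).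
    set (w := (Ci + RtoC t * (tau - Ci))%C) in *. assert (Nw := in_H_nz _ Hw).
    unfold h. eapply Cder_eq; [|apply (Cder_mult (fun w => Cexp (2 * (log_eta (- / w) - log_eta w))) (fun w => / w))%C;
      [apply Cder_Cexp_comp, Cder_scal, Cder_minus;
        [apply (Cder_comp log_eta (fun w => - / w)%C); [apply Cder_opp, Cder_inv, Nw|apply Cder_log_eta, in_H_inv, Hw]
        |apply Cder_log_eta, Hw]
      |apply Cder_inv, Nw]].
    cbv beta. assert (K := psi_sum_inv_24 w Hw).
    set (A := (tpi * (/ RtoC 24 - psi_sum (- / w)))%C) in *. set (B := (tpi * (/ RtoC 24 - psi_sum w))%C) in *.
    replace (A * - - / (w * w))%C with (B + / (2 * w))%C by (rewrite <- K; ring).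
    field. exact Nw. }
  assert (Ei : h Ci = (- Ci)%C).
  { unfold h. rewrite Ci_inv. replace (- - Ci)%C with Ci by ring.
    replace (2 * (log_eta Ci - log_eta Ci))%C with (RtoC 0) by ring. rewrite Cexp_0. ring. }
  rewrite Ei in Eh. assert (Nt := in_H_nz _ H).
  rewrite !eta_exp by (assumption || now apply in_H_inv).
  rewrite <- Eh. unfold h.
  replace (2 * (log_eta (- / tau) - log_eta tau))%C with ((log_eta (- / tau) + log_eta (- / tau)) - (log_eta tau + log_eta tau))%C by ring.
  rewrite Cexp_minus, !Cexp_add. field. repeat split; (exact Nt || apply Cexp_nz).
Qed.

Lemma eta_shift tau n : in_H tau -> eta (tau + IZR n)%C = (Ce (IZR n / RtoC 24) * eta tau)%C.
Proof.
  intros H. assert (in_H (tau + IZR n)%C) by (unfold in_H in *; rewrite im_plus, im_RtoC; lra).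
  rewrite !eta_exp, log_eta_shift, Cexp_add by assumption. unfold Ce. ring.
Qed.

(** * The modular group *)

Lemma mob_denom_nz g tau : (0 < mdet g)%Z -> in_H tau -> mob_denom g tau <> 0.
Proof.
  intros Hd H E. unfold mob_denom, mdet, in_H in *. destruct g as [a b c d]. simpl in *.
  assert (E1 : Im (IZR c * tau + IZR d)%C = 0) by now rewrite E.
  assert (E2 : Re (IZR c * tau + IZR d)%C = 0) by now rewrite E.
  rewrite im_plus, im_scal_l, im_RtoC in E1. rewrite re_plus, re_scal_l, re_RtoC in E2.
  assert (c = 0%Z) by (apply eq_IZR; nra). subst c. assert (d = 0%Z) by (apply eq_IZR; nra). subst d. lia.
Qed.

Lemma mob_in_H g tau : (0 < mdet g)%Z -> in_H tau -> in_H (mob g tau).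
Proof.
  intros Hd H. assert (N := mob_denom_nz g tau Hd H). unfold mob.
  assert (P := Cmod_pos _ N). set (D := mob_denom g tau) in *.
  unfold in_H.
  assert (E : Im ((IZR (ma g) * tau + IZR (mb g)) / D)%C * (Cmod D * Cmod D) = IZR (mdet g) * Im tau).
  { assert (Q : (Re D * Re D + Im D * Im D) <> 0) by (rewrite <- Cmod_sqr; nra).
    rewrite Cmod_sqr. unfold D, mdet, mob_denom in *. rewrite minus_IZR, !mult_IZR.
    destruct tau as [x y]. simpl in *. field. intros K. apply Q. etransitivity; [|exact K]. ring. }
  apply IZR_lt in Hd. unfold in_H in H.
  apply Rmult_lt_reg_r with (Cmod D * Cmod D); [nra|]. rewrite E, Rmult_0_l. now apply Rmult_lt_0_compat.
Qed.

Lemma Cmod_Ce_R x : Cmod (Ce (RtoC x)) = 1.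
Proof. rewrite Cmod_Ce, im_RtoC, Rmult_0_r, Ropp_0. apply exp_0. Qed.

(** Euclid's algorithm on the lower row, by induction on |c|: g = T^q S g', where the lower left
    entry of g' is a mod c. Each step uses [eta_shift] and [eta_sqr_inv] once, and the denominators
    satisfy the cocycle relation [Em]. *)
Theorem eta_sqr_transform g : SL2Z g -> exists chi : C, Cmod chi = 1 /\
  forall tau, in_H tau ->
    (eta (mob g tau) * eta (mob g tau) = chi * mob_denom g tau * (eta tau * eta tau))%C.
Proof.
  remember (Z.abs_nat (mc g)) as n eqn:En. revert g En.
  induction n as [n IH] using (well_founded_induction lt_wf). intros [a b c d] En Hg. simpl in En.
  assert (E24 : forall k : Z, (IZR k / RtoC 24 = RtoC (IZR k / 24))%C) by (intros; rewrite RtoC_div by lra; reflexivity).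
  destruct (Z.eq_dec c 0) as [->|Hc].
  - unfold SL2Z, mdet in Hg. simpl in Hg.
    assert (Hd : (a = d /\ (d = 1 \/ d = -1))%Z).
    { assert (a * d = 1)%Z by lia. destruct (Z.mul_eq_1 a d H) as [->| ->]; lia. }
    destruct Hd as [-> Hd]. assert (Edd : (IZR d * IZR d = 1)%C).
    { rewrite <- RtoC_mult, <- mult_IZR. destruct Hd as [-> | ->]; reflexivity. }
    (* The last factor d, which is 1 or -1, cancels the denominator d of the upper triangular
       matrix. *)
    exists (Ce (IZR (b * d) / RtoC 24) * Ce (IZR (b * d) / RtoC 24) * IZR d)%C. split.
    + rewrite E24, !Cmod_mult, Cmod_Ce_R, Cmod_R. destruct Hd as [-> | ->]; rewrite ?Rabs_R1, ?Rabs_m1; try ring.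
    + intros tau H. assert (Em : mob (Mat2 d b 0 d) tau = (tau + IZR (b * d))%C).
      { unfold mob, mob_denom. simpl. rewrite mult_IZR, RtoC_mult.
        assert (RtoC (IZR d) <> 0) by (apply RtoC_nz; destruct Hd as [-> | ->]; lra).
        transitivity ((IZR d * tau + IZR b * (IZR d * IZR d)) / IZR d)%C; [|field; assumption].
        rewrite Edd. field. assumption. }
      rewrite Em, eta_shift by exact H. unfold mob_denom. simpl.
      set (X := Ce (IZR (b * d) / RtoC 24)%C).
      transitivity (X * X * (IZR d * IZR d) * (eta tau * eta tau))%C; [rewrite Edd; ring|ring].
  - set (q := (a / c)%Z). set (a' := (a mod c)%Z).
    assert (Ea : (a = c * q + a')%Z) by (apply Z.div_mod; exact Hc).
    set (g' := Mat2 (- c) (- d) a' (b - q * d)).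
    assert (Hg' : SL2Z g').
    { unfold SL2Z, mdet in *. simpl in *. rewrite Ea in Hg. lia. }
    destruct (IH (Z.abs_nat a')) with (g := g') as [chi [H1 H2]].
    (* Floor division gives |a mod c| < |c| for either sign of c. *)
    + unfold a'. subst n. destruct (Z_lt_le_dec 0 c).
      * generalize (Z.mod_pos_bound a c ltac:(lia)). lia.
      * generalize (Z.mod_neg_bound a c ltac:(lia)). lia.
    + reflexivity.
    + exact Hg'.
    + exists (Ce (IZR q / RtoC 24) * Ce (IZR q / RtoC 24) * Ci * chi)%C. split.
      * rewrite E24, !Cmod_mult, Cmod_Ce_R, Cmod_Ci, H1. ring.
      * intros tau H.
        assert (D' : (0 < mdet g')%Z) by (rewrite Hg'; lia).
        assert (D : (0 < mdet (Mat2 a b c d))%Z) by (rewrite Hg; lia).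
        assert (N' := mob_denom_nz g' tau D' H). assert (N := mob_denom_nz _ tau D H).
        assert (Hm := mob_in_H g' tau D' H). assert (Hi := in_H_inv _ Hm). assert (Nm := in_H_nz _ Hm).
        assert (Em : (mob g' tau * mob_denom g' tau = - mob_denom (Mat2 a b c d) tau)%C).
        { unfold mob. set (dd := mob_denom g' tau) in *. unfold mob_denom. simpl. rewrite !opp_IZR, !RtoC_opp. field. exact N'. }
        assert (Eg : mob (Mat2 a b c d) tau = (- / mob g' tau + IZR q)%C).
        { transitivity ((mob_denom g' tau + IZR q * mob_denom (Mat2 a b c d) tau) / mob_denom (Mat2 a b c d) tau)%C.
          - unfold mob. f_equal. unfold mob_denom. simpl. rewrite Ea, minus_IZR, plus_IZR, !mult_IZR, RtoC_minus, RtoC_plus, !RtoC_mult. ring.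
          - replace (mob_denom (Mat2 a b c d) tau) with (- (mob g' tau * mob_denom g' tau))%C by (rewrite Em; ring).
            field. split; assumption. }
        rewrite Eg, eta_shift by exact Hi.
        set (X := Ce (IZR q / RtoC 24)%C).
        transitivity (X * X * (eta (- / mob g' tau) * eta (- / mob g' tau)))%C; [ring|].
        rewrite eta_sqr_inv by exact Hm. rewrite H2 by exact H.
        replace (mob_denom (Mat2 a b c d) tau) with (- (mob g' tau * mob_denom g' tau))%C by (rewrite Em; ring).
        ring.
Qed.

(** * Integral and half-integral powers *)

Lemma Cpowz_of_nat z n : Cpowz z (Z.of_nat n) = Cpow z n.
Proof. destruct n as [|n]; [reflexivity|]. simpl Z.of_nat. unfold Cpowz. now rewrite SuccNat2Pos.id_succ. Qed.

Lemma Cpowz_opp_of_nat z n : Cpowz z (- Z.of_nat n) = (/ Cpow z n)%C.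
Proof.
  destruct n as [|n]; [simpl; field|]. simpl Z.of_nat. simpl Z.opp. unfold Cpowz. now rewrite SuccNat2Pos.id_succ.
Qed.

Lemma Z_nat_cases (n : Z) : exists k, n = Z.of_nat k \/ n = (- Z.of_nat k)%Z.
Proof. exists (Z.abs_nat n). lia. Qed.

Lemma Cpowz_succ z n : z <> RtoC 0 -> Cpowz z (Z.succ n) = (z * Cpowz z n)%C.
Proof.
  intros Hz. destruct (Z_nat_cases n) as [[|k] [-> | ->]].
  - simpl. ring.
  - simpl. ring.
  - rewrite <- Nat2Z.inj_succ, !Cpowz_of_nat. reflexivity.
  - replace (Z.succ (- Z.of_nat (S k))) with (- Z.of_nat k)%Z by lia. rewrite !Cpowz_opp_of_nat. simpl.
    assert (Cpow z k <> 0) by now apply Cpow_nz. field. split; assumption.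
Qed.

Lemma Cpowz_nz z n : z <> RtoC 0 -> Cpowz z n <> 0.
Proof.
  intros Hz. destruct (Z_nat_cases n) as [k [-> | ->]].
  - rewrite Cpowz_of_nat. now apply Cpow_nz.
  - rewrite Cpowz_opp_of_nat. apply Cinv_nz. now apply Cpow_nz.
Qed.

Lemma Cpowz_add z n m : z <> RtoC 0 -> Cpowz z (n + m) = (Cpowz z n * Cpowz z m)%C.
Proof.
  intros Hz. induction m as [|m IH|m IH] using Z.peano_ind.
  - rewrite Z.add_0_r. simpl. ring.
  - rewrite Z.add_succ_r, !Cpowz_succ, IH by exact Hz. ring.
  - assert (E1 := Cpowz_succ z (n + Z.pred m) Hz). assert (E2 := Cpowz_succ z (Z.pred m) Hz).
    rewrite <- Z.add_succ_r, Z.succ_pred in E1. rewrite Z.succ_pred in E2. rewrite IH, E2 in E1.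
    replace (Cpowz z (n + Z.pred m)) with (/ z * (z * Cpowz z (n + Z.pred m)))%C by (field; exact Hz).
    rewrite <- E1. field. exact Hz.
Qed.

Lemma Cpowz_mult_l x y n : x <> RtoC 0 -> y <> RtoC 0 -> Cpowz (x * y)%C n = (Cpowz x n * Cpowz y n)%C.
Proof.
  intros Hx Hy. destruct (Z_nat_cases n) as [k [-> | ->]].
  - rewrite !Cpowz_of_nat. apply Cpow_mult_l.
  - rewrite !Cpowz_opp_of_nat, Cpow_mult_l.
    assert (A := Cpow_nz _ k Hx). assert (B := Cpow_nz _ k Hy). field. split; assumption.
Qed.

Lemma Cmod_Cpowz z n : Cmod z = 1 -> Cmod (Cpowz z n) = 1.
Proof.
  intros H. assert (N : z <> 0) by (apply Cmod_nz; lra).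
  destruct (Z_nat_cases n) as [k [-> | ->]].
  - rewrite Cpowz_of_nat, Cmod_pow, H. apply pow1.
  - rewrite Cpowz_opp_of_nat, Cmod_inv, Cmod_pow, H, pow1, Rinv_1; [reflexivity|now apply Cpow_nz].
Qed.

Lemma Cpowz_Cexp z n : Cpowz (Cexp z) n = Cexp (IZR n * z)%C.
Proof.
  destruct (Z_nat_cases n) as [k [-> | ->]].
  - rewrite Cpowz_of_nat, <- INR_IZR_INZ, Cexp_INR. reflexivity.
  - rewrite Cpowz_opp_of_nat, opp_IZR, <- INR_IZR_INZ, <- Cexp_INR, <- Cexp_opp. f_equal. rewrite RtoC_opp. ring.
Qed.

Lemma Clim_powz {T : Type} (F : (T -> Prop) -> Prop) {FF : ProperFilter F} f l n :
  l <> RtoC 0 -> Clim F f l -> Clim F (fun x => Cpowz (f x) n) (Cpowz l n).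
Proof.
  intros Hl Hf. destruct (Z_nat_cases n) as [k [-> | ->]].
  - rewrite Cpowz_of_nat. apply Clim_ext with (fun x => Cpow (f x) k); [exact FF|intros; now rewrite Cpowz_of_nat|].
    now apply Clim_pow.
  - rewrite Cpowz_opp_of_nat. apply Clim_ext with (fun x => / Cpow (f x) k)%C; [exact FF|intros; now rewrite Cpowz_opp_of_nat|].
    apply Clim_inv; [exact FF|now apply Cpow_nz|now apply Clim_pow].
Qed.

Lemma Cmod_Re_bounds z : 0 <= Cmod z + Re z /\ 0 <= Cmod z - Re z.
Proof. generalize (re_le_Cmod z). intros H. apply Rabs_le_between in H. lra. Qed.

Lemma Csqrt_sqr z : (Csqrt z * Csqrt z = z)%C.
Proof.
  destruct (Cmod_Re_bounds z) as [H1 H2].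
  set (p := sqrt ((Cmod z + Re z) / 2)). set (q := sqrt ((Cmod z - Re z) / 2)).
  assert (Ep : p * p = (Cmod z + Re z) / 2) by (apply sqrt_sqrt; lra).
  assert (Eq : q * q = (Cmod z - Re z) / 2) by (apply sqrt_sqrt; lra).
  assert (P : 0 <= p) by apply sqrt_pos. assert (Q : 0 <= q) by apply sqrt_pos.
  assert (Epq : 2 * (p * q) = Rabs (Im z)).
  { apply Rsqr_inj; [nra|apply Rabs_pos|]. unfold Rsqr. rewrite <- Rabs_sqr.
    replace (2 * (p * q) * (2 * (p * q))) with (4 * (p * p) * (q * q)) by ring. rewrite Ep, Eq.
    generalize (Cmod_sqr z). nra. }
  unfold Csqrt. fold p q. apply Ceq_ReIm.
  - destruct (Rle_dec 0 (Im z)); simpl; lra.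
  - destruct (Rle_dec 0 (Im z)) as [h|h]; simpl.
    + rewrite Rabs_pos_eq in Epq by exact h. lra.
    + rewrite Rabs_left in Epq by lra. lra.
Qed.

Lemma Csqrt_nz z : z <> RtoC 0 -> Csqrt z <> 0.
Proof. intros H K. apply H. rewrite <- (Csqrt_sqr z), K. ring. Qed.

(** Independent of the branch chosen for odd [w]; with continuity and non-vanishing, this is all
    that the passage from squares to square roots uses. *)
Lemma Cpow_half_sqr z w : z <> RtoC 0 -> (Cpow_half z w * Cpow_half z w = Cpowz z w)%C.
Proof.
  intros Hz. unfold Cpow_half. destruct (Z.even w) eqn:E.
  - rewrite <- Cpowz_add by exact Hz. f_equal. apply Z.even_spec in E. destruct E as [k ->].
    rewrite (Z.mul_comm 2), Z.div_mul by lia. lia.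
  - transitivity ((Csqrt z * Csqrt z) * (Cpowz z (w / 2) * Cpowz z (w / 2)))%C; [ring|].
    rewrite Csqrt_sqr, <- Cpowz_add, <- Cpowz_succ by exact Hz. f_equal.
    assert (O : Z.odd w = true) by (rewrite <- Z.negb_even, E; reflexivity).
    apply Z.odd_spec in O. destruct O as [k ->]. replace ((2 * k + 1) / 2)%Z with k by (apply Z.div_unique with 1%Z; lia). lia.
Qed.

Lemma Cpow_half_nz z w : z <> RtoC 0 -> Cpow_half z w <> 0.
Proof.
  intros Hz. unfold Cpow_half. destruct (Z.even w); [now apply Cpowz_nz|].
  apply Cmult_neq_0; [now apply Csqrt_nz|now apply Cpowz_nz].
Qed.

Lemma Clim_real_comp {T : Type} (F : (T -> Prop) -> Prop) {FF : ProperFilter F} (g : R -> R) (f : T -> R) (x : R) :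
  continuity_pt g x -> Clim F (fun t => RtoC (f t)) (RtoC x) -> Clim F (fun t => RtoC (g (f t))) (RtoC (g x)).
Proof.
  intros Hg Hf. apply Clim_RtoC; [exact FF|]. intros e He.
  destruct (Hg e He) as [d [Hd H]]. generalize (Hf d Hd). apply filter_imp. intros t Ht.
  rewrite <- RtoC_minus, Cmod_R in Ht. simpl in H. unfold R_dist in H.
  destruct (Req_dec (f t) x) as [->|n].
  - rewrite Rminus_diag, Rabs_R0. exact He.
  - apply H. split; [|exact Ht]. split; [exact I|]. intros E; apply n; now symmetry.
Qed.

Lemma Clim_Re {T : Type} (F : (T -> Prop) -> Prop) {FF : ProperFilter F} (f : T -> C) l :
  Clim F f l -> Clim F (fun t => RtoC (Re (f t))) (RtoC (Re l)).
Proof.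
  intros Hf e He. generalize (Hf e He). apply filter_imp. intros t Ht.
  rewrite <- RtoC_minus, Cmod_R. eapply Rle_lt_trans; [|exact Ht].
  replace (Re (f t) - Re l) with (Re (f t - l)%C); [apply re_le_Cmod|].
  unfold Cminus. rewrite re_plus, re_opp. ring.
Qed.

Lemma Clim_Cmod {T : Type} (F : (T -> Prop) -> Prop) {FF : ProperFilter F} (f : T -> C) l :
  Clim F f l -> Clim F (fun t => RtoC (Cmod (f t))) (RtoC (Cmod l)).
Proof.
  intros Hf e He. generalize (Hf e He). apply filter_imp. intros t Ht.
  rewrite <- RtoC_minus, Cmod_R. eapply Rle_lt_trans; [|exact Ht].
  generalize (Cmod_sub_ge (f t) l) (Cmod_sub_ge l (f t)). rewrite (Cmod_sub_sym l). intros.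
  apply Rabs_le. lra.
Qed.

Lemma Ccont_Csqrt z : Im z <> 0 -> Ccont Csqrt z.
Proof.
  intros Hz. set (s := if Rle_dec 0 (Im z) then 1 else -1).
  set (h := fun w => (RtoC (sqrt ((Cmod w + Re w) / 2)) + RtoC s * Ci * RtoC (sqrt ((Cmod w - Re w) / 2)))%C).
  assert (E : nbh z (fun w => h w = Csqrt w)).
  { exists (Rabs (Im z)). split; [now apply Rabs_pos_lt|]. intros w Hw.
    assert (K := im_le_Cmod (w - z)). unfold Cminus in K at 1. rewrite im_plus, im_opp in K.
    unfold h, Csqrt, s. apply Ceq_ReIm; destruct (Rle_dec 0 (Im z)); destruct (Rle_dec 0 (Im w)); simpl; try ring; exfalso.
    - apply Rabs_le_between in K. rewrite Rabs_pos_eq in Hw; lra.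
    - apply Rabs_le_between in K. rewrite Rabs_left in Hw; lra. }
  unfold Ccont. rewrite <- (nbh_self _ _ E).
  apply Clim_ext_loc with h; [apply nbh_filter|exact E|].
  assert (L : forall s' : R, Clim (nbh z) (fun w => RtoC ((Cmod w + s' * Re w) / 2)) (RtoC ((Cmod z + s' * Re z) / 2))).
  { intros s'. apply Clim_ext with (fun w => (RtoC (Cmod w) + RtoC s' * RtoC (Re w)) * RtoC (/ 2))%C.
    - apply nbh_filter.
    - intros w. rewrite <- RtoC_mult, <- RtoC_plus, <- RtoC_mult. reflexivity.
    - unfold Rdiv. rewrite RtoC_mult, RtoC_plus, RtoC_mult.
      apply Clim_mult; [apply nbh_filter| |apply Clim_const, nbh_filter].
      apply Clim_plus; [apply nbh_filter|apply Clim_Cmod; [apply nbh_filter|apply Ccont_id]|].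
      apply Clim_mult; [apply nbh_filter|apply Clim_const, nbh_filter|apply Clim_Re; [apply nbh_filter|apply Ccont_id]]. }
  destruct (Cmod_Re_bounds z) as [H1 H2].
  apply Clim_plus; [apply nbh_filter| |apply Clim_mult; [apply nbh_filter|apply Clim_const, nbh_filter|]].
  - apply (Clim_real_comp (nbh z) sqrt (fun w => (Cmod w + Re w) / 2)).
    + apply continuity_pt_sqrt. lra.
    + generalize (L 1). rewrite Rmult_1_l. intros K. eapply Clim_ext; [apply nbh_filter| |exact K].
      intros w. simpl. now rewrite Rmult_1_l.
  - apply (Clim_real_comp (nbh z) sqrt (fun w => (Cmod w - Re w) / 2)).
    + apply continuity_pt_sqrt. lra.
    + generalize (L (-1)). replace (Cmod z + -1 * Re z) with (Cmod z - Re z) by ring. intros K.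
      eapply Clim_ext; [apply nbh_filter| |exact K].
      intros w. cbv beta. f_equal. field.
Qed.

Lemma Ccont_mob_denom g tau : Ccont (mob_denom g) tau.
Proof.
  unfold Ccont, mob_denom. apply Clim_plus; [apply nbh_filter| |apply Clim_const, nbh_filter].
  apply Clim_mult; [apply nbh_filter|apply Clim_const, nbh_filter|apply Ccont_id].
Qed.

Lemma Ccont_mob g tau : (0 < mdet g)%Z -> in_H tau -> Ccont (mob g) tau.
Proof.
  intros Hd H. unfold Ccont, mob. apply Clim_div; [apply nbh_filter|now apply mob_denom_nz| |apply Ccont_mob_denom].
  apply Clim_plus; [apply nbh_filter| |apply Clim_const, nbh_filter].
  apply Clim_mult; [apply nbh_filter|apply Clim_const, nbh_filter|apply Ccont_id].
Qed.

(** The principal root jumps on the negative real axis. For c <> 0 the denominator c tau + d is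
    never real on the upper half-plane; for c = 0 it is constant, and its root is constant even if d
    < 0. *)
Lemma Ccont_Csqrt_denom g tau : in_H tau -> Ccont (fun w => Csqrt (mob_denom g w)) tau.
Proof.
  intros H. destruct (Z.eq_dec (mc g) 0) as [E|E].
  - unfold Ccont. apply Clim_ext with (fun _ => Csqrt (IZR (md g))); [apply nbh_filter| |].
    + intros w. unfold mob_denom. rewrite E. f_equal. ring.
    + unfold mob_denom. rewrite E. replace (0 * tau + IZR (md g))%C with (RtoC (IZR (md g))) by ring.
      apply Clim_const, nbh_filter.
  - apply (Ccont_comp Csqrt (mob_denom g)); [apply Ccont_mob_denom|apply Ccont_Csqrt].
    unfold mob_denom. rewrite im_plus, im_scal_l, im_RtoC, Rplus_0_r. unfold in_H in H.
    apply Rmult_integral_contrapositive. split; [now apply not_0_IZR|lra].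
Qed.

Lemma Ccont_Cpow_half_denom g w tau : (0 < mdet g)%Z -> in_H tau ->
  Ccont (fun z => Cpow_half (mob_denom g z) w) tau.
Proof.
  intros Hd H. assert (N := mob_denom_nz g tau Hd H). unfold Cpow_half. destruct (Z.even w).
  - apply Clim_powz; [apply nbh_filter|exact N|apply Ccont_mob_denom].
  - apply Clim_mult; [apply nbh_filter|now apply Ccont_Csqrt_denom|].
    apply Clim_powz; [apply nbh_filter|exact N|apply Ccont_mob_denom].
Qed.

(* A continuous square root of a constant cannot change sign on the connected set H. *)
Lemma Ccont_sqr_const (phi : C -> C) (X : C) : X <> 0 ->
  (forall tau, in_H tau -> Ccont phi tau) ->
  (forall tau, in_H tau -> (phi tau * phi tau = X)%C) ->
  forall tau, in_H tau -> phi tau = phi Ci.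
Proof.
  intros HX Hc Hs tau H. assert (Ni : phi Ci <> 0).
  { intros K. apply HX. rewrite <- (Hs Ci in_H_Ci), K. ring. }
  assert (S1 : forall w, in_H w -> (phi w / phi Ci)%C = 1 \/ (phi w / phi Ci)%C = RtoC (-1)).
  { intros w Hw. assert (E : ((phi w / phi Ci - 1) * (phi w / phi Ci + 1) = 0)%C).
    { transitivity ((phi w * phi w - phi Ci * phi Ci) / (phi Ci * phi Ci))%C; [field; exact Ni|].
      rewrite (Hs w Hw), (Hs Ci in_H_Ci). field. exact HX. }
    destruct (Cmult_integral _ _ E) as [K|K].
    - left. rewrite <- (Cplus_0_l 1), <- K. ring.
    - right. transitivity ((phi w / phi Ci + 1) + RtoC (-1))%C; [ring|]. rewrite K. ring. }
  destruct (S1 tau H) as [E|E].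
  - replace (phi tau) with (phi tau / phi Ci * phi Ci)%C by (field; exact Ni). rewrite E. ring.
  - exfalso. set (h := fun t : R => Re (phi (tau + RtoC t * (Ci - tau)) / phi Ci)%C).
    destruct (IVT_interv h 0 1) as [t [Ht Hz]].
    + intros t Ht. assert (Hw := in_H_convex _ _ t H in_H_Ci Ht).
      assert (L : Clim (nbh (tau + RtoC t * (Ci - tau))%C) (fun w => (phi w / phi Ci)%C) (phi (tau + RtoC t * (Ci - tau)) / phi Ci)%C).
      { apply Clim_div; [apply nbh_filter|exact Ni|now apply Hc|apply Clim_const, nbh_filter]. }
      intros e He. destruct (L e He) as [d [Hd K]].
      set (B := Cmod (Ci - tau)%C + 1). assert (HB : 0 < B) by (unfold B; generalize (Cmod_ge_0 (Ci - tau)%C); lra).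
      exists (d / B). split; [now apply Rdiv_lt_0_compat|]. intros s [_ Hs2]. change (Rabs (s - t) < d / B) in Hs2. change (Rabs (h s - h t) < e).
      unfold h. replace (Re (phi (tau + RtoC s * (Ci - tau)) / phi Ci)%C - Re (phi (tau + RtoC t * (Ci - tau)) / phi Ci)%C)
        with (Re (phi (tau + RtoC s * (Ci - tau)) / phi Ci - phi (tau + RtoC t * (Ci - tau)) / phi Ci)%C)
        by (unfold Cminus at 1; rewrite re_plus, re_opp; ring).
      eapply Rle_lt_trans; [apply re_le_Cmod|]. apply K.
      replace (tau + RtoC s * (Ci - tau) - (tau + RtoC t * (Ci - tau)))%C with (RtoC (s - t) * (Ci - tau))%C
        by (rewrite RtoC_minus; ring).
      rewrite Cmod_mult, Cmod_R. apply Rle_lt_trans with (Rabs (s - t) * B).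
      * apply Rmult_le_compat_l; [apply Rabs_pos|unfold B; lra].
      * apply (Rmult_lt_compat_r B) in Hs2; [|exact HB]. replace (d / B * B) with d in Hs2 by (field; lra). exact Hs2.
    + lra.
    + unfold h. replace (tau + 0 * (Ci - tau))%C with tau by ring. rewrite E. simpl. lra.
    + unfold h. replace (tau + 1 * (Ci - tau))%C with Ci by ring. replace (phi Ci / phi Ci)%C with (RtoC 1) by (field; exact Ni). simpl. lra.
    + assert (Hw := in_H_convex _ _ t H in_H_Ci Ht). unfold h in Hz.
      destruct (S1 _ Hw) as [K|K]; rewrite K in Hz; simpl in Hz; lra.
Qed.

(** * Comparison with the library notions *)

Lemma Cder_ex_derive f z l : Cder f z l -> @ex_derive C_AbsRing C_NormedModule f z.
Proof.
  intros [phi [H1 [H2 H3]]]. exists l. split; [apply is_linear_scal_l|].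
  intros x Hx. apply (@is_filter_lim_locally_unique C_AbsRing (AbsRing_NormedModule C_AbsRing)) in Hx. subst x.
  intros eps. destruct (H1 eps (cond_pos eps)) as [d1 [Hd1 K1]]. destruct H3 as [d2 [Hd2 K2]].
  exists (mkposreal _ (Rmin_pos _ _ Hd1 Hd2)). intros y Hy.
  assert (Hy' : Cmod (y - z)%C < Rmin d1 d2) by exact Hy.
  change (Cmod ((f y - f z) - (y - z) * l)%C <= eps * Cmod (y - z)%C).
  rewrite K2 by (eapply Rlt_le_trans; [exact Hy'|apply Rmin_r]).
  rewrite <- H2. replace (phi y * (y - z) - (y - z) * phi z)%C with ((phi y - phi z) * (y - z))%C by ring.
  rewrite Cmod_mult. apply Rmult_le_compat_r; [apply Cmod_ge_0|]. left. apply K1.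
  eapply Rlt_le_trans; [exact Hy'|apply Rmin_l].
Qed.

Lemma Ccont_continuous f z : Ccont f z -> @continuous C_UniformSpace C_UniformSpace f z.
Proof.
  intros H. apply filterlim_locally. intros eps. destruct (H eps (cond_pos eps)) as [d [Hd K]].
  (* Balls of the uniform structure are products, comparable with balls of the modulus up to sqrt 2
     <= 2. *)
  assert (Hd2 : 0 < d / 2) by lra. exists (mkposreal _ Hd2). intros y Hy.
  apply C_NormedModule_mixin_compat1. apply K.
  apply (C_NormedModule_mixin_compat2 z y) in Hy. simpl in Hy.
  eapply Rlt_le_trans; [exact Hy|].
  assert (sqrt 2 <= 2); [|nra]. rewrite <- (sqrt_square 2) at 2 by lra. apply sqrt_le_1; lra.
Qed.

(** Order 0 at every point with [f] itself as the unit; the disc of radius [Im z0] around [z0] stays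
    in the upper half-plane. *)
Lemma holomorphic_nz_meromorphic f :
  (forall tau, in_H tau -> f tau <> RtoC 0 /\ exists l, Cder f tau l) -> meromorphic_on_H f.
Proof.
  intros H z0 Hz0. exists 0%Z, f, (Im z0). split; [exact Hz0|]. split; [now apply H|].
  intros z Hz. split.
  - assert (Hz' : in_H z).
    { unfold in_H in *. generalize (im_le_Cmod (z - z0)). intros K. unfold Cminus in K at 1.
      rewrite im_plus, im_opp in K. apply Rabs_le_between in K. lra. }
    destruct (H z Hz') as [_ [l Hl]]. now apply Cder_ex_derive with l.
  - simpl. ring.
Qed.

(** * Power series with leading coefficient one *)

Definition conv (a b : nat -> C) (n : nat) : C := csumn (fun k => a k * b (n - k)%nat)%C (S n).

Lemma csumn_conv u v N : csumn (conv u v) N = csumn (fun k => u k * csumn v (N - k))%C N.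
Proof.
  induction N as [|N IH]; [reflexivity|].
  rewrite csumn_S, IH. unfold conv. rewrite !csumn_S.
  replace (S N - N)%nat with 1%nat by lia. rewrite csumn_1, Nat.sub_diag, Cplus_assoc. f_equal.
  rewrite <- csumn_plus. apply csumn_ext. intros k Hk.
  replace (S N - k)%nat with (S (N - k)) by lia. rewrite csumn_S. ring.
Qed.

(** By [csumn_conv] a partial sum of the Cauchy product is a sum of u_k times a partial sum of v;
    the latter are bounded, so domination by a multiple of |u_k| applies. *)
Lemma Clim_conv u v : summable u -> summable v -> Clim eventually (csumn (conv u v)) (Csum u * Csum v)%C.
Proof.
  intros Hu Hv. set (w := fun k N => if (k <? N)%nat then (u k * csumn v (N - k))%C else 0).
  apply Clim_ext with (fun N => Csum (fun k => w k N)); [apply eventually_filter| |].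
  - intros N. rewrite csumn_conv.
    assert (Z : forall n, w (N + n)%nat N = 0).
    { intros n. unfold w. destruct (Nat.ltb_spec (N + n) N); [lia|reflexivity]. }
    rewrite (Csum_shift _ N).
    + rewrite (Csum_ext (fun n => w (N + n)%nat N) (fun _ => 0) Z), Csum_0, Cplus_0_r.
      apply csumn_ext. intros k Hk. unfold w. destruct (Nat.ltb_spec k N); [reflexivity|lia].
    + apply summable_unshift with N. eapply summable_ext; [intros n; symmetry; apply Z|apply summable_0].
  - rewrite (Cmult_comm (Csum u)), <- Csum_scal by exact Hu.
    set (V := Series (fun n => Cmod (v n))).
    assert (HV : forall n, Cmod (csumn v n) <= V) by (intros n; apply Cmod_csumn_Series; [intros; lra|exact Hv]).
    apply (Csum_dominated eventually w (fun k => Csum v * u k)%C (fun k => V * Cmod (u k))).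
    + apply ex_series_Rscal. exact Hu.
    + apply filter_forall. intros N k. assert (V0 : 0 <= V) by (eapply Rle_trans; [apply Cmod_ge_0|apply (HV 0%nat)]).
      assert (U0 := Cmod_ge_0 (u k)). unfold w. destruct (k <? N)%nat.
      * rewrite Cmod_mult, Rmult_comm. apply Rmult_le_compat_r; [exact U0|apply HV].
      * rewrite Cmod_0. nra.
    + intros k. apply Clim_ext_loc with (fun N => u k * csumn v (N - k))%C; [apply eventually_filter| |].
      * exists (S k). intros N HN. unfold w. destruct (Nat.ltb_spec k N); [reflexivity|lia].
      * apply Clim_eq with (u k * Csum v)%C; [ring|].
        apply Clim_mult; [apply eventually_filter|apply Clim_const, eventually_filter|].
        intros e He. destruct (Csum_lim v Hv e He) as [M HM]. exists (M + k)%nat. intros n Hn. apply HM. lia.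
Qed.

(** The number [R0] bounds the coefficients geometrically and is an inverse radius within which [F]
    is represented. Products and reciprocals only enlarge it by a constant factor. *)
Definition germ (a : nat -> C) (R0 : R) (F : C -> C) : Prop :=
  a 0%nat = 1 /\ 1 <= R0 /\ (forall n, Cmod (a n) <= R0 ^ n) /\
  forall x, Cmod x * R0 < 1 -> F x = Csum (fun n => a n * Cpow x n)%C.

Lemma germ_summable (a : nat -> C) R0 x : 1 <= R0 -> (forall n, Cmod (a n) <= R0 ^ n) -> Cmod x * R0 < 1 ->
  summable (fun n => a n * Cpow x n)%C.
Proof.
  intros HR Ha Hx. assert (P := Cmod_ge_0 x).
  apply summable_le with (fun n => (Cmod x * R0) ^ n); [|apply ex_series_geom_R; nra].
  intros n. rewrite Cmod_mult, Cmod_pow, Rpow_mult_distr, Rmult_comm.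
  apply Rmult_le_compat_l; [now apply pow_le|apply Ha].
Qed.

Lemma germ_mono a R0 R1 F : R0 <= R1 -> germ a R0 F -> germ a R1 F.
Proof.
  intros H [H0 [H1 [H2 H3]]]. split; [exact H0|]. split; [lra|]. split.
  - intros n. eapply Rle_trans; [apply H2|]. apply pow_incr. lra.
  - intros x Hx. apply H3. generalize (Cmod_ge_0 x). nra.
Qed.

Lemma INR_S_le_pow2 n : INR (S n) <= 2 ^ n.
Proof.
  induction n as [|n IH]; [simpl; lra|]. rewrite S_INR. simpl pow.
  assert (1 <= 2 ^ n) by (apply pow_R1_Rle; lra). lra.
Qed.

Lemma Cmod_csumn_const u c n : (forall k, (k < n)%nat -> Cmod (u k) <= c) -> Cmod (csumn u n) <= INR n * c.
Proof.
  induction n as [|n IH]; intros H; [simpl; rewrite Cmod_0; lra|].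
  rewrite csumn_S, S_INR. eapply Rle_trans; [apply Cmod_triangle|].
  generalize (IH (fun k Hk => H k (Nat.lt_lt_succ_r _ _ Hk))) (H n (Nat.lt_succ_diag_r n)). lra.
Qed.

(** The n + 1 terms of the Cauchy product are absorbed by n + 1 <= 2^n. *)
Lemma conv_bound a b R0 n : 1 <= R0 -> (forall n, Cmod (a n) <= R0 ^ n) -> (forall n, Cmod (b n) <= R0 ^ n) ->
  Cmod (conv a b n) <= (2 * R0) ^ n.
Proof.
  intros HR Ha Hb. unfold conv. rewrite Rpow_mult_distr.
  eapply Rle_trans; [apply (Cmod_csumn_const _ (R0 ^ n))|].
  - intros k Hk. rewrite Cmod_mult. replace n with (k + (n - k))%nat at 2 by lia. rewrite pow_add.
    apply Rmult_le_compat; try apply Cmod_ge_0; [apply Ha|apply Hb].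
  - apply Rmult_le_compat_r; [apply pow_le; lra|apply INR_S_le_pow2].
Qed.

Lemma Csum_conv_pow a b R0 x : 1 <= R0 -> (forall n, Cmod (a n) <= R0 ^ n) -> (forall n, Cmod (b n) <= R0 ^ n) ->
  Cmod x * (2 * R0) < 1 ->
  Csum (fun n => conv a b n * Cpow x n)%C = (Csum (fun n => a n * Cpow x n) * Csum (fun n => b n * Cpow x n))%C.
Proof.
  intros HR Ha Hb Hx. assert (P := Cmod_ge_0 x).
  assert (Hx' : Cmod x * R0 < 1) by nra.
  apply Csum_unique.
  - apply germ_summable with (2 * R0); [lra|intros n; now apply conv_bound|exact Hx].
  - eapply Clim_ext; [apply eventually_filter| |apply Clim_conv; apply germ_summable with R0; assumption].
    intros N. apply csumn_ext. intros n _. unfold conv. rewrite Cmult_comm, <- csumn_scal. apply csumn_ext.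
    intros k Hk. replace (Cpow x n) with (Cpow x k * Cpow x (n - k))%C by (rewrite <- Cpow_add_r; f_equal; lia). ring.
Qed.

Lemma germ_mult a b R0 F G : germ a R0 F -> germ b R0 G -> germ (conv a b) (2 * R0) (fun x => F x * G x)%C.
Proof.
  intros [A0 [A1 [A2 A3]]] [B0 [B1 [B2 B3]]]. split; [|split; [lra|split]].
  - unfold conv. rewrite csumn_1. simpl. rewrite A0, B0. ring.
  - intros n. now apply conv_bound.
  - intros x Hx. assert (Hx' : Cmod x * R0 < 1) by (generalize (Cmod_ge_0 x); nra).
    rewrite (A3 x Hx'), (B3 x Hx'). symmetry. now apply Csum_conv_pow with R0.
Qed.

(** Course-of-values recursion made structural: stage [n] holds the coefficients of 1 / F with index
    at most n, so stage [S n] may refer to all of them. *)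
Fixpoint inv_coef_upto (a : nat -> C) (n : nat) (k : nat) : C :=
  match n with
  | O => 1
  | S m => if (k <=? m)%nat then inv_coef_upto a m k
           else (- csumn (fun i => a (S m - i)%nat * inv_coef_upto a m i) (S m))%C
  end.

Definition inv_coef (a : nat -> C) (n : nat) : C := inv_coef_upto a n n.

Lemma inv_coef_upto_eq a n k : (k <= n)%nat -> inv_coef_upto a n k = inv_coef a k.
Proof.
  induction n as [|n IH]; intros Hk.
  - replace k with 0%nat by lia. reflexivity.
  - destruct (Nat.eq_dec k (S n)) as [->|Hne]; [reflexivity|]. simpl.
    destruct (Nat.leb_spec k n); [apply IH; lia|lia].
Qed.

Lemma inv_coef_S a n : inv_coef a (S n) = (- csumn (fun i => a (S n - i)%nat * inv_coef a i) (S n))%C.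
Proof.
  unfold inv_coef at 1.
  change (inv_coef_upto a (S n) (S n)) with (if (S n <=? n)%nat then inv_coef_upto a n (S n)
    else (- csumn (fun i => a (S n - i)%nat * inv_coef_upto a n i) (S n))%C).
  destruct (Nat.leb_spec (S n) n); [lia|]. f_equal.
  apply csumn_ext. intros k Hk. rewrite inv_coef_upto_eq by lia. reflexivity.
Qed.

Lemma conv_inv_coef a n : a 0%nat = RtoC 1 -> conv (inv_coef a) a n = if (n =? 0)%nat then 1 else 0.
Proof.
  intros H. unfold conv. destruct n as [|n].
  - rewrite csumn_1. simpl. rewrite H. unfold inv_coef. simpl. ring.
  - rewrite csumn_S, Nat.sub_diag, H, inv_coef_S. simpl Nat.eqb. cbv iota.
    rewrite (csumn_ext _ (fun i => a (S n - i)%nat * inv_coef a i)%C) by (intros; ring). ring.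
Qed.

(** Doubling closes the induction: the sum over i <= n of R0^(n+1-i) (2 R0)^i is R0^(n+1) (2^(n+1) -
    1). *)
Lemma inv_coef_bound a R0 : 1 <= R0 -> (forall n, Cmod (a n) <= R0 ^ n) -> forall n, Cmod (inv_coef a n) <= (2 * R0) ^ n.
Proof.
  intros HR Ha n. induction n as [n IH] using (well_founded_induction lt_wf).
  destruct n as [|n].
  - unfold inv_coef. simpl. rewrite Cmod_1. lra.
  - rewrite inv_coef_S, Cmod_opp.
    assert (G : forall m, (m <= S n)%nat ->
      Cmod (csumn (fun i => a (S n - i)%nat * inv_coef a i)%C m) <= R0 ^ S n * (2 ^ m - 1)).
    { induction m as [|m IHm]; intros Hm; [simpl; rewrite Cmod_0; lra|].
      rewrite csumn_S. eapply Rle_trans; [apply Cmod_triangle|].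
      assert (K : Cmod (a (S n - m)%nat * inv_coef a m)%C <= R0 ^ S n * 2 ^ m).
      { rewrite Cmod_mult. replace (S n) with ((S n - m) + m)%nat at 2 by lia. rewrite pow_add, Rmult_assoc.
        apply Rmult_le_compat; try apply Cmod_ge_0; [apply Ha|].
        rewrite Rmult_comm, <- Rpow_mult_distr. apply IH. lia. }
      specialize (IHm ltac:(lia)). simpl (2 ^ S m). lra. }
    eapply Rle_trans; [apply G; lia|]. rewrite Rpow_mult_distr.
    assert (0 <= R0 ^ S n) by (apply pow_le; lra). lra.
Qed.

(** The reciprocal has coefficients bounded by (2 R0)^n, and multiplying it back with the original
    series doubles the bound again; hence 4. *)
Lemma germ_inv a R0 F : germ a R0 F -> germ (inv_coef a) (4 * R0) (fun x => / F x)%C.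
Proof.
  intros [A0 [A1 [A2 A3]]].
  assert (B := inv_coef_bound a R0 A1 A2).
  assert (A2' : forall n, Cmod (a n) <= (2 * R0) ^ n).
  { intros n. eapply Rle_trans; [apply A2|]. apply pow_incr. lra. }
  split; [reflexivity|split; [lra|split]].
  - intros n. eapply Rle_trans; [apply B|]. apply pow_incr. lra.
  - intros x Hx. assert (P := Cmod_ge_0 x). rewrite (A3 x) by nra.
    assert (E : (Csum (fun n => inv_coef a n * Cpow x n) * Csum (fun n => a n * Cpow x n) = 1)%C).
    { rewrite <- (Csum_conv_pow (inv_coef a) a (2 * R0)) by (assumption || lra).
      rewrite (Csum_ext _ (fun n => (if (n =? 0)%nat then 1 else 0) * Cpow x n)%C) by (intros; now rewrite conv_inv_coef).
      rewrite Csum_Sl.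
      - rewrite (Csum_ext (fun n => _) (fun _ => 0)), Csum_0; [simpl; ring|]. intros n. simpl. ring.
      - apply summable_unshift with 1%nat. eapply summable_ext; [|apply summable_0]. intros n. simpl. ring. }
    set (X := Csum (fun n => (a n * Cpow x n)%C)) in *.
    assert (NX : X <> 0) by (intros K; rewrite K, Cmult_0_r in E; apply C1_nz; now symmetry).
    replace (/ X)%C with (/ X * (Csum (fun n => inv_coef a n * Cpow x n) * X))%C by (rewrite E; ring).
    field. exact NX.
Qed.

Lemma germ_1 : germ (fun n => if (n =? 0)%nat then 1 else 0) 1 (fun _ => 1).
Proof.
  split; [reflexivity|split; [lra|split]].
  - intros [|n]; simpl; rewrite ?Cmod_1, ?Cmod_0; [lra|]. apply Rmult_le_pos; [lra|apply pow_le; lra].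
  - intros x _. rewrite Csum_Sl.
    + rewrite (Csum_ext (fun n => _) (fun _ => 0)), Csum_0; [simpl; ring|]. intros n. simpl. ring.
    + apply summable_unshift with 1%nat. eapply summable_ext; [|apply summable_0]. intros n. simpl. ring.
Qed.

(** * The Euler product as a power series *)

Definition euler_prod (q : C) : C := Cexp (- lambert q)%C.

(* The coefficient of x^k in prod_(i = 1)^n (1 - zeta^i x^(m i)). *)
Fixpoint euler_coef (zeta : C) (m n k : nat) : C :=
  match n with
  | O => if (k =? 0)%nat then 1 else 0
  | S n' => (euler_coef zeta m n' k -
      (if (m * S n' <=? k)%nat then Cpow zeta (S n') * euler_coef zeta m n' (k - m * S n') else 0))%C
  end.

Lemma euler_coef_S zeta m n k : euler_coef zeta m (S n) k = (euler_coef zeta m n k -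
  (if (m * S n <=? k)%nat then Cpow zeta (S n) * euler_coef zeta m n (k - m * S n) else 0))%C.
Proof. reflexivity. Qed.

(** A factor of index above k involves only powers of x above k. The diagonal value
    [euler_coef zeta m k k] is thus the coefficient of the infinite product. *)
Lemma euler_coef_stable zeta m n k : (0 < m)%nat -> (k <= n)%nat -> euler_coef zeta m n k = euler_coef zeta m k k.
Proof.
  intros Hm. induction n as [|n IH]; intros Hk.
  - replace k with 0%nat by lia. reflexivity.
  - destruct (Nat.eq_dec k (S n)) as [->|Hne]; [reflexivity|]. rewrite euler_coef_S, IH by lia. destruct (Nat.leb_spec (m * S n) k); [nia|]. ring.
Qed.

(** In the scale 2^k, the factor of index i multiplies the bound by 1 + 2^(-i) <= exp(2^(-i)); the
    exponents add up to 1 - 2^(-n). The result is uniform in n, since exp 1 <= 3. *)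
Lemma euler_coef_bound zeta m n k : (0 < m)%nat -> Cmod zeta = 1 ->
  Cmod (euler_coef zeta m n k) <= exp (1 - (/ 2) ^ n) * 2 ^ k.
Proof.
  intros Hm Hz. revert k. induction n as [|n IH]; intros k.
  - simpl. rewrite Rminus_diag, exp_0, Rmult_1_l.
    destruct (k =? 0)%nat; rewrite ?Cmod_1, ?Cmod_0; [apply pow_R1_Rle; lra|apply pow_le; lra].
  - rewrite euler_coef_S. eapply Rle_trans; [apply Cmod_sub_le|].
    set (En := exp (1 - (/ 2) ^ n)) in *. assert (PE : 0 < En) by apply exp_pos.
    assert (P2 : 0 < 2 ^ k) by (apply pow_lt; lra). assert (Ph : 0 < (/ 2) ^ S n) by (apply pow_lt; lra).
    assert (K : Cmod (if (m * S n <=? k)%nat then (Cpow zeta (S n) * euler_coef zeta m n (k - m * S n))%C else 0)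
      <= En * 2 ^ k * (/ 2) ^ S n).
    { destruct (Nat.leb_spec (m * S n) k) as [h|h].
      - rewrite Cmod_mult, Cmod_pow, Hz, pow1, Rmult_1_l. eapply Rle_trans; [apply IH|].
        rewrite Rmult_assoc. apply Rmult_le_compat_l; [lra|].
        apply Rle_trans with (2 ^ (k - S n)); [apply Rle_pow; [lra|nia]|].
        rewrite pow_inv. replace k with ((k - S n) + S n)%nat at 2 by nia.
        rewrite pow_add. right. field. apply pow_nonzero. lra.
      - rewrite Cmod_0. apply Rmult_le_pos; nra. }
    apply Rle_trans with (En * 2 ^ k * (1 + (/ 2) ^ S n)).
    { rewrite Rmult_plus_distr_l, Rmult_1_r. apply Rplus_le_compat; [apply IH|exact K]. }
    replace (1 - (/ 2) ^ S n) with ((1 - (/ 2) ^ n) + (/ 2) ^ S n) by (simpl; field).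
    rewrite exp_plus. fold En. replace (En * exp ((/ 2) ^ S n) * 2 ^ k) with (En * 2 ^ k * exp ((/ 2) ^ S n)) by ring.
    apply Rmult_le_compat_l; [nra|]. apply exp_ineq1_le.
Qed.

Lemma euler_coef_bound3 zeta m n k : (0 < m)%nat -> Cmod zeta = 1 -> Cmod (euler_coef zeta m n k) <= 3 * 2 ^ k.
Proof.
  intros Hm Hz. eapply Rle_trans; [now apply euler_coef_bound|].
  apply Rmult_le_compat_r; [apply pow_le; lra|]. apply Rle_trans with (exp 1); [|apply exp_le_3].
  assert (0 < (/ 2) ^ n) by (apply pow_lt; lra). left. apply exp_increasing. lra.
Qed.

Lemma euler_coef_dominated zeta m n x k : (0 < m)%nat -> Cmod zeta = 1 ->
  Cmod (euler_coef zeta m n k * Cpow x k)%C <= 3 * (2 * Cmod x) ^ k.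
Proof.
  intros Hm Hz. rewrite Cmod_mult, Cmod_pow, Rpow_mult_distr, <- Rmult_assoc.
  apply Rmult_le_compat_r; [apply pow_le, Cmod_ge_0|now apply euler_coef_bound3].
Qed.

Lemma euler_partial_series zeta m n x : (0 < m)%nat -> Cmod zeta = 1 -> Cmod x < 1 / 2 ->
  Csum (fun k => euler_coef zeta m n k * Cpow x k)%C = euler_partial (zeta * Cpow x m)%C n.
Proof.
  intros Hm Hz Hx. assert (P := Cmod_ge_0 x).
  assert (HS : forall n, summable (fun k => euler_coef zeta m n k * Cpow x k)%C).
  { intros n'. apply summable_le with (fun k => 3 * (2 * Cmod x) ^ k).
    - intros k. now apply euler_coef_dominated.
    - apply ex_series_Rscal, ex_series_geom_R. lra. }
  induction n as [|n IH].
  - destruct germ_1 as [_ [_ [_ G]]]. symmetry. apply G. lra.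
  - rewrite euler_partial_S, <- IH.
    set (s := (m * S n)%nat).
    set (sh := fun k => ((if (s <=? k)%nat then Cpow zeta (S n) * euler_coef zeta m n (k - s) else 0) * Cpow x k)%C).
    assert (E : forall k, sh (s + k)%nat = (Cpow zeta (S n) * Cpow x s * (euler_coef zeta m n k * Cpow x k))%C).
    { intros k. unfold sh. destruct (Nat.leb_spec s (s + k)); [|lia].
      replace (s + k - s)%nat with k by lia. rewrite Cpow_add_r. ring. }
    assert (Ssh : summable sh).
    { apply summable_unshift with s. eapply summable_ext; [intros k; symmetry; apply E|now apply summable_scal]. }
    rewrite (Csum_ext _ (fun k => euler_coef zeta m n k * Cpow x k - sh k)%C).
    + rewrite Csum_minus by (assumption || apply HS). rewrite (Csum_shift sh s Ssh), (Csum_ext _ _ E), Csum_scal by apply HS.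
      rewrite csumn_0.
      * rewrite Cpow_mult_l, <- Cpow_mult_r. fold s. ring.
      * intros k Hk. unfold sh. destruct (Nat.leb_spec s k); [lia|]. ring.
    + intros k. unfold sh. rewrite euler_coef_S. fold s. ring.
Qed.

Lemma germ_euler zeta m : (0 < m)%nat -> Cmod zeta = 1 ->
  germ (fun k => euler_coef zeta m k k) 6 (fun x => euler_prod (zeta * Cpow x m)).
Proof.
  intros Hm Hz. split; [reflexivity|split; [lra|split]].
  (* The bound 3 * 2^k is at most 6^k only from k = 1 on; the coefficient of index 0 is 1. *)
  - intros [|n]; [simpl; rewrite Cmod_1; lra|].
    eapply Rle_trans; [now apply euler_coef_bound3|].
    replace 6 with (3 * 2) by ring. rewrite Rpow_mult_distr. apply Rmult_le_compat_r; [apply pow_le; lra|].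
    simpl. assert (1 <= 3 ^ n) by (apply pow_R1_Rle; lra). lra.
  - intros x Hx. assert (P := Cmod_ge_0 x). assert (Hx2 : Cmod x < 1 / 2) by lra.
    assert (Hq : Cmod (zeta * Cpow x m)%C < 1).
    { rewrite Cmod_mult, Hz, Rmult_1_l. destruct m as [|m]; [lia|]. apply Cmod_pow_lt_1. lra. }
    apply (Clim_unique eventually (euler_partial (zeta * Cpow x m)%C)).
    + now apply euler_partial_lim.
    + apply Clim_ext with (fun n => Csum (fun k => euler_coef zeta m n k * Cpow x k)%C);
        [apply eventually_filter|intros n; now apply euler_partial_series|].
      apply (Csum_dominated eventually (fun k n => euler_coef zeta m n k * Cpow x k)%C
        (fun k => euler_coef zeta m k k * Cpow x k)%C (fun k => 3 * (2 * Cmod x) ^ k)).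
      * apply ex_series_Rscal, ex_series_geom_R. lra.
      * apply filter_forall. intros n k. now apply euler_coef_dominated.
      * intros k. apply Clim_ext_loc with (fun _ => euler_coef zeta m k k * Cpow x k)%C;
          [apply eventually_filter| |apply Clim_const, eventually_filter].
        exists k. intros n Hn. now rewrite (euler_coef_stable zeta m n k).
Qed.

(** * Power series with coefficients in a subring *)

(** One development for two uses: the integers ([Cint]) for the expansion at i oo, and all complex
    numbers ([Ctrue]) at an arbitrary cusp, where roots of unity occur. *)
Section CoefficientRing.
Variable I : C -> Prop.
Hypothesis I0 : I 0.
Hypothesis I1 : I 1.
Hypothesis Iadd : forall x y, I x -> I y -> I (x + y)%C.
Hypothesis Iopp : forall x, I x -> I (- x)%C.
Hypothesis Imul : forall x y, I x -> I y -> I (x * y)%C.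

Definition germ_over (F : C -> C) : Prop :=
  exists a R0, germ a R0 F /\ forall n, I (a n).

Lemma csumn_in u n : (forall k, (k < n)%nat -> I (u k)) -> I (csumn u n).
Proof.
  induction n as [|n IH]; intros H; [exact I0|]. simpl. apply Iadd; [apply IH; intros; apply H; lia|apply H; lia].
Qed.

Lemma germ_over_ext F G : (forall x, F x = G x) -> germ_over F -> germ_over G.
Proof.
  intros E [a [R0 [[H0 [H1 [H2 H3]]] H4]]]. exists a, R0. split; [|exact H4].
  split; [exact H0|split; [exact H1|split; [exact H2|]]]. intros x Hx. rewrite <- E. now apply H3.
Qed.

Lemma germ_over_1 : germ_over (fun _ => 1).
Proof. eexists _, _. split; [apply germ_1|]. intros n. cbv beta. destruct (n =? 0)%nat; assumption. Qed.

Lemma germ_over_mult F G : germ_over F -> germ_over G -> germ_over (fun x => F x * G x)%C.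
Proof.
  intros [a [R0 [H1 H2]]] [b [R1 [K1 K2]]]. exists (conv a b), (2 * Rmax R0 R1). split.
  - apply germ_mult; [apply germ_mono with R0; [apply Rmax_l|exact H1]|apply germ_mono with R1; [apply Rmax_r|exact K1]].
  - intros n. unfold conv. apply csumn_in. intros; apply Imul; auto.
Qed.

(** The leading coefficient 1 is what keeps the reciprocal in the subring: its recursion involves no
    division. *)
Lemma germ_over_inv F : germ_over F -> germ_over (fun x => / F x)%C.
Proof.
  intros [a [R0 [H1 H2]]]. exists (inv_coef a), (4 * R0). split; [now apply germ_inv|].
  intros n. induction n as [n IH] using (well_founded_induction lt_wf). destruct n as [|n].
  - exact I1.
  - rewrite inv_coef_S. apply Iopp, csumn_in. intros k Hk. apply Imul; auto.
Qed.

Lemma germ_over_powz F n : germ_over F -> germ_over (fun x => Cpowz (F x) n).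
Proof.
  intros H. assert (P : forall k, germ_over (fun x => Cpow (F x) k)).
  { induction k as [|k IH]; [apply germ_over_1|]. apply (germ_over_mult F (fun x => Cpow (F x) k)); assumption. }
  destruct (Z_nat_cases n) as [k [-> | ->]].
  - apply germ_over_ext with (2 := P k). intros x. now rewrite Cpowz_of_nat.
  - apply germ_over_ext with (2 := germ_over_inv _ (P k)). intros x. now rewrite Cpowz_opp_of_nat.
Qed.

Lemma germ_over_euler zeta m : I zeta -> (0 < m)%nat -> Cmod zeta = 1 ->
  germ_over (fun x => euler_prod (zeta * Cpow x m)).
Proof.
  intros Iz Hm Hz. eexists _, _. split; [now apply germ_euler|].
  assert (Ip : forall n, I (Cpow zeta n)) by (induction n; simpl; auto).
  assert (G : forall n k, I (euler_coef zeta m n k)).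
  { induction n as [|n IH]; intros k; [simpl|rewrite euler_coef_S].
    - destruct (k =? 0)%nat; assumption.
    - apply Iadd; [apply IH|]. apply Iopp. destruct (m * S n <=? k)%nat; [|exact I0]. apply Imul; auto. }
  intros n. apply G.
Qed.
End CoefficientRing.

Definition Cint (z : C) : Prop := exists k : Z, z = IZR k.

Lemma Cint_0 : Cint 0. Proof. now exists 0%Z. Qed.
Lemma Cint_1 : Cint 1. Proof. now exists 1%Z. Qed.
Lemma Cint_add x y : Cint x -> Cint y -> Cint (x + y)%C.
Proof. intros [k ->] [l ->]. exists (k + l)%Z. now rewrite plus_IZR, RtoC_plus. Qed.
Lemma Cint_opp x : Cint x -> Cint (- x)%C.
Proof. intros [k ->]. exists (- k)%Z. now rewrite opp_IZR, RtoC_opp. Qed.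
Lemma Cint_mul x y : Cint x -> Cint y -> Cint (x * y)%C.
Proof. intros [k ->] [l ->]. exists (k * l)%Z. now rewrite mult_IZR, RtoC_mult. Qed.

Lemma germ_has_expansion (H F : C -> C) (W : nat) (rho : R) (k : C) a R0 : (0 < W)%nat -> germ a R0 F ->
  (forall tau, in_H tau -> H tau = (k * Ce (RtoC (rho / INR W) * tau) * F (Ce (RtoC (/ INR W) * tau)))%C) ->
  has_expansion H W rho (fun n => k * a n)%C.
Proof.
  intros HW [H0 [H1 [H2 H3]]] E. assert (PW : 0 < INR W) by now apply lt_0_INR.
  (* Above this height s = 2 pi Im tau / W exceeds R0, and exp s > s > R0 puts e(tau / W) inside the
     domain of the germ. *)
  exists (INR W * R0). intros tau Ht. assert (PP := PI_RGT_0). assert (P2 := PI2_1).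
  assert (Hin : in_H tau) by (unfold in_H; nra).
  assert (Hx : Cmod (Ce (RtoC (/ INR W) * tau)) * R0 < 1).
  { rewrite Cmod_Ce, im_scal_l. set (s := 2 * PI * (/ INR W * Im tau)).
    assert (Hs : R0 < s).
    { unfold s. apply Rlt_le_trans with (1 * (/ INR W * Im tau)).
      - rewrite Rmult_1_l. apply Rmult_lt_reg_l with (INR W); [exact PW|].
        rewrite <- Rmult_assoc, Rinv_r by lra. lra.
      - apply Rmult_le_compat_r; [|lra]. apply Rmult_le_pos; [left; now apply Rinv_0_lt_compat|unfold in_H in Hin; lra]. }
    rewrite exp_Ropp. generalize (exp_ineq1_le s). intros K.
    apply Rmult_lt_reg_l with (exp s); [apply exp_pos|]. rewrite <- Rmult_assoc, Rinv_r; [lra|].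
    generalize (exp_pos s); lra. }
  rewrite E by exact Hin. rewrite H3 by exact Hx.
  assert (Sx := germ_summable a R0 _ H1 H2 Hx).
  rewrite <- Csum_scal by exact Sx.
  apply (is_series_ext (fun n => (k * Ce (RtoC (rho / INR W) * tau) * (a n * Cpow (Ce (RtoC (/ INR W) * tau)) n))%C)).
  - intros n. rewrite <- Ce_pow.
    replace (RtoC ((INR n + rho) / INR W) * tau)%C with (RtoC (rho / INR W) * tau + INR n * (RtoC (/ INR W) * tau))%C.
    + rewrite Ce_add. match goal with |- @eq _ ?u ?v => change (@eq C u v) end. ring.
    + unfold Rdiv. rewrite !RtoC_mult, RtoC_plus. ring.
  - apply Csum_is_series. now apply summable_scal.
Qed.

(** * Eta quotients as modular forms *)

(** [eta_quotient] over an arbitrary list in place of [divisors N], which opens the way to induction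
    on the list; the two are convertible for that list. *)
Definition etaq (l : list nat) (r : nat -> Z) (tau : C) : C :=
  Cprod (map (fun d => Cpowz (eta (INR d * tau)%C) (r d)) l).

Definition log_etaq (l : list nat) (r : nat -> Z) (tau : C) : C :=
  fold_right Cplus (RtoC 0) (map (fun d => IZR (r d) * log_eta (INR d * tau))%C l).

Definition all_pos (l : list nat) : Prop := forall d, In d l -> (0 < d)%nat.

Lemma all_pos_cons d l : all_pos (d :: l) -> (0 < d)%nat /\ all_pos l.
Proof. intros H. split; [apply H; now left|]. intros e He. apply H. now right. Qed.

Lemma In_divisors d N : In d (divisors N) -> (0 < d)%nat /\ Nat.divide d N.
Proof.
  unfold divisors. rewrite filter_In, in_seq, Nat.eqb_eq. intros [H1 H2]. split; [lia|].
  apply Nat.mod_divide; [lia|exact H2].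
Qed.

Lemma divisors_pos N : all_pos (divisors N).
Proof. intros d H. now apply In_divisors in H. Qed.

Lemma in_H_scal_pos d tau : (0 < d)%nat -> in_H tau -> in_H (INR d * tau)%C.
Proof. intros Hd H. destruct d as [|d]; [lia|]. now apply in_H_scal. Qed.

Lemma etaq_exp l r tau : all_pos l -> in_H tau -> etaq l r tau = Cexp (log_etaq l r tau).
Proof.
  intros Hl H. induction l as [|d l IH].
  - symmetry. apply Cexp_0.
  - apply all_pos_cons in Hl. destruct Hl as [Hd Hl]. unfold etaq, log_etaq in *. simpl.
    rewrite Cexp_add, <- IH by exact Hl. f_equal.
    rewrite eta_exp by now apply in_H_scal_pos. apply Cpowz_Cexp.
Qed.

Lemma etaq_nz l r tau : all_pos l -> in_H tau -> etaq l r tau <> 0.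
Proof. intros Hl H. rewrite etaq_exp by assumption. apply Cexp_nz. Qed.

Lemma Cder_log_etaq l r tau : all_pos l -> in_H tau -> exists m, Cder (log_etaq l r) tau m.
Proof.
  intros Hl H. induction l as [|d l IH].
  - exists (RtoC 0). apply (Cder_const (RtoC 0) tau).
  - apply all_pos_cons in Hl. destruct Hl as [Hd Hl]. destruct (IH Hl) as [m Hm].
    eexists. unfold log_etaq. simpl.
    apply (Cder_plus (fun w => IZR (r d) * log_eta (INR d * w))%C (log_etaq l r)); [|exact Hm].
    apply Cder_scal. apply (Cder_comp log_eta (fun w => INR d * w)%C).
    + apply Cder_scal, Cder_id.
    + apply Cder_log_eta. now apply in_H_scal_pos.
Qed.

Lemma nbh_in_H tau : in_H tau -> nbh tau in_H.
Proof.
  intros H. generalize (in_H_nbh _ H). apply filter_imp. unfold in_H in *. intros w Hw. lra.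
Qed.

Lemma Cder_etaq l r tau : all_pos l -> in_H tau -> exists m, Cder (etaq l r) tau m.
Proof.
  intros Hl H. destruct (Cder_log_etaq l r tau Hl H) as [m Hm]. eexists.
  apply Cder_ext_loc with (2 := Cder_Cexp_comp _ _ _ Hm).
  generalize (nbh_in_H _ H). apply filter_imp. intros w Hw. symmetry. now apply etaq_exp.
Qed.

Lemma Ccont_etaq l r tau : all_pos l -> in_H tau -> Ccont (etaq l r) tau.
Proof. intros Hl H. destruct (Cder_etaq l r tau Hl H) as [m Hm]. now apply Cder_cont in Hm. Qed.

Lemma Ccont_eta tau : in_H tau -> Ccont eta tau.
Proof.
  intros H. apply Cder_cont with (Cexp (log_eta tau) * (tpi * (/ RtoC 24 - psi_sum tau)))%C.
  apply Cder_ext_loc with (2 := Cder_Cexp_comp _ _ _ (Cder_log_eta _ H)).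
  generalize (nbh_in_H _ H). apply filter_imp. intros w Hw. symmetry. now apply eta_exp.
Qed.

Lemma etaq_meromorphic l r : all_pos l -> meromorphic_on_H (etaq l r).
Proof.
  intros Hl. apply holomorphic_nz_meromorphic. intros tau H. split; [now apply etaq_nz|now apply Cder_etaq].
Qed.

Lemma INR_IZR d : INR d = IZR (Z.of_nat d).
Proof. now rewrite INR_IZR_INZ. Qed.

(** Conjugation by diag(d, 1): d g(tau) = g'(d tau) with g' = (a, b d; c / d, e), integral since d
    divides c, and g' at d tau has the same denominator as g at tau. *)
Lemma eta_sqr_level g d : (0 < d)%nat -> Gamma0 d g -> exists chi, Cmod chi = 1 /\
  forall tau, in_H tau ->
    (eta (INR d * mob g tau) * eta (INR d * mob g tau) =
     chi * mob_denom g tau * (eta (INR d * tau) * eta (INR d * tau)))%C.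
Proof.
  intros Hd [Hs [c' Hc]]. destruct g as [a b c e]. simpl in Hc. subst c.
  set (g' := Mat2 a (b * Z.of_nat d) c' e).
  assert (Hg' : SL2Z g') by (unfold SL2Z, mdet in *; simpl in *; lia).
  destruct (eta_sqr_transform g' Hg') as [chi [H1 H2]]. exists chi. split; [exact H1|].
  intros tau H. specialize (H2 (INR d * tau)%C (in_H_scal_pos _ _ Hd H)).
  assert (Ed : mob_denom g' (INR d * tau) = mob_denom (Mat2 a b (c' * Z.of_nat d) e) tau).
  { unfold mob_denom, g'. simpl. rewrite mult_IZR, RtoC_mult, INR_IZR. ring. }
  assert (Em : mob g' (INR d * tau) = (INR d * mob (Mat2 a b (c' * Z.of_nat d) e) tau)%C).
  { unfold mob. rewrite Ed. unfold g'. simpl. rewrite mult_IZR, RtoC_mult, INR_IZR. unfold Cdiv. ring. }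
  rewrite Em, Ed in H2. exact H2.
Qed.

Lemma etaq_sqr_Gamma0 N g l r : (forall d, In d l -> (0 < d)%nat /\ Nat.divide d N) -> Gamma0 N g ->
  exists X, Cmod X = 1 /\ forall tau, in_H tau ->
    (etaq l r (mob g tau) * etaq l r (mob g tau) =
     X * Cpowz (mob_denom g tau) (Zsum (map r l)) * (etaq l r tau * etaq l r tau))%C.
Proof.
  intros Hl [Hs Hc]. assert (Hdet : (0 < mdet g)%Z) by (rewrite Hs; lia).
  induction l as [|d l IH].
  - exists (RtoC 1). split; [apply Cmod_1|]. intros tau H. unfold etaq. simpl. ring.
  - destruct (Hl d (or_introl eq_refl)) as [Hd HdN].
    destruct IH as [X [X1 X2]]; [intros e He; apply Hl; now right|].
    assert (Gd : Gamma0 d g).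
    { split; [exact Hs|]. apply Z.divide_trans with (Z.of_nat N); [|exact Hc].
      destruct HdN as [k ->]. exists (Z.of_nat k). apply Nat2Z.inj_mul. }
    destruct (eta_sqr_level g d Hd Gd) as [chi [C1 C2]].
    exists (Cpowz chi (r d) * X)%C. split.
    + rewrite Cmod_mult, X1, Cmod_Cpowz by exact C1. ring.
    + intros tau H. assert (N1 := mob_denom_nz g tau Hdet H).
      assert (Nchi : chi <> 0) by (apply Cmod_nz; lra).
      assert (Hm := mob_in_H g tau Hdet H).
      assert (E1 := eta_nz _ (in_H_scal_pos _ _ Hd Hm)). assert (E2 := eta_nz _ (in_H_scal_pos _ _ Hd H)).
      specialize (X2 tau H). specialize (C2 tau H). unfold etaq in *. simpl.
      set (P := Cprod (map (fun d0 => Cpowz (eta (INR d0 * mob g tau)%C) (r d0)) l)) in *.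
      set (Q := Cprod (map (fun d0 => Cpowz (eta (INR d0 * tau)%C) (r d0)) l)) in *.
      transitivity (Cpowz (eta (INR d * mob g tau) * eta (INR d * mob g tau))%C (r d) * (P * P))%C.
      * rewrite Cpowz_mult_l by assumption. ring.
      * rewrite X2, C2, !Cpowz_mult_l, Cpowz_add by (repeat (assumption || apply Cmult_neq_0)). ring.
Qed.

(** The quotient [phi] of the two sides has square X by the squared law and is continuous; hence it
    is constant, and its value at i, of modulus 1, is the multiplier. *)
Lemma etaq_Gamma0 N g l r : (forall d, In d l -> (0 < d)%nat /\ Nat.divide d N) -> Gamma0 N g ->
  exists chi, Cmod chi = 1 /\ forall tau, in_H tau ->
    etaq l r (mob g tau) = (chi * Cpow_half (mob_denom g tau) (Zsum (map r l)) * etaq l r tau)%C.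
Proof.
  intros Hl Hg. assert (Hp : all_pos l) by (intros d Hd; now apply Hl).
  destruct (etaq_sqr_Gamma0 N g l r Hl Hg) as [X [X1 X2]]. destruct Hg as [Hs _].
  assert (Hdet : (0 < mdet g)%Z) by (rewrite Hs; lia).
  set (w := Zsum (map r l)) in *.
  set (phi := fun tau => (etaq l r (mob g tau) / (Cpow_half (mob_denom g tau) w * etaq l r tau))%C).
  assert (ND : forall tau, in_H tau -> (Cpow_half (mob_denom g tau) w * etaq l r tau)%C <> 0).
  { intros tau H. apply Cmult_neq_0; [now apply Cpow_half_nz, mob_denom_nz|now apply etaq_nz]. }
  assert (S1 : forall tau, in_H tau -> (phi tau * phi tau = X)%C).
  { intros tau H. unfold phi. specialize (X2 tau H). specialize (ND tau H).
    assert (N1 := mob_denom_nz g tau Hdet H). assert (N2 := etaq_nz l r tau Hp H).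
    assert (N3 := Cpow_half_nz _ w N1). assert (K := Cpow_half_sqr _ w N1).
    transitivity ((etaq l r (mob g tau) * etaq l r (mob g tau)) /
      ((Cpow_half (mob_denom g tau) w * Cpow_half (mob_denom g tau) w) * (etaq l r tau * etaq l r tau)))%C.
    - field. split; assumption.
    - rewrite X2, K. assert (N4 := Cpowz_nz _ w N1). field. split; assumption. }
  assert (NX : X <> 0) by (apply Cmod_nz; lra).
  assert (Cst := Ccont_sqr_const phi X NX).
  exists (phi Ci). split.
  - assert (E := S1 Ci in_H_Ci). assert (K : Cmod (phi Ci) * Cmod (phi Ci) = 1) by (rewrite <- Cmod_mult, E; exact X1).
    generalize (Cmod_ge_0 (phi Ci)). intros. nra.
  - intros tau H. rewrite <- (Cst (fun t Ht => ltac:(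
      apply Clim_div; [apply nbh_filter|now apply ND| |apply Clim_mult; [apply nbh_filter|now apply Ccont_Cpow_half_denom|now apply Ccont_etaq]];
      apply (Ccont_comp (etaq l r) (mob g)); [now apply Ccont_mob|apply Ccont_etaq; [exact Hp|now apply mob_in_H]])) S1 tau H).
    unfold phi. specialize (ND tau H). field. split.
    + intros K. apply ND. rewrite K. ring.
    + intros K. apply ND. rewrite K. ring.
Qed.

(** * Expansions at the cusps *)

(** Hermite normal form: diag(d, 1) g = g' (A, B; 0, D) with g' in SL2(Z). The first column of g' is
    (d a, c) divided by its gcd A, completed by Bezout coefficients. The transformation under g' is
    known, which leaves an upper triangular substitution with a visible expansion. *)
Lemma cusp_decomposition g d : (0 < d)%nat -> SL2Z g ->
  exists (A B D : Z) (K : C), (0 < A)%Z /\ (0 < D)%Z /\ (A * D = Z.of_nat d)%Z /\ K <> 0 /\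
    forall tau, in_H tau ->
      in_H ((IZR A * tau + IZR B) / IZR D)%C /\
      (eta (INR d * mob g tau) * eta (INR d * mob g tau) = K * mob_denom g tau *
       (eta ((IZR A * tau + IZR B) / IZR D) * eta ((IZR A * tau + IZR B) / IZR D)))%C.
Proof.
  intros Hd Hs. destruct g as [a b c e]. unfold SL2Z, mdet in Hs. simpl in Hs.
  set (n := Z.of_nat d). assert (Hn : (0 < n)%Z) by (unfold n; lia).
  set (G := Z.gcd (n * a) c).
  assert (G0 : (0 < G)%Z).
  { assert (0 <= G)%Z by apply Z.gcd_nonneg. assert (G <> 0)%Z; [|lia].
    intros E. apply Z.gcd_eq_0 in E. destruct E as [E1 E2]. subst c. apply Z.mul_eq_0 in E1. destruct E1 as [E1|E1]; [lia|]. subst a. lia. }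
  destruct (Z.gcd_divide_l (n * a) c) as [a' Ha']. destruct (Z.gcd_divide_r (n * a) c) as [c' Hc'].
  fold G in Ha', Hc'.
  destruct (Z.gcd_bezout (n * a) c G eq_refl) as [u [v Huv]].
  assert (Hb : (u * a' + v * c' = 1)%Z).
  { apply (Z.mul_cancel_r _ _ G); [lia|].
    replace ((u * a' + v * c') * G)%Z with (u * (a' * G) + v * (c' * G))%Z by ring.
    rewrite <- Ha', <- Hc', Huv. ring. }
  set (g' := Mat2 a' (- v) c' u).
  assert (Hg' : SL2Z g') by (unfold SL2Z, mdet, g'; simpl; lia).
  set (B := (u * (n * b) + v * e)%Z). set (D := (a' * e - c' * (n * b))%Z).
  assert (HGD : (G * D = n)%Z).
  { unfold D. replace (G * (a' * e - c' * (n * b)))%Z with ((a' * G) * e - (c' * G) * (n * b))%Z by ring.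
    rewrite <- Ha', <- Hc'. replace (n * a * e - c * (n * b))%Z with (n * (a * e - b * c))%Z by ring. rewrite Hs. ring. }
  assert (D0 : (0 < D)%Z) by nia.
  destruct (eta_sqr_transform g' Hg') as [chi [H1 H2]].
  assert (ND : RtoC (IZR D) <> 0) by (apply RtoC_nz, not_0_IZR; lia).
  (* The denominator of g' at the new point, times D, is that of the given matrix at tau; hence the
     division by [IZR D]. *)
  exists G, B, D, (chi / IZR D)%C. repeat split; try assumption.
  - apply Cmult_neq_0; [apply Cmod_nz; lra|now apply Cinv_nz].
  - assert (E := mob_in_H (Mat2 G B 0 D) tau). unfold mob, mob_denom in E. simpl in E.
    replace (0 * tau + IZR D)%C with (RtoC (IZR D)) in E by ring. apply E; [unfold mdet; simpl; lia|exact H].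
  - set (s := ((IZR G * tau + IZR B) / IZR D)%C).
    assert (Hsig : in_H s).
    { assert (E := mob_in_H (Mat2 G B 0 D) tau). unfold mob, mob_denom in E. simpl in E.
      replace (0 * tau + IZR D)%C with (RtoC (IZR D)) in E by ring. apply E; [unfold mdet; simpl; lia|exact H]. }
    assert (Eden : (mob_denom g' s * IZR D = mob_denom (Mat2 a b c e) tau)%C).
    { unfold mob_denom, g', s. simpl.
      transitivity (IZR (c' * G) * tau + IZR (c' * B + u * D))%C.
      - rewrite plus_IZR, !mult_IZR, RtoC_plus, !RtoC_mult. field. exact ND.
      - rewrite <- Hc'. do 3 f_equal. unfold B, D.
        replace (c' * (u * (n * b) + v * e) + u * (a' * e - c' * (n * b)))%Z with ((u * a' + v * c') * e)%Z by ring.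
        rewrite Hb. ring. }
    assert (Hdet : (0 < mdet (Mat2 a b c e))%Z) by (unfold mdet; simpl; lia).
    assert (Nden := mob_denom_nz _ _ Hdet H).
    assert (Hdet' : (0 < mdet g')%Z) by (rewrite Hg'; lia).
    assert (Nden' := mob_denom_nz _ _ Hdet' Hsig).
    assert (Em : (INR d * mob (Mat2 a b c e) tau)%C = mob g' s).
    { unfold mob. rewrite <- Eden.
      transitivity ((INR d * (IZR a * tau + IZR b)) / (mob_denom g' s * IZR D))%C.
      { simpl. field. split; assumption. }
      transitivity (((IZR a' * s + IZR (- v)) * IZR D) / (mob_denom g' s * IZR D))%C;
        [|simpl; field; split; assumption].
      f_equal. unfold s.
      transitivity (IZR (a' * G) * tau + IZR (a' * B - v * D))%C.
      - rewrite <- Ha'. replace (a' * B - v * D)%Z with (n * b)%Z.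
        + unfold n. rewrite !mult_IZR, !RtoC_mult, INR_IZR. ring.
        + unfold B, D. transitivity ((u * a' + v * c') * (n * b))%Z; [rewrite Hb; ring|ring].
      - rewrite minus_IZR, opp_IZR, !mult_IZR, RtoC_minus, RtoC_opp, !RtoC_mult. field. exact ND. }
    rewrite Em, (H2 s Hsig), <- Eden. field. exact ND.
Qed.

Lemma eta_euler tau : in_H tau -> eta tau = (Ce (tau / RtoC 24) * euler_prod (Ce tau))%C.
Proof. intros H. rewrite eta_exp by exact H. unfold log_eta, Cminus. rewrite Cexp_add. reflexivity. Qed.

Definition Ctrue (_ : C) : Prop := True.

(* h is the product of the functions eta((A tau + B) / D)^(r d) of cusp_decomposition. *)
Lemma etaq_cusp N g l r : (0 < N)%nat -> (forall d, In d l -> (0 < d)%nat /\ Nat.divide d N) -> SL2Z g ->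
  exists (K : C) (h : C -> C) (k : C) (rho : R) (F : C -> C), K <> 0 /\ germ_over Ctrue F /\
   forall tau, in_H tau -> h tau <> 0 /\ Ccont h tau /\
    h tau = (k * Ce (RtoC rho * tau) * F (Ce (RtoC (/ INR N) * tau)))%C /\
    (etaq l r (mob g tau) * etaq l r (mob g tau) =
     K * Cpowz (mob_denom g tau) (Zsum (map r l)) * (h tau * h tau))%C.
Proof.
  intros HN Hl Hs. assert (Hdet : (0 < mdet g)%Z) by (rewrite Hs; lia).
  induction l as [|d l IH].
  - exists (RtoC 1), (fun _ => 1), (RtoC 1), 0, (fun _ => 1). split; [apply C1_nz|].
    split; [now apply germ_over_1|]. intros tau H. split; [apply C1_nz|]. split; [apply Clim_const, nbh_filter|].
    split.
    + replace (RtoC 0 * tau)%C with (RtoC 0) by ring. rewrite Ce_0. ring.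
    + unfold etaq. simpl. ring.
  - destruct (Hl d (or_introl eq_refl)) as [Hd HdN].
    destruct IH as [K [h [k [rho [F [HK [HF IH]]]]]]]; [intros e He; apply Hl; now right|].
    destruct (cusp_decomposition g d Hd Hs) as [A [B [D [K' [HA [HD [HAD [HK' Hc]]]]]]]].
    assert (PN : 0 < INR N) by now apply lt_0_INR.
    assert (ND : IZR D <> 0) by (apply not_0_IZR; lia).
    (* All factors must be series in the single variable e(tau / N): with A D = d and N = q d one
       has A / D = A^2 q / N. *)
    assert (Hm : exists m, (0 < m)%nat /\ IZR A / IZR D = INR m * / INR N).
    { destruct HdN as [q Hq]. exists (Z.to_nat (A * (Z.of_nat q * A))). split.
      - assert (q <> 0)%nat by (intros ->; lia). nia.
      - rewrite INR_IZR_INZ, Z2Nat.id by nia. rewrite (INR_IZR_INZ N).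
        rewrite Hq, Nat2Z.inj_mul, <- HAD, !mult_IZR.
        assert (IZR A <> 0) by (apply not_0_IZR; lia).
        assert (IZR (Z.of_nat q) <> 0) by (apply not_0_IZR; intros E; lia).
        field. repeat split; assumption. }
    destruct Hm as [m [Hm Em]].
    set (sig := fun tau => ((IZR A * tau + IZR B) / IZR D)%C).
    set (zeta := Ce (RtoC (IZR B / IZR D))).
    assert (Esig : forall tau, sig tau = (RtoC (IZR A / IZR D) * tau + RtoC (IZR B / IZR D))%C).
    { intros tau. unfold sig. rewrite !RtoC_div by exact ND. field. now apply RtoC_nz. }
    exists (Cpowz K' (r d) * K)%C, (fun tau => Cpowz (eta (sig tau)) (r d) * h tau)%C,
      (Cpowz (Ce (RtoC (IZR B / IZR D / 24))) (r d) * k)%C, (IZR (r d) * (IZR A / IZR D / 24) + rho),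
      (fun x => Cpowz (euler_prod (zeta * Cpow x m)) (r d) * F x)%C.
    split; [apply Cmult_neq_0; [now apply Cpowz_nz|exact HK]|].
    split.
    { apply germ_over_mult; unfold Ctrue; try tauto. apply germ_over_powz; try tauto.
      apply germ_over_euler; try tauto. unfold zeta. apply Cmod_Ce_R. }
    intros tau H. destruct (IH tau H) as [I1 [I2 [I3 I4]]]. destruct (Hc tau H) as [J1 J2].
    fold (sig tau) in J1, J2. assert (Ns := eta_nz _ J1). assert (Nd := mob_denom_nz g tau Hdet H).
    split; [apply Cmult_neq_0; [now apply Cpowz_nz|exact I1]|].
    split; [|split].
    + apply Clim_mult; [apply nbh_filter| |exact I2]. apply Clim_powz; [apply nbh_filter|exact Ns|].
      apply (Ccont_comp eta sig); [|now apply Ccont_eta].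
      unfold Ccont, sig. apply Clim_div; [apply nbh_filter|now apply RtoC_nz| |apply Clim_const, nbh_filter].
      apply Clim_plus; [apply nbh_filter| |apply Clim_const, nbh_filter].
      apply Clim_mult; [apply nbh_filter|apply Clim_const, nbh_filter|apply Ccont_id].
    + rewrite I3, (eta_euler _ J1).
      assert (Ne : euler_prod (Ce (sig tau)) <> 0) by apply Cexp_nz.
      rewrite Cpowz_mult_l by (assumption || apply Ce_nz).
      assert (E1 : Ce (sig tau) = (zeta * Cpow (Ce (RtoC (/ INR N) * tau)) m)%C).
      { rewrite Esig, Ce_add, Em, <- Ce_pow, RtoC_mult. unfold zeta. rewrite Cmult_assoc. ring. }
      assert (E2 : Ce (sig tau / RtoC 24)%C = (Ce (RtoC (IZR A / IZR D / 24) * tau) * Ce (RtoC (IZR B / IZR D / 24)))%C).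
      { rewrite <- Ce_add, Esig. f_equal. unfold Rdiv. rewrite !RtoC_mult, (RtoC_inv 24) by lra. field. }
      rewrite E1, E2, Cpowz_mult_l by apply Ce_nz.
      assert (E3 : Cpowz (Ce (RtoC (IZR A / IZR D / 24) * tau)) (r d) = Ce (RtoC (IZR (r d) * (IZR A / IZR D / 24)) * tau)%C).
      { unfold Ce. rewrite Cpowz_Cexp, (RtoC_mult (IZR (r d))). f_equal. ring. }
      rewrite E3, RtoC_plus, Cmult_plus_distr_r, Ce_add. ring.
    + unfold etaq in *. simpl.
      set (P := Cprod (map (fun d0 => Cpowz (eta (INR d0 * mob g tau)%C) (r d0)) l)) in *.
      assert (Hmob := mob_in_H g tau Hdet H).
      assert (E1 := eta_nz _ (in_H_scal_pos _ _ Hd Hmob)).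
      transitivity (Cpowz (eta (INR d * mob g tau) * eta (INR d * mob g tau))%C (r d) * (P * P))%C.
      * rewrite Cpowz_mult_l by assumption. ring.
      * rewrite I4, J2, !Cpowz_mult_l, Cpowz_add by (repeat (assumption || apply Cmult_neq_0)). ring.
Qed.

Lemma has_expansion_coef f width rho a b : (forall n, a n = b n) ->
  has_expansion f width rho a -> has_expansion f width rho b.
Proof.
  intros E [Z HZ]. exists Z. intros tau Ht. eapply is_series_ext; [|now apply HZ].
  intros n. cbv beta. now rewrite E.
Qed.

Lemma near_infty_in_H (P : C -> Prop) : (forall tau, in_H tau -> P tau) -> near_infty P.
Proof. intros H. exists 0. intros tau Ht. now apply H. Qed.

Lemma etaq_meromorphic_at_cusps N l r : (0 < N)%nat ->
  (forall d, In d l -> (0 < d)%nat /\ Nat.divide d N) ->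
  meromorphic_at_cusps (Zsum (map r l)) (etaq l r).
Proof.
  intros HN Hl g Hs. assert (Hp : all_pos l) by (intros d Hd; now apply Hl).
  assert (Hdet : (0 < mdet g)%Z) by (rewrite Hs; lia).
  destruct (etaq_cusp N g l r HN Hl Hs) as [K [h [k [rho [F [HK [[a [R0 [HF _]]] Hh]]]]]]].
  set (w := Zsum (map r l)) in *.
  set (phi := fun tau => (etaq l r (mob g tau) / (Cpow_half (mob_denom g tau) w * h tau))%C).
  assert (ND : forall tau, in_H tau -> (Cpow_half (mob_denom g tau) w * h tau)%C <> 0).
  { intros tau H. apply Cmult_neq_0; [now apply Cpow_half_nz, mob_denom_nz|now apply Hh]. }
  assert (S1 : forall tau, in_H tau -> (phi tau * phi tau = K)%C).
  { intros tau H. unfold phi. destruct (Hh tau H) as [N2 [_ [_ X2]]].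
    assert (N1 := mob_denom_nz g tau Hdet H).
    assert (N3 := Cpow_half_nz _ w N1). assert (Q := Cpow_half_sqr _ w N1).
    transitivity ((etaq l r (mob g tau) * etaq l r (mob g tau)) /
      ((Cpow_half (mob_denom g tau) w * Cpow_half (mob_denom g tau) w) * (h tau * h tau)))%C.
    - field. split; assumption.
    - rewrite X2, Q. assert (N4 := Cpowz_nz _ w N1). field. split; assumption. }
  assert (S2 : forall tau, in_H tau -> Ccont phi tau).
  { intros t Ht. apply Clim_div; [apply nbh_filter|now apply ND| |].
    - apply (Ccont_comp (etaq l r) (mob g)); [now apply Ccont_mob|apply Ccont_etaq; [exact Hp|now apply mob_in_H]].
    - apply Clim_mult; [apply nbh_filter|now apply Ccont_Cpow_half_denom|now apply Hh]. }
  assert (Cst := Ccont_sqr_const phi K HK S2 S1).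
  (* [has_expansion] divides the shift by the width N, so [rho] is multiplied by it beforehand. *)
  exists N, (rho * INR N), (fun n => phi Ci * k * a n)%C. split; [exact HN|].
  apply germ_has_expansion with F R0; [exact HN|exact HF|].
  intros tau H. destruct (Hh tau H) as [N2 [_ [X3 _]]].
  replace (rho * INR N / INR N) with rho by (field; apply not_0_INR; lia).
  rewrite <- (Cst tau H). transitivity (phi tau * h tau)%C; [|rewrite X3; ring].
  unfold slash. rewrite Hs. unfold Rpower. rewrite ln_1, Rmult_0_r, exp_0. unfold phi.
  assert (N3 := Cpow_half_nz _ w (mob_denom_nz g tau Hdet H)). field. split; assumption.
Qed.

Lemma Zsum_cons x l : Zsum (x :: l) = (x + Zsum l)%Z.
Proof. reflexivity. Qed.

Lemma etaq_at_infinity l r : all_pos l -> exists F, germ_over Cint F /\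
  forall tau, in_H tau ->
    etaq l r tau = (Ce (RtoC (IZR (Zsum (map (fun d => Z.of_nat d * r d)%Z l)) / 24) * tau) * F (Ce tau))%C.
Proof.
  induction l as [|d l IH]; intros Hl.
  - exists (fun _ => 1). split; [apply germ_over_1; [apply Cint_0|apply Cint_1]|].
    intros tau H. unfold etaq. simpl. replace (0 / 24) with 0 by field.
    replace (0 * tau)%C with (RtoC 0) by ring. rewrite Ce_0. ring.
  - apply all_pos_cons in Hl. destruct Hl as [Hd Hl]. destruct (IH Hl) as [F [HF E]].
    exists (fun x => Cpowz (euler_prod (1 * Cpow x d)) (r d) * F x)%C. split.
    + apply germ_over_mult; auto using Cint_0, Cint_1, Cint_add, Cint_opp, Cint_mul.
      apply germ_over_powz; auto using Cint_0, Cint_1, Cint_add, Cint_opp, Cint_mul.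
      apply germ_over_euler; auto using Cint_0, Cint_1, Cint_add, Cint_opp, Cint_mul. apply Cmod_1.
    + intros tau H. unfold etaq in *. simpl. rewrite (E tau H).
      assert (Hdt := in_H_scal_pos _ _ Hd H). rewrite (eta_euler _ Hdt).
      rewrite Cpowz_mult_l by (apply Ce_nz || apply Cexp_nz).
      rewrite Cmult_1_l, <- Ce_pow.
      replace (Cpowz (Ce (INR d * tau / RtoC 24)) (r d)) with (Ce (RtoC (IZR (Z.of_nat d * r d) / 24) * tau)).
      * rewrite plus_IZR. unfold Rdiv. rewrite Rmult_plus_distr_r, RtoC_plus, Cmult_plus_distr_r, Ce_add. ring.
      * unfold Ce. rewrite Cpowz_Cexp. f_equal. rewrite mult_IZR, <- INR_IZR_INZ.
        unfold Rdiv. rewrite !RtoC_mult, RtoC_inv by lra. field.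
Qed.

Lemma up_IZR k : up (IZR k) = (k + 1)%Z.
Proof. symmetry. apply tech_up; rewrite plus_IZR; lra. Qed.

Lemma etaq_integral_normalized l r : all_pos l -> (24 | Zsum (map (fun d => Z.of_nat d * r d)%Z l))%Z ->
  integral_normalized (etaq l r).
Proof.
  intros Hl [h Hh]. destruct (etaq_at_infinity l r Hl) as [F [[a [R0 [HF HI]]] E]].
  (* [Cint] gives each integer only existentially; [up] of an integer k is k + 1, so this formula
     turns the coefficients into an explicit integer sequence. *)
  assert (Ea : forall n, a n = RtoC (IZR (up (Re (a n)) - 1))).
  { intros n. destruct (HI n) as [k ->]. rewrite re_RtoC, up_IZR. f_equal. f_equal. lia. }
  exists h, (fun n => (up (Re (a n)) - 1)%Z). split.
  - destruct HF as [A0 _]. rewrite A0, re_RtoC, (up_IZR 1). reflexivity.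
  - apply has_expansion_coef with (fun n => 1 * a n)%C; [intros n; rewrite <- Ea; ring|].
    apply germ_has_expansion with F R0; [lia|exact HF|]. intros tau H. rewrite (E tau H), Hh.
    simpl INR. rewrite Rinv_1, !Cmult_1_l, Rdiv_1_r, mult_IZR.
    replace (IZR h * 24 / 24) with (IZR h) by field. reflexivity.
Qed.

Lemma integral_normalized_leading f : integral_normalized f -> leading_coef_one f.
Proof.
  intros [h [a [H0 H]]]. exists h, (fun n => IZR (a n)). split; [now rewrite H0|exact H].
Qed.

Theorem eta_quotient_modular_form N r : (0 < N)%nat -> eta_quotient_cond N r ->
  modular_form N (eta_twice_weight N r) (eta_quotient N r).
Proof.
  intros HN [Hr _]. change (eta_quotient N r) with (etaq (divisors N) r).
  assert (Hp := divisors_pos N). split; [now apply etaq_meromorphic|]. split; [|split].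
  - set (l := divisors N) in *. set (w := eta_twice_weight N r).
    (* The multiplier is obtained separately for each matrix; evaluating the law at tau = i
       expresses it as one explicit function of [g]. *)
    exists (fun g => etaq l r (mob g Ci) / (Cpow_half (mob_denom g Ci) w * etaq l r Ci))%C.
    intros g Hg. destruct (etaq_Gamma0 N g l r (fun d Hd => In_divisors d N Hd) Hg) as [chi [H1 H2]].
    assert (Hdet : (0 < mdet g)%Z) by (rewrite (proj1 Hg); lia).
    assert (E : (etaq l r (mob g Ci) / (Cpow_half (mob_denom g Ci) w * etaq l r Ci))%C = chi).
    { rewrite (H2 Ci in_H_Ci). fold w.
      assert (N1 := Cpow_half_nz _ w (mob_denom_nz g Ci Hdet in_H_Ci)). assert (N2 := etaq_nz l r Ci Hp in_H_Ci).
      change (Zsum (map r l)) with w. field. split; assumption. }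
    rewrite E. split; [exact H1|exact H2].
  - apply etaq_meromorphic_at_cusps with N; [exact HN|]. intros d Hd. now apply In_divisors.
  - now apply etaq_integral_normalized.
Qed.

(** * Roots of unity *)

Lemma Ce_real_eq1_small v : Rabs v <= 3 / 4 -> Ce (RtoC v) = 1 -> v = 0.
Proof.
  intros Hv E. assert (K := one_minus_Ce_lower (RtoC v) 0). rewrite re_RtoC, im_RtoC, Rabs_R0, E, Cmod_R in K.
  specialize (K Hv (Rle_refl 0)). replace (1 - 1)%C with (RtoC 0) in K by ring. rewrite Cmod_0, Rmult_0_r, Ropp_0, exp_0 in K.
  apply Rabs_eq_0. generalize (Rabs_pos v). lra.
Qed.

Lemma Ce_rational_eq1 (k : Z) (p : nat) : (0 < p)%nat -> Ce (RtoC (IZR k / INR p)) = 1 -> (Z.of_nat p | k)%Z.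
Proof.
  intros Hp E. set (n := Z.of_nat p). assert (Hn : (0 < n)%Z) by (unfold n; lia).
  assert (En : INR p = IZR n) by apply INR_IZR_INZ. rewrite En in E.
  assert (Pn := IZR_lt _ _ Hn).
  assert (Dm := Z.div_mod k n ltac:(lia)). assert (Bm := Z.mod_pos_bound k n Hn).
  set (q := (k / n)%Z) in *. set (s := (k mod n)%Z) in *.
  assert (Es : Ce (RtoC (IZR s / IZR n)) = 1).
  { rewrite <- E. rewrite Dm, plus_IZR, mult_IZR.
    replace ((IZR n * IZR q + IZR s) / IZR n) with (IZR q + IZR s / IZR n) by (field; lra).
    rewrite RtoC_plus, Ce_add, Ce_IZR. ring. }
  destruct Bm as [B1 B2]. apply IZR_le in B1. apply IZR_lt in B2.
  assert (V : 0 <= IZR s / IZR n < 1).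
  { split; [apply Rdiv_le_0_compat; lra|]. apply Rmult_lt_reg_r with (IZR n); [exact Pn|].
    unfold Rdiv. rewrite Rmult_assoc, Rinv_l by lra. lra. }
  assert (Z0 : s = 0%Z).
  { destruct (Rle_dec (IZR s / IZR n) (3 / 4)) as [h|h].
    - apply Ce_real_eq1_small in Es; [|rewrite Rabs_pos_eq; lra]. apply eq_IZR.
      replace (IZR s) with (IZR s / IZR n * IZR n) by (field; lra). rewrite Es. ring.
    - assert (E2 : Ce (RtoC (IZR s / IZR n - 1)) = 1).
      { rewrite RtoC_minus, Ce_minus, Es, Ce_1. field. }
      apply Ce_real_eq1_small in E2; [lra|]. rewrite Rabs_left; lra. }
  exists q. rewrite Dm, Z0. ring.
Qed.

(** Polynomial functions of degree at most [d] in Horner form, which suits the factor theorem by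
    induction on [d]. *)
Fixpoint poly_fun (d : nat) (f : C -> C) : Prop :=
  match d with
  | O => exists c, forall y, f y = c
  | S d' => exists c g, poly_fun d' g /\ forall y, f y = (c + y * g y)%C
  end.

Lemma poly_fun_affine d f a b : poly_fun d f -> poly_fun d (fun y => a * f y + b)%C.
Proof.
  revert f b. induction d as [|d IH]; intros f b; simpl.
  - intros [c Hc]. exists (a * c + b)%C. intros y. now rewrite Hc.
  - intros [c [g [Hg E]]]. exists (a * c + b)%C, (fun y => a * g y + 0)%C.
    split; [now apply IH|]. intros y. rewrite E. ring.
Qed.

Lemma poly_fun_root d f z : poly_fun (S d) f -> f z = 0 ->
  exists g, poly_fun d g /\ forall y, f y = ((y - z) * g y)%C.
Proof.
  revert f. induction d as [|d IH]; intros f [c [g [Hg E]]] Hz.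
  - destruct Hg as [k Hk]. exists g. split; [now exists k|]. intros y.
    rewrite E. rewrite E, !Hk in Hz. rewrite Hk. replace c with (c + z * k - z * k)%C by ring. rewrite Hz. ring.
  - destruct (IH (fun y => 1 * g y + - g z)%C) as [h [Hh Eh]].
    + apply poly_fun_affine. exact Hg.
    + ring.
    + exists (fun y => g z + y * h y)%C. split.
      * exists (g z), h. split; [exact Hh|reflexivity].
      * intros y. rewrite E. rewrite E in Hz. replace c with (c + z * g z - z * g z)%C by ring. rewrite Hz.
        specialize (Eh y). replace (g y) with ((1 * g y + - g z) + g z)%C by ring. rewrite Eh. ring.
Qed.

Definition prod_upto (u : nat -> C) (n : nat) : C := Cprod (map u (seq 0 n)).

Lemma prod_upto_S u n : prod_upto u (S n) = (prod_upto u n * u n)%C.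
Proof. unfold prod_upto. rewrite seq_S, map_app, Cprod_app. simpl. ring. Qed.

Lemma prod_upto_ext u v n : (forall k, (k < n)%nat -> u k = v k) -> prod_upto u n = prod_upto v n.
Proof.
  induction n as [|n IH]; intros H; [reflexivity|]. rewrite !prod_upto_S, IH, H; auto; lia.
Qed.

Lemma prod_upto_mult u v n : prod_upto (fun k => u k * v k)%C n = (prod_upto u n * prod_upto v n)%C.
Proof. induction n as [|n IH]; [unfold prod_upto; simpl; ring|]. rewrite !prod_upto_S, IH. ring. Qed.

Lemma prod_upto_const c n : prod_upto (fun _ => c) n = Cpow c n.
Proof. induction n as [|n IH]; [reflexivity|]. rewrite prod_upto_S, IH. simpl. ring. Qed.

Lemma prod_upto_nz u n : (forall k, (k < n)%nat -> u k <> RtoC 0) -> prod_upto u n <> 0.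
Proof.
  induction n as [|n IH]; intros H; [apply C1_nz|]. rewrite prod_upto_S. apply Cmult_neq_0; auto.
Qed.

Lemma Clim_prod_upto {T : Type} (F : (T -> Prop) -> Prop) {FF : ProperFilter F} (f : nat -> T -> C) (l : nat -> C) n :
  (forall k, Clim F (f k) (l k)) -> Clim F (fun x => prod_upto (fun k => f k x) n) (prod_upto l n).
Proof.
  intros H. induction n as [|n IH]; [exact (Clim_const F (RtoC 1))|].
  rewrite prod_upto_S. apply Clim_ext with (fun x => prod_upto (fun k => f k x) n * f n x)%C; [exact FF| |].
  - intros x. now rewrite prod_upto_S.
  - now apply Clim_mult.
Qed.

(** The roots are given as 1 / c_i and the linear factors as 1 - c_i y, so that K is the value at
    0. *)
Lemma poly_fun_factor n f (c : nat -> C) : poly_fun n f ->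
  (forall i, (i < n)%nat -> c i <> 0 /\ f (/ c i)%C = 0) ->
  (forall i j, (i < j)%nat -> (j < n)%nat -> c i <> c j) ->
  exists K, forall y, f y = (K * prod_upto (fun i => 1 - c i * y)%C n)%C.
Proof.
  revert f. induction n as [|n IH]; intros f Hf Hr Hd.
  - destruct Hf as [K HK]. exists K. intros y. rewrite HK. unfold prod_upto. simpl. ring.
  - destruct (Hr n (Nat.lt_succ_diag_r n)) as [Hcn Hfn].
    destruct (poly_fun_root n f _ Hf Hfn) as [g [Hg Eg]].
    destruct (IH (fun y => (- / c n) * g y + 0)%C) as [K HK].
    + now apply poly_fun_affine.
    + intros i Hi. destruct (Hr i ltac:(lia)) as [Hci Hfi]. split; [exact Hci|].
      rewrite Eg in Hfi. apply Cmult_integral in Hfi. destruct Hfi as [E|E].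
      * exfalso. apply (Hd i n Hi (Nat.lt_succ_diag_r n)).
        replace (c i) with (/ / c i)%C by (field; exact Hci).
        replace (/ c i)%C with (/ c n)%C; [field; exact Hcn|].
        symmetry. now apply Ceq_minus.
      * rewrite E. ring.
    + intros; apply Hd; lia.
    + exists K. intros y. rewrite prod_upto_S, Eg.
      transitivity ((- / c n * g y + 0) * (1 - c n * y))%C; [field; exact Hcn|]. rewrite HK. ring.
Qed.

Lemma poly_fun_pow n : poly_fun n (fun y => Cpow y n).
Proof.
  induction n as [|n IH]; [now exists (RtoC 1)|].
  exists (RtoC 0), (fun y => Cpow y n). split; [exact IH|]. intros y. simpl. ring.
Qed.

(** 1 - y^n vanishes at the n distinct points zeta^(-b); evaluation at y = 0 shows that the
    remaining constant is 1. *)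
Lemma prod_roots_of_unity n zeta : (0 < n)%nat -> Cpow zeta n = 1 ->
  (forall i, (0 < i < n)%nat -> Cpow zeta i <> 1) ->
  forall y, prod_upto (fun b => 1 - Cpow zeta b * y)%C n = (1 - Cpow y n)%C.
Proof.
  intros Hn Hz Hi y.
  assert (Nz : zeta <> 0).
  { intros ->. destruct n; [lia|]. simpl in Hz. rewrite Cmult_0_l in Hz. apply C1_nz. now symmetry. }
  destruct (poly_fun_factor n (fun y => (RtoC (-1)) * Cpow y n + 1)%C (fun b => Cpow zeta b)) as [K HK].
  - apply poly_fun_affine, poly_fun_pow.
  - intros i Hin. split; [now apply Cpow_nz|]. rewrite Cpow_inv by now apply Cpow_nz.
    rewrite <- Cpow_mult_r, Nat.mul_comm, Cpow_mult_r, Hz, Cpow_1_l. field.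
  - intros i j Hij Hj E. apply (Hi (j - i)%nat); [lia|].
    assert (E2 : (Cpow zeta i * Cpow zeta (j - i) = Cpow zeta i * 1)%C).
    { rewrite <- Cpow_add_r, E. replace (i + (j - i))%nat with j by lia. ring. }
    replace (Cpow zeta (j - i)) with (/ Cpow zeta i * (Cpow zeta i * Cpow zeta (j - i)))%C by (field; now apply Cpow_nz).
    rewrite E2. field. now apply Cpow_nz.
  - assert (K1 : K = 1).
    { specialize (HK 0). rewrite (prod_upto_ext _ (fun _ => 1)) in HK by (intros; ring).
      rewrite prod_upto_const, Cpow_1_l in HK. destruct n as [|n]; [lia|]. simpl in HK.
      rewrite Cmult_0_l in HK. rewrite Cmult_1_r in HK. rewrite <- HK. ring. }
    specialize (HK y). rewrite K1, Cmult_1_l in HK. rewrite <- HK. ring.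
Qed.

(** * The Hecke relation for the Euler product *)

(** In the application x = e(d tau / p) is a p-th root of the nome e(d tau) and omega = e(d / p);
    the points (tau + b) / p then give omega^b x. *)
Section EulerHecke.
Variables (p : nat) (omega x : C).
Hypothesis Hp : (0 < p)%nat.
Hypothesis omega_p : Cpow omega p = 1.
Hypothesis omega_roots : forall n, ~ Nat.divide p n -> forall y,
  prod_upto (fun b => 1 - Cpow omega (b * n) * y)%C p = (1 - Cpow y p)%C.

(** An exact identity of finite products, by induction. If p does not divide n + 1, the p new
    factors multiply to 1 - x^(p (n+1)). If it does, they all equal 1 - x^(n+1), and the products
    truncated at n / p advance by one factor each. *)
Lemma euler_partial_hecke n :
  (prod_upto (fun b => euler_partial (Cpow omega b * x) n) p * euler_partial (Cpow x (p * p)) (n / p) =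
   euler_partial (Cpow x p) n * Cpow (euler_partial (Cpow x p) (n / p)) p)%C.
Proof.
  induction n as [|n IH].
  - rewrite Nat.Div0.div_0_l. unfold euler_partial at 1 2 3 4. simpl map. simpl Cprod.
    rewrite prod_upto_const, !Cpow_1_l. ring.
  - rewrite (prod_upto_ext _ (fun b => euler_partial (Cpow omega b * x) n * (1 - Cpow (Cpow omega b * x) (S n)))%C)
      by (intros; apply euler_partial_S).
    rewrite prod_upto_mult, (euler_partial_S _ n).
    rewrite (prod_upto_ext (fun b => 1 - Cpow (Cpow omega b * x) (S n))%C (fun b => 1 - Cpow omega (b * S n) * Cpow x (S n))%C)
      by (intros; now rewrite Cpow_mult_l, Cpow_mult_r).
    destruct (Nat.eq_dec (S n mod p) 0) as [E|E].
    + assert (E1 : (S n = p * (S n / p))%nat).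
      { rewrite (Nat.div_mod_eq (S n) p) at 1. lia. }
      assert (E2 : (S n / p = S (n / p))%nat).
      { remember (S n / p)%nat as m. destruct m as [|m]; [lia|]. f_equal.
        apply Nat.div_unique with (p - 1)%nat; nia. }
      rewrite E2 in *. rewrite !euler_partial_S.
      rewrite (prod_upto_ext (fun b => 1 - Cpow omega (b * S n) * Cpow x (S n))%C (fun _ => 1 - Cpow x (S n))%C).
      * rewrite prod_upto_const, Cpow_mult_l.
        replace (Cpow (Cpow x (p * p)) (S (n / p))) with (Cpow (Cpow x p) (S n)) by (rewrite <- !Cpow_mult_r; f_equal; nia).
        replace (Cpow (Cpow x p) (S (n / p))) with (Cpow x (S n)) by (rewrite <- !Cpow_mult_r; f_equal; nia).
        set (A := prod_upto _ p) in *. set (B := euler_partial (Cpow x (p * p)) (n / p)) in *.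
        set (u := Cpow (1 - Cpow x (S n))%C p). set (v := (1 - Cpow (Cpow x p) (S n))%C).
        transitivity (A * B * u * v)%C; [ring|]. rewrite IH. ring.
      * intros b _. rewrite E1. replace (b * (p * S (n / p)))%nat with (p * (b * S (n / p)))%nat by ring.
        rewrite Cpow_mult_r, omega_p, Cpow_1_l. ring.
    + assert (E2 : (S n / p = n / p)%nat).
      { apply Nat.div_unique with (S n mod p - 1)%nat.
        - generalize (Nat.mod_upper_bound (S n) p). lia.
        - generalize (Nat.div_mod_eq (S n) p). lia. }
      rewrite E2, omega_roots.
      * replace (Cpow (Cpow x (S n)) p) with (Cpow (Cpow x p) (S n)) by (rewrite <- !Cpow_mult_r; f_equal; ring).
        set (A := prod_upto _ p) in *. set (B := euler_partial (Cpow x (p * p)) (n / p)) in *.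
        set (v := (1 - Cpow (Cpow x p) (S n))%C).
        transitivity (A * B * v)%C; [ring|]. rewrite IH. ring.
      * intros D. apply E. apply Nat.mod_divide; [lia|exact D].
Qed.

Lemma euler_prod_hecke : Cmod omega = 1 -> Cmod x < 1 ->
  (prod_upto (fun b => euler_prod (Cpow omega b * x)) p * euler_prod (Cpow x (p * p)) =
   euler_prod (Cpow x p) * Cpow (euler_prod (Cpow x p)) p)%C.
Proof.
  intros Ho Hx.
  assert (Hpow : forall n, (0 < n)%nat -> Cmod (Cpow x n) < 1) by (intros [|n] Hn; [lia|now apply Cmod_pow_lt_1]).
  assert (L : forall q, Cmod q < 1 -> Clim eventually (fun n => euler_partial q (n / p)) (euler_prod q)).
  { intros q Hq e He. destruct (euler_partial_lim q Hq e He) as [N HN]. exists (p * N)%nat. intros n Hn.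
    apply HN. apply Nat.div_le_lower_bound; lia. }
  apply (Clim_unique eventually (fun n => prod_upto (fun b => euler_partial (Cpow omega b * x)%C n) p
    * euler_partial (Cpow x (p * p)) (n / p))%C).
  - apply Clim_mult; [apply eventually_filter| |apply L, Hpow; nia].
    apply Clim_prod_upto; [apply eventually_filter|]. intros b. apply euler_partial_lim.
    rewrite Cmod_mult, Cmod_pow, Ho, pow1. lra.
  - apply Clim_ext with (fun n => euler_partial (Cpow x p) n * Cpow (euler_partial (Cpow x p) (n / p)) p)%C;
      [apply eventually_filter|intros n; symmetry; apply euler_partial_hecke|].
    apply Clim_mult; [apply eventually_filter|now apply euler_partial_lim, Hpow|].
    apply Clim_pow; [apply eventually_filter|]. apply L. now apply Hpow.
Qed.
End EulerHecke.

(** The number omega^n is a primitive p-th root of unity: omega^(n i) = 1 means p | i n d, and p,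
    being prime, would have to divide one of i, n, d. *)
Lemma Ce_root_roots p d : prime (Z.of_nat p) -> ~ Nat.divide p d ->
  forall n, ~ Nat.divide p n -> forall y,
    prod_upto (fun b => 1 - Cpow (Ce (RtoC (INR d / INR p))) (b * n) * y)%C p = (1 - Cpow y p)%C.
Proof.
  intros Hpr Hd n Hn y. assert (Hp : (0 < p)%nat) by (generalize (prime_ge_2 _ Hpr); lia).
  assert (Pp : INR p <> 0) by (apply not_0_INR; lia).
  assert (Epow : forall i, Cpow (Cpow (Ce (RtoC (INR d / INR p))) n) i = Ce (RtoC (IZR (Z.of_nat (i * n * d)) / INR p))).
  { intros i. rewrite <- Cpow_mult_r, <- Ce_pow, <- RtoC_mult. f_equal. f_equal. rewrite <- INR_IZR_INZ, !mult_INR. field. exact Pp. }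
  rewrite (prod_upto_ext _ (fun b => 1 - Cpow (Cpow (Ce (RtoC (INR d / INR p))) n) b * y)%C)
    by (intros; now rewrite <- Cpow_mult_r, Nat.mul_comm).
  apply prod_roots_of_unity; [exact Hp| |].
  - rewrite Epow. replace (IZR (Z.of_nat (p * n * d)) / INR p) with (INR (n * d)).
    + apply Ce_nat.
    + rewrite <- INR_IZR_INZ, !mult_INR. field. exact Pp.
  - intros i Hi E. rewrite Epow in E. apply Ce_rational_eq1 in E; [|exact Hp].
    assert (Dv : forall m, (Z.of_nat p | Z.of_nat m)%Z -> Nat.divide p m).
    { intros m [k Hk]. exists (Z.to_nat k). nia. }
    rewrite !Nat2Z.inj_mul in E. apply prime_mult in E; [|exact Hpr].
    destruct E as [E|E]; [|now apply Hd, Dv].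
    apply prime_mult in E; [|exact Hpr]. destruct E as [E|E]; [|now apply Hn, Dv].
    apply Z.divide_pos_le in E; lia.
Qed.

Lemma Cpow_S_l z n : (z * Cpow z n)%C = Cpow z (S n).
Proof. reflexivity. Qed.

(** The Euler factors match by [euler_prod_hecke]. For the prefactors put t = e(d tau / (24 p)): the
    left side has t^(p^2) from p tau and t^p from the p points (tau + b) / p, which together are
    (t^p)^(p+1). The phases e(d b / (24 p)) form the constant [k]. *)
Theorem eta_hecke p d : prime (Z.of_nat p) -> (0 < d)%nat -> ~ Nat.divide p d ->
  exists k, k <> RtoC 0 /\ forall tau, in_H tau ->
    (eta (INR d * (INR p * tau)) *
     prod_upto (fun b => eta (INR d * ((tau + INR b) / INR p))) p =
     k * Cpow (eta (INR d * tau)) (S p))%C.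
Proof.
  intros Hpr Hd Hpd. assert (Hp : (0 < p)%nat) by (generalize (prime_ge_2 _ Hpr); lia).
  assert (Pp : 0 < INR p) by now apply lt_0_INR.
  assert (Np : RtoC (INR p) <> 0) by (apply RtoC_nz; lra).
  set (omega := Ce (RtoC (INR d / INR p))).
  set (kb := fun b => Ce (RtoC (INR d * INR b / INR p / 24))).
  exists (prod_upto kb p). split; [apply prod_upto_nz; intros; apply Ce_nz|].
  intros tau H. set (x := Ce (RtoC (INR d / INR p) * tau)).
  assert (Hdp : 0 < INR d / INR p) by (apply Rdiv_lt_0_compat; [now apply lt_0_INR|exact Pp]).
  assert (Hx : Cmod x < 1).
  { apply Cmod_Ce_lt_1. unfold in_H in *. rewrite im_scal_l. nra. }
  assert (E1 : Ce (INR d * tau) = Cpow x p).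
  { unfold x. rewrite <- Ce_pow. f_equal. unfold Rdiv. rewrite RtoC_mult, (RtoC_inv (INR p)) by lra. field. exact Np. }
  assert (E2 : Ce (INR d * (INR p * tau)) = Cpow x (p * p)).
  { rewrite Cpow_mult_r, <- E1, <- Ce_pow. f_equal. ring. }
  assert (E3 : forall b, Ce (INR d * ((tau + INR b) / INR p)) = (Cpow omega b * x)%C).
  { intros b. unfold omega, x. rewrite <- Ce_pow, <- Ce_add. f_equal.
    unfold Rdiv. rewrite RtoC_mult, (RtoC_inv (INR p)) by lra. field. exact Np. }
  assert (H1 : in_H (INR d * tau)) by now apply in_H_scal_pos.
  assert (H2 : in_H (INR d * (INR p * tau))) by (apply in_H_scal_pos; [exact Hd|now apply in_H_scal_pos]).
  assert (H3 : forall b, in_H (INR d * ((tau + INR b) / INR p))).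
  { intros b. apply in_H_scal_pos; [exact Hd|]. unfold in_H in *. unfold Cdiv. rewrite <- RtoC_inv by lra.
    rewrite im_scal_r, im_plus, im_RtoC, Rplus_0_r. apply Rmult_lt_0_compat; [exact H|now apply Rinv_0_lt_compat]. }
  rewrite (eta_euler _ H1), (eta_euler _ H2), E1, E2.
  set (t := Ce (RtoC (INR d / INR p / 24) * tau)).
  rewrite (prod_upto_ext _ (fun b => kb b * (t * euler_prod (Cpow omega b * x)))%C).
  2:{ intros b _. rewrite (eta_euler _ (H3 b)), E3. rewrite Cmult_assoc. f_equal.
      unfold kb, t. rewrite <- Ce_add. f_equal. unfold Rdiv. rewrite !RtoC_mult, (RtoC_inv (INR p)), (RtoC_inv 24) by lra.
      field. exact Np. }
  rewrite !prod_upto_mult, prod_upto_const.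
  assert (EH := euler_prod_hecke p omega x Hp).
  assert (Op : Cpow omega p = 1).
  { unfold omega. rewrite <- Ce_pow, <- RtoC_mult. replace (INR p * (INR d / INR p)) with (INR d) by (field; lra). apply Ce_nat. }
  specialize (EH Op (Ce_root_roots p d Hpr Hpd) (Cmod_Ce_R _) Hx).
  assert (E4 : Ce (INR d * tau / RtoC 24) = Cpow t p).
  { unfold t. rewrite <- Ce_pow. f_equal. unfold Rdiv. rewrite !RtoC_mult, (RtoC_inv (INR p)), (RtoC_inv 24) by lra. field. exact Np. }
  assert (E5 : Ce (INR d * (INR p * tau) / RtoC 24) = Cpow (Cpow t p) p).
  { rewrite <- E4, <- Ce_pow. f_equal. field. }
  rewrite E4, E5. rewrite <- Cpow_S_l, Cpow_mult_l.
  transitivity (prod_upto kb p * (Cpow t p * Cpow (Cpow t p) p) *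
    (prod_upto (fun b => euler_prod (Cpow omega b * x)) p * euler_prod (Cpow x (p * p))))%C; [ring|].
  rewrite EH. ring.
Qed.

(** * The matrices of T(p) for prime p *)

Lemma divisors_prime p : prime (Z.of_nat p) -> divisors p = (1 :: p :: nil)%nat.
Proof.
  intros Hpr. assert (H2 := prime_ge_2 _ Hpr). unfold divisors.
  destruct p as [|[|p]]; [lia|lia|].
  replace (seq 1 (S (S p))) with ((1 :: seq 2 p) ++ (S (S p) :: nil))%nat.
  2:{ rewrite (seq_S (S p) 1). reflexivity. }
  rewrite filter_app.
  assert (E : forall l, (forall d, In d l -> (1 < d < S (S p))%nat) ->
    filter (fun d => Nat.eqb (Nat.modulo (S (S p)) d) 0) l = nil).
  { induction l as [|d l IH]; intros Hl; [reflexivity|]. cbn [filter].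
    assert (Hd := Hl d (or_introl eq_refl)).
    destruct (Nat.eqb_spec (S (S p) mod d) 0) as [K|K].
    - exfalso. apply Nat.mod_divide in K; [|lia]. destruct K as [q Hq].
      assert (D : (Z.of_nat d | Z.of_nat (S (S p)))%Z) by (exists (Z.of_nat q); rewrite Hq; apply Nat2Z.inj_mul).
      apply prime_divisors in D; [|exact Hpr]. lia.
    - apply IH. intros e He. apply Hl. now right. }
  cbn [filter]. rewrite Nat.mod_1_r, Nat.Div0.mod_same, E; [reflexivity|].
  intros d Hd. apply in_seq in Hd. lia.
Qed.

Lemma hecke_matrices_prime p : prime (Z.of_nat p) ->
  hecke_matrices p = Mat2 (Z.of_nat p) 0 0 1 :: map (fun b => Mat2 1 (Z.of_nat b) 0 (Z.of_nat p)) (seq 0 p).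
Proof.
  intros Hpr. assert (H2 := prime_ge_2 _ Hpr). unfold hecke_matrices. rewrite divisors_prime by exact Hpr.
  cbn [flat_map map seq app]. rewrite app_nil_r, Nat.div_1_r, (Nat.div_same p) by lia. reflexivity.
Qed.

(** For an upper triangular matrix the slash factor does not depend on tau; all such factors are
    later absorbed into the normalizing constant, whatever the branch for odd weight. *)
Definition slash_const (w a b d : Z) : C :=
  (RtoC (Rpower (IZR (a * d - b * 0)) (IZR w / 4)) * / Cpow_half (IZR d) w)%C.

Lemma slash_const_nz w a b d : d <> 0%Z -> slash_const w a b d <> 0.
Proof.
  intros Hd. apply Cmult_neq_0; [|apply Cinv_nz, Cpow_half_nz, RtoC_nz, not_0_IZR, Hd].
  apply RtoC_nz. unfold Rpower. generalize (exp_pos (IZR w / 4 * ln (IZR (a * d - b * 0)))). lra.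
Qed.

Lemma slash_upper w f a b d tau : slash w f (Mat2 a b 0 d) tau =
  (slash_const w a b d * f ((IZR a * tau + IZR b) / IZR d))%C.
Proof.
  unfold slash, slash_const, mdet, mob, mob_denom. simpl.
  replace (0 * tau + IZR d)%C with (RtoC (IZR d)) by ring. reflexivity.
Qed.

(** * The multiplicative Hecke operators on eta quotients *)

Lemma Cpow_Cpowz z n m : z <> RtoC 0 -> Cpow (Cpowz z n) m = Cpowz (Cpow z m) n.
Proof.
  intros Hz. induction m as [|m IH]; simpl.
  - destruct (Z_nat_cases n) as [k [-> | ->]].
    + now rewrite Cpowz_of_nat, Cpow_1_l.
    + rewrite Cpowz_opp_of_nat, Cpow_1_l. field.
  - rewrite IH, Cpowz_mult_l; [reflexivity|exact Hz|now apply Cpow_nz].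
Qed.

Lemma prod_upto_Cpowz u z n : (forall k, (k < n)%nat -> u k <> RtoC 0) ->
  prod_upto (fun k => Cpowz (u k) z) n = Cpowz (prod_upto u n) z.
Proof.
  induction n as [|n IH]; intros H.
  - unfold prod_upto. simpl. destruct (Z_nat_cases z) as [k [-> | ->]].
    + now rewrite Cpowz_of_nat, Cpow_1_l.
    + rewrite Cpowz_opp_of_nat, Cpow_1_l. field.
  - rewrite !prod_upto_S, IH, Cpowz_mult_l by (try apply prod_upto_nz; auto). reflexivity.
Qed.

Lemma in_H_div tau b p : (0 < p)%nat -> in_H tau -> in_H ((tau + INR b) / INR p)%C.
Proof.
  intros Hp H. assert (Pp : 0 < INR p) by now apply lt_0_INR.
  unfold in_H in *. unfold Cdiv. rewrite <- RtoC_inv by lra.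
  rewrite im_scal_r, im_plus, im_RtoC, Rplus_0_r. apply Rmult_lt_0_compat; [exact H|now apply Rinv_0_lt_compat].
Qed.

Lemma etaq_hecke p l r : prime (Z.of_nat p) -> all_pos l -> (forall d, In d l -> ~ Nat.divide p d) ->
  exists k, k <> RtoC 0 /\ forall tau, in_H tau ->
    (etaq l r (INR p * tau) *
     prod_upto (fun b => etaq l r ((tau + INR b) / INR p)) p =
     k * Cpow (etaq l r tau) (S p))%C.
Proof.
  intros Hpr Hl Hc. assert (Hp : (0 < p)%nat) by (generalize (prime_ge_2 _ Hpr); lia).
  induction l as [|d l IH].
  - exists (RtoC 1). split; [apply C1_nz|]. intros tau H. unfold etaq. simpl map. simpl Cprod.
    rewrite prod_upto_const, !Cpow_1_l. ring.
  - apply all_pos_cons in Hl. destruct Hl as [Hd Hl].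
    destruct IH as [k [Hk E]]; [exact Hl|intros e He; apply Hc; now right|].
    destruct (eta_hecke p d Hpr Hd (Hc d (or_introl eq_refl))) as [k' [Hk' E']].
    exists (Cpowz k' (r d) * k)%C. split; [apply Cmult_neq_0; [now apply Cpowz_nz|exact Hk]|].
    intros tau H.
    assert (Ec : forall t, etaq (d :: l) r t = (Cpowz (eta (INR d * t)) (r d) * etaq l r t)%C) by reflexivity.
    rewrite (prod_upto_ext _ (fun b => Cpowz (eta (INR d * ((tau + INR b) / INR p))) (r d) *
      etaq l r ((tau + INR b) / INR p))%C) by (intros; apply Ec).
    assert (N0 : forall b, eta (INR d * ((tau + INR b) / INR p))%C <> 0).
    { intros b. apply eta_nz, in_H_scal_pos; [exact Hd|now apply in_H_div]. }
    rewrite !Ec, prod_upto_mult, prod_upto_Cpowz by auto.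
    assert (N1 : eta (INR d * tau)%C <> 0) by now apply eta_nz, in_H_scal_pos.
    assert (N2 : eta (INR d * (INR p * tau))%C <> 0) by (apply eta_nz, in_H_scal_pos; [exact Hd|now apply in_H_scal_pos]).
    assert (N3 : prod_upto (fun b => eta (INR d * ((tau + INR b) / INR p))%C) p <> 0) by (apply prod_upto_nz; auto).
    rewrite Cpow_mult_l, Cpow_Cpowz by exact N1.
    transitivity (Cpowz k' (r d) * Cpowz (Cpow (eta (INR d * tau)) (S p)) (r d) * (k * Cpow (etaq l r tau) (S p)))%C; [|ring].
    rewrite <- Cpowz_mult_l by (assumption || now apply Cpow_nz).
    rewrite <- E', <- E by exact H. rewrite Cpowz_mult_l by assumption. ring.
Qed.

Lemma log_etaq_scal l r (c : Z) tau : log_etaq l (fun d => c * r d)%Z tau = (IZR c * log_etaq l r tau)%C.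
Proof.
  induction l as [|d l IH]; unfold log_etaq in *; simpl; [ring|].
  rewrite IH, mult_IZR, RtoC_mult. ring.
Qed.

Lemma etaq_pow l r n tau : all_pos l -> in_H tau ->
  etaq l (fun d => Z.of_nat n * r d)%Z tau = Cpow (etaq l r tau) n.
Proof.
  intros Hl H. rewrite !etaq_exp, log_etaq_scal by assumption. rewrite <- INR_IZR_INZ. apply Cexp_INR.
Qed.

Lemma mero_eq_in_H f g : (forall tau, in_H tau -> f tau = g tau) -> mero_eq f g.
Proof.
  intros H z0 Hz. destruct (nbh_in_H _ Hz) as [e [He K]]. exists e. split; [exact He|].
  intros z [_ Hz2]. now apply H, K.
Qed.

(** The image under T(p) is exhibited as the eta quotient with exponents (p + 1) r_d. Its leading
    coefficient is 1 by its own q-expansion, whose order is again integral. *)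
Lemma etaq_is_hecke w p l r : prime (Z.of_nat p) -> all_pos l -> (forall d, In d l -> ~ Nat.divide p d) ->
  (24 | Zsum (map (fun d => Z.of_nat d * r d)%Z l))%Z ->
  is_hecke w p (etaq l r) (etaq l (fun d => Z.of_nat (S p) * r d)%Z).
Proof.
  intros Hpr Hl Hc H24. assert (Hp : (0 < p)%nat) by (generalize (prime_ge_2 _ Hpr); lia).
  split; [now apply etaq_meromorphic|]. split.
  - apply integral_normalized_leading, etaq_integral_normalized; [exact Hl|].
    destruct H24 as [q Hq]. exists (Z.of_nat (S p) * q)%Z.
    assert (E : forall l', Zsum (map (fun d => Z.of_nat d * (Z.of_nat (S p) * r d))%Z l') =
      (Z.of_nat (S p) * Zsum (map (fun d => Z.of_nat d * r d) l'))%Z).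
    { induction l' as [|d l' IH]; [simpl; lia|]. cbn [map]. rewrite !Zsum_cons, IH. ring. }
    rewrite E, Hq. ring.
  - destruct (etaq_hecke p l r Hpr Hl Hc) as [k [Hk E]].
    set (c0 := slash_const w (Z.of_nat p) 0 1). set (cb := fun b => slash_const w 1 (Z.of_nat b) (Z.of_nat p)).
    set (R0 := RtoC (Rpower (INR p) (IZR w / 2 * (INR p - 1) / 2))).
    assert (N0 : c0 <> 0) by (apply slash_const_nz; lia).
    assert (Nb : prod_upto cb p <> 0) by (apply prod_upto_nz; intros; apply slash_const_nz; lia).
    assert (NR : R0 <> 0).
    { apply RtoC_nz. unfold Rpower. generalize (exp_pos (IZR w / 2 * (INR p - 1) / 2 * ln (INR p))). lra. }
    (* The inverse of every constant collected: the power of p in the definition, the slash factors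
       of the p + 1 matrices, and the constant of [etaq_hecke]. *)
    exists (/ (R0 * c0 * prod_upto cb p * k))%C. apply mero_eq_in_H. intros tau H.
    rewrite etaq_pow by assumption. rewrite hecke_matrices_prime by exact Hpr. rewrite map_cons, map_map.
    set (u := fun b => slash w (etaq l r) (Mat2 1 (Z.of_nat b) 0 (Z.of_nat p)) tau).
    change (Cprod (slash w (etaq l r) (Mat2 (Z.of_nat p) 0 0 1) tau :: map u (seq 0 p)))
      with (slash w (etaq l r) (Mat2 (Z.of_nat p) 0 0 1) tau * prod_upto u p)%C.
    rewrite (prod_upto_ext u (fun b => cb b * etaq l r ((tau + INR b) / INR p))%C).
    + rewrite slash_upper, prod_upto_mult. fold c0 R0.
      replace ((IZR (Z.of_nat p) * tau + IZR 0) / IZR 1)%C with (INR p * tau)%C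
        by (rewrite <- INR_IZR_INZ; field).
      assert (NE : Cpow (etaq l r tau) (S p) <> 0) by now apply Cpow_nz, etaq_nz.
      transitivity (/ (R0 * c0 * prod_upto cb p * k) * R0 * c0 * prod_upto cb p * (k * Cpow (etaq l r tau) (S p)))%C.
      * field. repeat split; assumption.
      * rewrite <- E by exact H. ring.
    + intros b _. unfold u, cb. rewrite slash_upper. f_equal. f_equal.
      rewrite <- !INR_IZR_INZ, Cmult_1_l. reflexivity.
Qed.

(** * The logarithm near i oo and complex powers *)

Global Instance near_infty_filter : ProperFilter near_infty.
Proof.
  constructor.
  - intros P [Y H]. exists (RtoC (Y + 1) * Ci)%C. apply H. simpl. lra.
  - constructor.
    + exists 0. trivial.
    + intros P Q [Y H] [Z K]. exists (Rmax Y Z). intros t Ht. split; [apply H|apply K];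
      (eapply Rle_lt_trans; [|exact Ht]); [apply Rmax_l|apply Rmax_r].
    + intros P Q HPQ [Y H]. exists Y. auto.
Qed.

(** The majorant sums to r / (1 - r)^2, and 1 / (1 - r) <= 2. *)
Lemma lambert_small q : Cmod q <= 1 / 2 -> Cmod (lambert q) <= 4 * Cmod q.
Proof.
  intros H. set (r := Cmod q) in *. assert (P : 0 <= r) by apply Cmod_ge_0.
  assert (G : is_series (fun k => / (1 - r) * r ^ S k) (/ (1 - r) * (r * / (1 - r)))).
  { apply (is_series_ext (fun k => scal (/ (1 - r) * r) (r ^ k))).
    - intros k. change (/ (1 - r) * r * r ^ k = / (1 - r) * (r * r ^ k)). ring.
    - rewrite <- Rmult_assoc. apply (is_series_scal (V := R_NormedModule) (/ (1 - r) * r)).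
      apply is_series_geom. rewrite Rabs_pos_eq; lra. }
  eapply Rle_trans.
  - apply (Cmod_Csum_le _ (fun k => / (1 - r) * r ^ S k)); [intros k; apply lambert_term_bound; unfold r in *; lra|].
    eexists; exact G.
  - rewrite (is_series_unique _ _ G). assert (I : / (1 - r) <= 2) by (replace 2 with (/ (1 / 2)) by field; apply Rinv_le_contravar; lra).
    assert (0 < / (1 - r)) by (apply Rinv_0_lt_compat; lra).
    assert (r * / (1 - r) <= 2 * r) by nra.
    assert (0 <= r * / (1 - r)) by nra. nra.
Qed.

Lemma Clim_lambert_infty d : (0 < d)%nat -> Clim near_infty (fun tau => lambert (Ce (INR d * tau))) 0.
Proof.
  intros Hd e He. set (e' := Rmin (1 / 2) (e / 4)). assert (He' : 0 < e') by (apply Rmin_pos; lra).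
  exists (/ e'). intros tau Ht. assert (Pi : 0 < / e') by now apply Rinv_0_lt_compat.
  assert (D1 : 1 <= INR d) by (apply (le_INR 1); lia). assert (P2 := PI2_1).
  assert (K : Cmod (Ce (INR d * tau)) < e').
  { rewrite Cmod_Ce, im_scal_l. set (s := 2 * PI * (INR d * Im tau)).
    assert (Hs : / e' < s).
    { unfold s. assert (Im tau <= INR d * Im tau) by nra. nra. }
    rewrite exp_Ropp. generalize (exp_ineq1_le s). intros K.
    rewrite <- (Rinv_inv e'). apply Rinv_lt_contravar; [|lra]. apply Rmult_lt_0_compat; [exact Pi|apply exp_pos]. }
  replace (lambert (Ce (INR d * tau)) - 0)%C with (lambert (Ce (INR d * tau))) by ring.
  assert (M1 : e' <= 1 / 2) by apply Rmin_l. assert (M2 : e' <= e / 4) by apply Rmin_r.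
  eapply Rle_lt_trans; [apply lambert_small|]; lra.
Qed.

Lemma log_etaq_infty l r : all_pos l -> Clim near_infty (fun tau => log_etaq l r tau -
  RtoC (2 * PI * (IZR (Zsum (map (fun d => Z.of_nat d * r d)%Z l)) / 24)) * Ci * tau)%C 0.
Proof.
  induction l as [|d l IH]; intros Hl.
  - apply Clim_ext with (fun _ => 0); [apply near_infty_filter| |apply Clim_const, near_infty_filter].
    intros tau. unfold log_etaq. simpl. replace (2 * PI * (0 / 24)) with 0 by field. ring.
  - apply all_pos_cons in Hl. destruct Hl as [Hd Hl]. specialize (IH Hl).
    set (S0 := Zsum (map (fun d => (Z.of_nat d * r d)%Z) l)) in *.
    apply Clim_ext with (fun tau => IZR (- r d) * lambert (Ce (INR d * tau)) +
      (log_etaq l r tau - RtoC (2 * PI * (IZR S0 / 24)) * Ci * tau))%C; [apply near_infty_filter| |].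
    + intros tau. cbn [map]. rewrite Zsum_cons. fold S0. rewrite plus_IZR, mult_IZR, <- INR_IZR_INZ, opp_IZR.
      replace (2 * PI * ((INR d * IZR (r d) + IZR S0) / 24)) with
        (2 * PI * (IZR S0 / 24) + 2 * PI * (/ 24) * (INR d * IZR (r d))) by field.
      rewrite RtoC_plus.
      replace (RtoC (2 * PI * / 24 * (INR d * IZR (r d)))) with (RtoC (2 * PI) * / RtoC 24 * (INR d * IZR (r d)))%C
        by (rewrite <- RtoC_inv, <- !RtoC_mult by lra; reflexivity).
      change (log_etaq (d :: l) r tau) with (IZR (r d) * log_eta (INR d * tau) + log_etaq l r tau)%C.
      unfold log_eta. rewrite RtoC_opp. field.
    + apply Clim_eq with (IZR (- r d) * 0 + 0)%C; [ring|].
      apply Clim_plus; [apply near_infty_filter| |exact IH].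
      apply Clim_mult; [apply near_infty_filter|apply Clim_const, near_infty_filter|now apply Clim_lambert_infty].
Qed.

(** [log_etaq] is the required branch: its difference from 2 pi i h tau is a combination of Lambert
    series in e(d tau), which tend to 0. The congruence modulo 24 makes h an integer. *)
Lemma etaq_complex_power l r n : all_pos l -> (24 | Zsum (map (fun d => Z.of_nat d * r d)%Z l))%Z ->
  is_complex_power (etaq l r) (INR n) (etaq l (fun d => Z.of_nat n * r d)%Z).
Proof.
  intros Hl [h Hh]. split; [now apply etaq_meromorphic|]. exists h, (log_etaq l r). split.
  - apply near_infty_in_H. intros tau H. split; [|split].
    + destruct (Cder_log_etaq l r tau Hl H) as [m Hm]. apply Ccont_continuous. now apply Cder_cont with m.
    + now apply etaq_exp.
    + rewrite etaq_pow, etaq_exp by assumption. symmetry. apply Cexp_INR.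
  - intros e He. generalize (log_etaq_infty l r Hl e He). apply filter_imp. intros tau. rewrite Hh, mult_IZR.
    replace (IZR h * 24 / 24) with (IZR h) by field.
    intros K. eapply Rle_lt_trans; [|exact K]. right. f_equal. ring.
Qed.

Theorem theorem1p13 (N : nat) (r : nat -> Z)
  (hN : (0 < N)%nat) (hr : eta_quotient_cond N r) :
  mult_hecke_eigenform_wt N (eta_twice_weight N r) (eta_quotient N r) /\
  (Z.Even (eta_twice_weight N r) ->
   mult_hecke_eigenform N (eta_quotient N r)).
Proof.
  assert (H : mult_hecke_eigenform_wt N (eta_twice_weight N r) (eta_quotient N r)).
  { split; [now apply eta_quotient_modular_form|]. intros p Hp HpN.
    assert (Hl := divisors_pos N).
    (* The eigenvalue p + 1 is the number of matrices in T(p). *)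
    exists (INR (S p)), (etaq (divisors N) (fun d => Z.of_nat (S p) * r d)%Z). split.
    - apply etaq_is_hecke; [exact Hp|exact Hl| |apply hr]. intros d Hd Hpd. apply HpN.
      apply Nat.divide_trans with d; [exact Hpd|now apply In_divisors].
    - apply etaq_complex_power; [exact Hl|apply hr]. }
  split; [exact H|]. intros [k Hk]. exists k. now rewrite <- Hk.
Qed.
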